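(* Let $E$ be a metrizable real Hausdorff locally convex topological vector space, $(M,\mathcal{A})$ a finite-dimensional (say $n$-dimensional) $C^\infty$-manifold with rough boundary, and $A\subseteq M$ a closed subset. Assume that one of the following two conditions holds: (a) $M$ is $C^\infty$-paracompact and $A$ is locally compact. (b) $M$ is regular (as a topological space) and $A$ is compact. Then the continuous linear map \[\rho^\infty_{A,M}\colon C^\infty(M,E)\to\mathcal{E}^\infty_M(A,E),\quad f\mapsto\big((\partial^\alpha(f\circ\varphi^{-1}))|_{\varphi(A\cap U_\varphi)}\big)_{\varphi\in\mathcal{A},\,\alpha\in(\mathbb{N}_0)^n}\] is surjective.
   Context: Below $k=\infty$ is the case relevant to the claim. $\mathbb{N}=\{1,2,\dots\}$, $\mathbb{N}_0=\mathbb{N}\cup\{0\}$, $\|\cdot\|$ is the Euclidean norm; $\alpha,\beta,\gamma$ denote multi-indices. Subsets carry induced topologies, products product topologies. Sets. A subset $U\subseteq\mathbb{R}^n$ is locally convex if each $x\in U$ has a convex neighbourhood in $U$. It has dense interior if its interior $U^\circ$ in $\mathbb{R}^n$ is dense in $U$. $C^k$-functions. Let $U\subseteq\mathbb{R}^n$ be locally convex with dense interior, $F$ a locally convex space. $f\colon U\to F$ is $C^0$ if continuous. For $k\in\mathbb{N}\cup\{\infty\}$, $f$ is $C^k$ if $f$ is continuous and for all $l\in\mathbb{N}$, $l\le k$, the iterated directional derivatives $d^{(l)}f(x,y_1,\dots,y_l)=(D_{y_l}\cdots D_{y_1}f)(x)$, $(D_yf)(x)=\lim_{t\to0}\frac{f(x+ty)-f(x)}{t}$,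 exist for $x\in U^\circ$, $y_i\in\mathbb{R}^n$, and $d^{(l)}f\colon U^\circ\times(\mathbb{R}^n)^l\to F$ is continuous with a continuous extension to $U\times(\mathbb{R}^n)^l$. For $|\alpha|\le k$, $\partial^\alpha f\colon U\to F$ is the continuous extension of the iterated partial derivative of $f|_{U^\circ}$. $C^k(U,E)$ carries the topology generated by the seminorms $\|f\|_{C^l,q,K}=\max_{|\alpha|\le l}\sup_{x\in K}q(\partial^\alpha f(x))$, $l\in\mathbb{N}_0$, $l\le k$, $q$ a continuous seminorm on $E$, $K\subseteq U$ compact. Whitney jets in $\mathbb{R}^n$. For any $B\subseteq\mathbb{R}^n$, a $k$-jet on $B$ is a family $f=(f_\alpha)_{|\alpha|\le k}$ of functions $f_\alpha\colon B\to E$. For $l\in\mathbb{N}_0$, $l\le k$, $|\alpha|\le l$, $x,y\in B$ put $R_y^{l-|\alpha|}\partial^\alpha f(x)=f_\alpha(x)-\sum_{|\beta|\le l-|\alpha|}\frac{(x-y)^\beta}{\beta!}f_{\alpha+\beta}(y)$. $f$ is a Whitney $k$-jet if for all such $l,\alpha$, continuous seminorms $q$ on $E$, compact $K\subseteq B$, $\varepsilon>0$ there is $\delta>0$ with $q(R_y^{l-|\alpha|}\partial^\alpha f(x))\le\varepsilon\|x-y\|^{l-|\alpha|}$ for all $x,y\in K$ with $0<\|x-y\|<\delta$. $\mathcal{E}^k(B,E)$ is the space of Whitney $k$-jets, with the locally convex topology generated by the seminorms $\max_{|\alpha|\le l}\sup_{x\in K}q(f_\alpha(x))+\max_{|\alpha|\le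 l}\sup\{q(R_y^{l-|\alpha|}\partial^\alpha f(x))/\|x-y\|^{l-|\alpha|}\colon x\ne y\text{ in }K\}$ for $l,q,K$ as before. Restriction of jets is componentwise. Faà di Bruno polynomials. Let $s,t\in\mathbb{N}$, $0\ne\alpha\in(\mathbb{N}_0)^s$, $m=|\alpha|$, and let $j_1\le\dots\le j_m$ in $\{1,\dots,s\}$ be the numbers such that each $r$ occurs exactly $\alpha_r$ times. For nonempty $I\subseteq\{1,\dots,m\}$ let $(I)\in(\mathbb{N}_0)^s$ have $r$-th component $|\{i\in I\colon j_i=r\}|$. For $0\ne\beta\in(\mathbb{N}_0)^t$ with $j=|\beta|\le|\alpha|$ and real $x=(x_{\gamma,i})_{|\gamma|\le|\alpha|,1\le i\le t}$ ($\gamma\in(\mathbb{N}_0)^s$) put $p_{\alpha,\beta}(x)=\sum_{\{I_1,\dots,I_j\}}\sum_{(i_1,\dots,i_j)}x_{(I_1),i_1}\cdots x_{(I_j),i_j}$, the first sum over partitions of $\{1,\dots,m\}$ into $j$ nonempty disjoint sets, the second over $i_1,\dots,i_j\in\{1,\dots,t\}$ with $|\{l\colon i_l=r\}|=\beta_r$ for all $r$. Put $p_{\alpha,0}=0$ for $\alpha\ne0$ and $p_{0,0}=1$. Pull-back. For a $C^k$-function $g\colon U\to V$ between locally convex sets with dense interior $U\subseteq\mathbb{R}^s$, $V\subseteq\mathbb{R}^t$, and $A'\subseteq U$, $B'\subseteq V$ with $g(A')\subseteq B'$, let $g^*f=(g|_{A'})^*(f)$ for a $k$-jet $f$ on $B'$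 be the $k$-jet on $A'$ with components $x\mapsto\sum_{|\beta|\le|\alpha|}p_{\alpha,\beta}((\partial^\gamma g(x))_{|\gamma|\le|\alpha|})f_\beta(g(x))$, where $(\partial^\gamma g(x))_\gamma$ is identified with the tuple $(\partial^\gamma g_i(x))_{\gamma,i}$. Manifolds. An $n$-dimensional $C^k$-manifold with rough boundary is a Hausdorff space $M$ with a maximal $C^k$-atlas $\mathcal{A}$ of homeomorphisms (charts) $\varphi\colon U_\varphi\to V_\varphi$ from open sets $U_\varphi\subseteq M$ onto locally convex subsets $V_\varphi\subseteq\mathbb{R}^n$ with dense interior, where a $C^k$-atlas satisfies: the $U_\varphi$ cover $M$; all transition maps $\varphi\circ\psi^{-1}\colon\psi(U_\varphi\cap U_\psi)\to V_\varphi$ are $C^k$; and for $x\in U_\varphi\cap U_\psi$, $\varphi(x)\in\partial V_\varphi$ iff $\psi(x)\in\partial V_\psi$ (where $\partial V=\overline V\setminus V^\circ$). A function $f\colon M\to F$ into a locally convex space is $C^k$ if it is continuous and $f\circ\varphi^{-1}\colon V_\varphi\to F$ is $C^k$ for each chart. $C^k(M,E)$ carries the compact-open $C^k$-topology, generated by the finite sums of the seminorms $f\mapsto\|f\circ\varphi^{-1}\|_{C^l,q,\varphi(K)}$ ($l\in\mathbb{N}_0$, $l\le k$, $q$ a continuous seminorm on $E$, $\varphi\in\mathcal{A}$, $K\subseteq U_\varphi$ compact). $M$ is $C^k$-paracompact if for each open cover $(U_j)_{j\in J}$ of $M$ there is a locally finite partition of unity $(h_j)_{j\in J}$ on $M$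 consisting of $C^k$-functions with $\mathrm{supp}(h_j)\subseteq U_j$ for all $j$. A topological space is regular if it is Hausdorff and every neighbourhood of a point contains a closed neighbourhood of it. Whitney jets on $A\subseteq M$. Jets $f_\varphi\in\mathcal{E}^k(\varphi(A\cap U_\varphi),E)$ and $f_\psi\in\mathcal{E}^k(\psi(A\cap U_\psi),E)$ correspond, $f_\varphi\sim f_\psi$, if $(\psi\circ\varphi^{-1})^*(f_\psi|_{\psi(A\cap U_\varphi\cap U_\psi)})=f_\varphi|_{\varphi(A\cap U_\varphi\cap U_\psi)}$. $\mathcal{E}^k_M(A,E)$ is the topological vector subspace of $\prod_{\varphi\in\mathcal{A}}\mathcal{E}^k(\varphi(A\cap U_\varphi),E)$ of all families $(f_\varphi)_{\varphi\in\mathcal{A}}$ with $f_\varphi\sim f_\psi$ for all $\varphi,\psi\in\mathcal{A}$. *)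

(* Defs.v *)
From HB Require Import structures.
From mathcomp Require Import all_boot all_order all_algebra.
From mathcomp Require mpoly.
(* The multinomials notations clash with those of the analysis library; only
   the multi-indices [multinom n], [bmultinom n b] (degree < b), [mdeg] and
   [mnm_add] are used. *)
Import -(notations) mpoly.
From mathcomp Require Import all_classical all_reals.
From mathcomp Require Import topology convex normedtype.

Set Implicit Arguments.
Unset Strict Implicit.
Unset Printing Implicit Defensive.

Import Order.TTheory GRing.Theory Num.Theory.
Import numFieldNormedType.Exports.

Local Open Scope classical_set_scope.
Local Open Scope ring_scope.

(* Stated through the topology only: the uniform structure of a [tvsType] is
   not required to be translation invariant. *)
Definition metrizable (R : realType) (T : topologicalType) : Prop :=
  exists d : T -> T -> R,
    [/\ forall x y, 0 <= d x y,
        forall x y, d x y = 0 <-> x = y,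
        forall x y, d x y = d y x,
        forall x y z, d x z <= d x y + d y z &
        forall x, nbhs x =
          filter_from [set e : R | 0 < e] (fun e => [set y | d x y < e])].

Definition continuous_seminorm (R : realType) (E : tvsType R) (q : E -> R) :=
  [/\ forall x y, q (x + y) <= q x + q y,
      forall (a : R) x, q (a *: x) = `|a| * q x &
      continuous (q : E -> R^o)].

(* The topology generated by a family [P] of functions which are seminorms on
   the linear subspace [X] of [W] (elsewhere their values are irrelevant). It
   is only meaningful on [X], hence the centres of the balls lie in [X]. *)
Definition seminorm_topology (R : realType) (W : lmodType R) (X : set W)
  (P : set (W -> R)) : Type := W.

HB.instance Definition _ (R : realType) (W : lmodType R) (X : set W)
    (P : set (W -> R)) := Choice.copy (seminorm_topology X P) W.

HB.instance Definition _ (R : realType) (W : lmodType R) (X : set W)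
    (P : set (W -> R)) :=
  isSubBaseTopological.Build (seminorm_topology X P)
    [set B : set W | exists (x : W) (p : W -> R) (e : R),
      [/\ X x, P p, 0 < e & B = [set y | p (y - x) < e]]]
    id.

Definition euclidean_norm (R : realType) (n : nat) (x : 'rV[R]_n) : R :=
  Num.sqrt (\sum_(i < n) x 0 i ^+ 2).

Definition locally_convex_set (R : realType) (n : nat) (U : set 'rV[R]_n) :=
  forall x, U x -> exists C : set 'rV[R]_n,
    [/\ convex_set C, C `<=` U & within U (nbhs x) C].

Definition dense_interior (R : realType) (n : nat) (U : set 'rV[R]_n) :=
  U `<=` closure U°.

Definition boundary (R : realType) (n : nat) (U : set 'rV[R]_n) :=
  closure U `\` U°.

(* The same difference quotient as for [derive] and [derivable], which the
   library restricts to values in normed modules. A [tvsType] is not pointed,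
   so that [lim] is not available either. *)
Definition dquot (R : realType) (n : nat) (F : tvsType R) (f : 'rV[R]_n -> F)
    (x v : 'rV[R]_n) (h : R) : F :=
  h^-1 *: (f (h *: v + x) - f x).

Definition dir_derivable (R : realType) (n : nat) (F : tvsType R)
    (f : 'rV[R]_n -> F) (x v : 'rV[R]_n) : Prop :=
  exists l : F, dquot f x v h @[h --> (0 : R)^'] --> l.

Definition dir_derive (R : realType) (n : nat) (F : tvsType R)
    (f : 'rV[R]_n -> F) (v x : 'rV[R]_n) : F :=
  xget 0 [set l : F | dquot f x v h @[h --> (0 : R)^'] --> l].

(* [:: y_1; ..; y_l] |-> D_{y_l} .. D_{y_1} f *)
Definition iter_derive (R : realType) (n : nat) (F : tvsType R)
    (f : 'rV[R]_n -> F) (ys : seq 'rV[R]_n) : 'rV[R]_n -> F :=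
  foldl (@dir_derive R n F) f ys.

(* The l-tuple (y_1, .., y_l) of vectors is given by the rows of a matrix. *)
Definition dl (R : realType) (n : nat) (F : tvsType R) (f : 'rV[R]_n -> F)
    (l : nat) (xy : 'rV[R]_n * 'M[R]_(l, n)) : F :=
  iter_derive f [seq row i xy.2 | i <- enum 'I_l] xy.1.

(* Functions on U are represented by total functions whose values outside U
   are irrelevant; derivatives are only taken at interior points of U. *)
Definition smooth_on (R : realType) (n : nat) (F : tvsType R)
    (U : set 'rV[R]_n) (f : 'rV[R]_n -> F) : Prop :=
  [/\ {within U, continuous f},
      forall ys y x, U° x -> dir_derivable (iter_derive f ys) x y &
      forall l, (0 < l)%N ->
        {within U° `*` setT, continuous (@dl R n F f l)} /\
        exists g : 'rV[R]_n * 'M[R]_(l, n) -> F,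
          {within U `*` setT, continuous g} /\
          (forall xy, U° xy.1 -> g xy = dl f xy)].

(* The nondecreasing sequence j_1 <= .. <= j_m, m = |a|, in which each index r
   occurs exactly a_r times. *)
Definition mnm_seq (n : nat) (a : multinom n) : seq 'I_n :=
  flatten [seq nseq (a r) r | r <- enum 'I_n].

(* The continuous extension to U of the iterated partial derivative of f on
   the interior of U, set to 0 outside U. *)
Definition partial (R : realType) (n : nat) (F : tvsType R)
    (U : set 'rV[R]_n) (f : 'rV[R]_n -> F) (a : multinom n) : 'rV[R]_n -> F :=
  xget (fun=> 0) [set g | [/\ {within U, continuous g},
    forall x, U° x ->
      g x = iter_derive f [seq delta_mx 0 i | i <- mnm_seq a] x &
    forall x, ~ U x -> g x = 0]].

(* The suprema are those of sets of nonnegative reals, with sup set0 = 0; they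
   are finite when f is smooth on U and K is a compact subset of U. *)
Definition smooth_seminorm (R : realType) (n : nat) (F : tvsType R)
    (U : set 'rV[R]_n) (l : nat) (q : F -> R) (K : set 'rV[R]_n)
    (f : 'rV[R]_n -> F) : R :=
  \big[Num.max/0]_(a : bmultinom n l.+1) sup [set q (partial U f a x) | x in K].

(* Jets on B are extended by 0 outside B, so that equality of jets is equality
   of functions. *)
Notation jet R n E := (multinom n -> 'rV[R]_n -> E).

(* R_y^(l - |a|) d^a f (x) *)
Definition remainder (R : realType) (n : nat) (E : tvsType R) (f : jet R n E)
    (l : nat) (a : multinom n) (y x : 'rV[R]_n) : E :=
  f a x - \sum_(b : bmultinom n (l - mdeg a).+1)
    ((\prod_(i < n) (x - y) 0 i ^+ b i) / (\prod_(i < n) (b i)`!)%N%:R) *: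
      f (mnm_add a b) y.

Definition whitney_jets (R : realType) (n : nat) (E : tvsType R)
    (B : set 'rV[R]_n) : set (jet R n E) :=
  [set f | (forall a x, ~ B x -> f a x = 0) /\
    forall (l : nat) (a : multinom n) (q : E -> R) (K : set 'rV[R]_n) (e : R),
      (mdeg a <= l)%N -> continuous_seminorm q -> compact K -> K `<=` B ->
      0 < e ->
      exists2 d : R, 0 < d & forall x y, K x -> K y ->
        0 < euclidean_norm (x - y) < d ->
        q (remainder f l a y x) <= e * euclidean_norm (x - y) ^+ (l - mdeg a)].
Arguments whitney_jets {R n} E B.

Definition whitney_seminorm (R : realType) (n : nat) (E : tvsType R)
    (l : nat) (q : E -> R) (K : set 'rV[R]_n)
    (f : jet R n E) : R :=
  \big[Num.max/0]_(a : bmultinom n l.+1) sup [set q (f a x) | x in K] +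
  \big[Num.max/0]_(a : bmultinom n l.+1)
    sup [set q (remainder f l a xy.2 xy.1) /
             euclidean_norm (xy.1 - xy.2) ^+ (l - mdeg a) |
         xy in [set xy | [/\ K xy.1, K xy.2 & xy.1 <> xy.2]]].

Definition whitney_seminorms (R : realType) (n : nat) (E : tvsType R)
    (B : set 'rV[R]_n) : set (jet R n E -> R) :=
  [set p | exists (l : nat) (q : E -> R) (K : set 'rV[R]_n),
    [/\ continuous_seminorm q, compact K, K `<=` B &
        p = whitney_seminorm l q K]].
Arguments whitney_seminorms {R n} E B.

(* The multi-index (I), for a set I of positions in j_1 <= .. <= j_m. *)
Definition block_mnm (s : nat) (a : multinom s) (I : {set 'I_(mdeg a)}) :
    multinom s :=
  Multinom [tuple #|[pred i in I | onth (mnm_seq a) i == Some r]| | r < s].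

(* The value of p_{a,b} at the real family (x_{c,i}). A partition of the set of
   positions into |b| blocks is enumerated by [enum_val]. *)
Definition faa_di_bruno (R : realType) (s t : nat) (a : multinom s)
    (b : multinom t) (x : multinom s -> 'I_t -> R) : R :=
  if mdeg b == 0 then (mdeg a == 0)%:R else
  \sum_(P : {set {set 'I_(mdeg a)}} |
          finset.partition P [set: 'I_(mdeg a)]%SET && (#|P| == mdeg b))
    \sum_(i : {ffun 'I_#|P| -> 'I_t} |
            [forall r, #|[pred l | i l == r]| == b r])
      \prod_(l < #|P|) x (block_mnm (enum_val l)) (i l).

Definition pullback (R : realType) (s t : nat) (E : tvsType R)
    (U : set 'rV[R]_s) (g : 'rV[R]_s -> 'rV[R]_t) (f : jet R t E) : jet R s E :=
  fun a x => \sum_(b : bmultinom t (mdeg a).+1)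
    faa_di_bruno a b (fun c i => partial U g c x 0 i) *: f b (g x).

(* A chart is determined by its domain and its map, where the latter vanishes
   outside the domain (see [is_chart]). *)
Record chart (R : realType) (n : nat) (M : topologicalType) := Chart {
  chart_dom : set M;
  chart_map :> M -> 'rV[R]_n }.

Definition chart_cod (R : realType) (n : nat) (M : topologicalType)
  (phi : chart R n M) : set 'rV[R]_n := phi @` chart_dom phi.

(* f o phi^-1, extended by 0 outside the codomain of phi. The definition does
   not need M to be inhabited. *)
Definition in_chart (R : realType) (n : nat) (M : topologicalType)
    (F : zmodType) (phi : chart R n M) (f : M -> F) (v : 'rV[R]_n) : F :=
  xget 0 [set f x | x in [set x | chart_dom phi x /\ phi x = v]].

Definition is_chart (R : realType) (n : nat) (M : topologicalType)
    (phi : chart R n M) : Prop :=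
  [/\ open (chart_dom phi),
      locally_convex_set (chart_cod phi) /\ dense_interior (chart_cod phi),
      set_inj (chart_dom phi) phi /\ {within chart_dom phi, continuous phi},
      forall O : set M, open O -> O `<=` chart_dom phi ->
        exists2 W : set 'rV[R]_n, open W & phi @` O = chart_cod phi `&` W &
      forall x, ~ chart_dom phi x -> phi x = 0].

Definition smooth_transition (R : realType) (n : nat) (M : topologicalType)
    (phi psi : chart R n M) : Prop :=
  smooth_on (phi @` (chart_dom phi `&` chart_dom psi)) (in_chart phi psi) /\
  forall x, chart_dom phi x -> chart_dom psi x ->
    (boundary (chart_cod phi) (phi x) <-> boundary (chart_cod psi) (psi x)).

Definition smooth_atlas (R : realType) (n : nat) (M : topologicalType)
    (A : set (chart R n M)) : Prop :=
  [/\ forall phi, A phi -> is_chart phi,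
      forall x, exists2 phi, A phi & chart_dom phi x &
      forall phi psi, A phi -> A psi -> smooth_transition phi psi].

Definition rough_manifold (R : realType) (n : nat) (M : topologicalType)
    (A : set (chart R n M)) : Prop :=
  [/\ hausdorff_space M, smooth_atlas A &
      forall B, smooth_atlas B -> A `<=` B -> B = A].

Definition smooth_functions (R : realType) (n : nat) (M : topologicalType)
    (A : set (chart R n M)) (F : tvsType R) : set (M -> F) :=
  [set f | continuous f /\
    forall phi, A phi -> smooth_on (chart_cod phi) (in_chart phi f)].
Arguments smooth_functions {R n M} A F.

Definition smooth_seminorms (R : realType) (n : nat) (M : topologicalType)
    (A : set (chart R n M)) (F : tvsType R) : set ((M -> F) -> R) :=
  [set p | exists (l : nat) (q : F -> R) (phi : chart R n M) (K : set M),
    [/\ continuous_seminorm q, A phi, compact K, K `<=` chart_dom phi &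
        p = fun f => smooth_seminorm (chart_cod phi) l q (phi @` K)
                       (in_chart phi f)]].
Arguments smooth_seminorms {R n M} A F.

Definition supp (R : realType) (M : topologicalType) (h : M -> R) : set M :=
  closure [set x | h x != 0].

(* Index sets may be assumed to be choice types: classically, every type carries
   such a structure. *)
Definition smoothly_paracompact (R : realType) (n : nat) (M : topologicalType)
    (A : set (chart R n M)) : Prop :=
  forall (J : choiceType) (U : J -> set M),
    (forall j, open (U j)) -> \bigcup_j U j = setT ->
    exists h : J -> M -> R,
      [/\ forall j, smooth_functions A R^o (h j),
          forall j x, 0 <= h j x,
          forall x : M, exists2 N, nbhs x N &
            finite_set [set j | supp (h j) `&` N !=set0],
          forall x, \sum_(j \in [set: J]) h j x = 1 &
          forall j, supp (h j) `<=` U j].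

Definition jets_correspond (R : realType) (n : nat) (M : topologicalType)
    (E : tvsType R) (S : set M) (phi psi : chart R n M)
    (fphi fpsi : jet R n E) : Prop :=
  forall a v,
    (phi @` (S `&` chart_dom phi `&` chart_dom psi)) v ->
    pullback (phi @` (chart_dom phi `&` chart_dom psi)) (in_chart phi psi)
      fpsi a v = fphi a v.

Definition jet_dom (R : realType) (n : nat) (M : topologicalType)
  (S : set M) (phi : chart R n M) : set 'rV[R]_n :=
  phi @` (S `&` chart_dom phi).

Definition manifold_jets (R : realType) (n : nat) (M : topologicalType)
    (A : set (chart R n M)) (E : tvsType R) (S : set M) :
    set (A -> jet R n E) :=
  [set f | (forall phi : A, whitney_jets E (jet_dom S (\val phi)) (f phi)) /\
    forall phi psi : A,
      jets_correspond S (\val phi) (\val psi) (f phi) (f psi)].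
Arguments manifold_jets {R n M} A E S.

Definition restriction_map (R : realType) (n : nat) (M : topologicalType)
    (A : set (chart R n M)) (E : tvsType R) (S : set M) (f : M -> E) :
    A -> jet R n E :=
  fun phi a => patch (fun=> 0) (jet_dom S (\val phi))
    (partial (chart_cod (\val phi)) (in_chart (\val phi) f) a).
Arguments restriction_map {R n M} A E S f _ _ _.

(* C^oo(M, F) and the product of the spaces of Whitney jets over all charts;
   only the topology on the subspaces [smooth_functions A F] and
   [manifold_jets S] is meaningful. *)
Definition smooth_space (R : realType) (n : nat) (M : topologicalType)
    (A : set (chart R n M)) (F : tvsType R) : topologicalType :=
  seminorm_topology (smooth_functions A F) (smooth_seminorms A F).

Definition whitney_space (R : realType) (n : nat) (E : tvsType R)
    (B : set 'rV[R]_n) : topologicalType :=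
  seminorm_topology (whitney_jets E B) (whitney_seminorms E B).

Definition jet_product_space (R : realType) (n : nat) (M : topologicalType)
    (A : set (chart R n M)) (E : tvsType R) (S : set M) : topologicalType :=
  prod_topology (fun phi : A => whitney_space E (jet_dom S (\val phi))).

(* Main.v *)
Require Import Defs.
From mathcomp Require Import all_boot all_order all_algebra.
From mathcomp Require mpoly.
Import -(notations) mpoly.
From mathcomp Require Import finmap.
From mathcomp Require Import all_classical all_reals.
From mathcomp Require Import interval_inference.
From mathcomp Require Import topology convex normedtype.
From mathcomp Require Import derive sequences realfun exp.
From mathcomp Require Import ring lra.

Set Implicit Arguments.
Unset Strict Implicit.
Unset Printing Implicit Defensive.

Import Order.TTheory GRing.Theory Num.Theory.
Import numFieldNormedType.Exports.

Local Open Scope classical_set_scope.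
Local Open Scope ring_scope.


(** Derivatives are handled by jets indexed by finite sequences of directions
([LJ]): such a family is closed under products and composition, is determined by
its first member on a set with dense interior, and exists exactly for smooth
functions ([smooth_on_jet], [jet_smooth_on]).

The restriction map is well defined and continuous because of Taylor's formula. In a
locally convex set with dense interior, close points span triangles that lie in the
interior up to one side ([locally_star]); along these the mean value inequality gives
bounds for the Taylor remainders of a smooth function by its derivatives, up to the
boundary ([smooth_whitney], [whitney_bound]). Jets in two charts correspond since the
polynomials that define the pull-back are those of the iterated chain rule
([pullback_compL]).

Surjectivity rests on Whitney's extension theorem for a compact subset K of R^n
([whitney_extension]). At the scale 2^-m, Taylor polynomials of the jet at points of K
are glued with bumps on a lattice of mesh 2^-m, and the approximations of successive
scales are glued to each other, so that a point x at a distance r from K sees only the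
scales 2^-m close to r. Two Taylor polynomials of order k used at x differ by o(r^k),
while s derivatives of the bumps cost r^-s. For jets of infinite order the order used at
scale m has to tend to infinity with m; since the topology of E is given by a sequence
of seminorms, it can do so slowly enough for the uncontrolled terms of high order to be
absorbed by one power of 2^-m ([order_exists]).

On the manifold, both conditions on M and A yield a locally finite family of smooth
functions h_j with sum 1 near A, each supported in a chart domain and meeting A in a
compact set ([paracompact_partition], [compact_partition]). The extensions F_j obtained
in the charts are glued to the sum of the h_j F_j. At a point of A, Leibniz' rule
shows that its jet is the product of the jet of the sum of the h_j, which is the jet of
the constant 1, with the prescribed jet ([restriction_surj]). *)

(** * Continuous seminorms *)

Section LimitsInTvs.
Variables (R : realType) (E : tvsType R) (T : Type) (F : set_system T).
Context {FF : Filter F}.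

Lemma tvs_cvgD (f g : T -> E) (a b : E) :
  f @ F --> a -> g @ F --> b -> (fun t => f t + g t) @ F --> a + b.
Proof.
move=> fa gb; apply: (@cvg_comp _ _ _ (fun t => (f t, g t))
  (fun z : E * E => z.1 + z.2) _ (nbhs (a, b))); first exact: cvg_pair.
exact: (@add_continuous E (a, b)).
Qed.

Lemma tvs_cvgB (f g : T -> E) (a b : E) :
  f @ F --> a -> g @ F --> b -> (fun t => f t - g t) @ F --> a - b.
Proof.
move=> fa gb; apply: (@cvg_comp _ _ _ (fun t => (f t, g t))
  (fun z : E * E => z.1 - z.2) _ (nbhs (a, b))); first exact: cvg_pair.
exact: (@sub_continuous E (a, b)).
Qed.

Lemma tvs_cvgZ (f : T -> R) (g : T -> E) (a : R) (b : E) :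
  f @ F --> a -> g @ F --> b -> (fun t => f t *: g t) @ F --> a *: b.
Proof.
move=> fa gb; apply: (@cvg_comp _ _ _ (fun t => (f t, g t))
  (fun z : R^o * E => z.1 *: z.2) _ (nbhs ((a : R^o), b))).
  exact: (@cvg_pair _ _ _ _ (nbhs (a : R^o)) (nbhs b)).
exact: (@scale_continuous R E ((a : R^o), b)).
Qed.

Lemma tvs_cvg_sum (I : Type) (r : seq I) (P : pred I) (f : I -> T -> E)
    (a : I -> E) : (forall i, P i -> f i @ F --> a i) ->
  (fun t => \sum_(i <- r | P i) f i t) @ F --> \sum_(i <- r | P i) a i.
Proof.
move=> fa; elim: r => [|i r ih].
  under eq_fun do rewrite big_nil.
  by rewrite big_nil; exact: cvg_cst.
under eq_fun do rewrite big_cons.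
rewrite big_cons; case: ifPn => // Pi.
by apply: tvs_cvgD => //; exact: fa.
Qed.

End LimitsInTvs.

Section Seminorms.
Variables (R : realType) (E : tvsType R).
Implicit Types (q : E -> R) (x y : E).

Lemma csemi0 q : continuous_seminorm q -> q 0 = 0.
Proof. by case=> _ qZ _; rewrite -(scale0r (0 : E)) qZ normr0 mul0r. Qed.

Lemma csemiD q x y : continuous_seminorm q -> q (x + y) <= q x + q y.
Proof. by case. Qed.

Lemma csemiZ q (a : R) x : continuous_seminorm q -> q (a *: x) = `|a| * q x.
Proof. by case. Qed.

Lemma csemiN q x : continuous_seminorm q -> q (- x) = q x.
Proof. by move=> qs; rewrite -scaleN1r csemiZ// normrN1 mul1r. Qed.

Lemma csemi_ge0 q x : continuous_seminorm q -> 0 <= q x.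
Proof.
move=> qs; have := csemiD x (- x) qs.
by rewrite subrr csemi0// csemiN// -mulr2n pmulrn_lge0.
Qed.

Lemma csemiB q x y : continuous_seminorm q -> q (x - y) <= q x + q y.
Proof. by move=> qs; rewrite -(csemiN y qs); exact: csemiD. Qed.

Lemma csemiC q x y : continuous_seminorm q -> q (x - y) = q (y - x).
Proof. by move=> qs; rewrite -opprB csemiN. Qed.

Lemma csemi_tri q x y z : continuous_seminorm q ->
  q (x - z) <= q (x - y) + q (y - z).
Proof. by move=> qs; rewrite -(subrKA y); exact: csemiD. Qed.

Lemma csemi_sum q (I : Type) (r : seq I) (P : pred I) (f : I -> E) :
  continuous_seminorm q ->
  q (\sum_(i <- r | P i) f i) <= \sum_(i <- r | P i) q (f i).
Proof.
move=> qs; elim/big_ind2: _ => [|a b c d ab cd|//]; first by rewrite csemi0.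
by apply: le_trans (csemiD _ _ qs) _; exact: lerD.
Qed.

Lemma csemi_cvg0 q x : continuous_seminorm q -> forall e, 0 < e ->
  \forall y \near x, q (y - x) < e.
Proof.
move=> qs e e0; have [_ _ qc] := qs.
have : q (y - x) @[y --> x] --> (0 : R^o).
  rewrite -(csemi0 qs) -(subrr x).
  apply: (@cvg_comp _ _ _ (fun y => y - x) q _ (nbhs (x - x))); last exact: qc.
  by apply: tvs_cvgB; [exact: cvg_id|exact: cvg_cst].
move=> /cvgr0Pnorm_lt /(_ _ e0); apply: filterS => y.
by rewrite ger0_norm// csemi_ge0.
Qed.

Lemma csemi_add q1 q2 : continuous_seminorm q1 -> continuous_seminorm q2 ->
  continuous_seminorm (fun x => q1 x + q2 x).
Proof.
move=> q1s q2s; split=> [x y|a x|x].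
- by rewrite addrACA; apply: lerD; exact: csemiD.
- by rewrite !csemiZ// mulrDr.
- case: q1s => _ _ /(_ x) c1; case: q2s => _ _ /(_ x) c2.
  exact: (@tvs_cvgD R R^o _ _ _ q1 q2).
Qed.

(* continuity at the origin suffices *)
Lemma csemi_mk q : (forall x y, q (x + y) <= q x + q y) ->
  (forall (a : R) x, q (a *: x) = `|a| * q x) ->
  (forall e, 0 < e -> \forall x \near (0 : E), q x < e) ->
  continuous_seminorm q.
Proof.
move=> qD qZ q0; split=> // x.
have qN y : q (- y) = q y by rewrite -scaleN1r qZ normrN1 mul1r.
have sub : (fun y => y - x) @ x --> (0 : E).
  rewrite -(subrr x).
  by apply: tvs_cvgB; [exact: cvg_id|exact: cvg_cst].
apply/cvgrPdist_lt => e e0; near=> y.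
have : q (y - x) < e by near: y; exact: (sub _ (q0 _ e0)).
apply: le_lt_trans; rewrite ler_norml; apply/andP; split.
  have := qD (y - x) x; rewrite subrK => h.
  by rewrite lerNl opprB lerBlDr.
have := qD (x - y) y; rewrite subrK -opprB qN => h.
by rewrite lerBlDr.
Unshelve. all: by end_near. Qed.

Lemma convex_setP (V : lmodType R) (C : set V) :
  convex_set C <-> forall (x y : V) (t : R), C x -> C y -> 0 <= t <= 1 ->
    C (t *: x + (1 - t) *: y).
Proof.
split=> [cC x y t Cx Cy /andP[t0 t1]|cC x y l].
  by have := cC x y (Itv01 t0 t1) (mem_set Cx) (mem_set Cy); rewrite inE.
rewrite !inE => Cx Cy; have := cC x y l%:num Cx Cy; apply.
by rewrite ge0 le1.
Qed.

Lemma scale_cvg0 x : (fun t : R => t *: x) @ (0 : R) --> (0 : E).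
Proof.
rewrite -[in X in _ --> X](scale0r x).
by apply: tvs_cvgZ; [exact: cvg_id|exact: cvg_cst].
Qed.

(** The Minkowski gauge of a convex symmetric neighbourhood inside N is a continuous
seminorm; hence neighbourhoods, and limits, can be tested with seminorms only. *)
Lemma csemi_nbhs (N : set E) : nbhs (0 : E) N ->
  exists q, continuous_seminorm q /\ forall x, q x < 1 -> N x.
Proof.
move=> N0; have [B Bc [Bo Bb]] := @locally_convex R E.
have [C [BC C0] CN] : filter_from [set U | B U /\ U (0 : E)] id N by exact: Bb.
have Cc : convex_set C by apply: Bc; rewrite inE.
pose D : set E := [set x | C x /\ C (- x)].
have nC : nbhs (0 : E) C by apply: open_nbhs_nbhs; split => //; exact: Bo.
have nD : nbhs (0 : E) D.
  apply: filterI => //; have := @opp_continuous E 0 C; rewrite oppr0; exact.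
have D0 : D 0 by split => //; rewrite oppr0.
have Dc x y (t : R) : D x -> D y -> 0 <= t <= 1 -> D (t *: x + (1 - t) *: y).
  move=> [Cx Cx'] [Cy Cy'] t01; split; first exact: (convex_setP C).1.
  by rewrite opprD -!scalerN; exact: (convex_setP C).1.
have DZ x (t : R) : D x -> 0 <= t <= 1 -> D (t *: x).
  by move=> Dx t01; have := Dc x 0 t Dx D0 t01; rewrite scaler0 addr0.
pose S x := [set t : R | 0 < t /\ D (t^-1 *: x)].
have Slb x : lbound (S x) 0 by move=> t [/ltW].
have Sne x : S x !=set0.
  have /nbhs_ballP[e /= e0 he] := scale_cvg0 x nD.
  exists (2 / e); split; first by rewrite divr_gt0.
  rewrite invf_div; apply: he; rewrite -ball_normE/= sub0r normrN gtr0_norm.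
    by rewrite ltr_pdivrMr// ltr_pMr// ltr1n.
  by rewrite divr_gt0.
have Sinf x : has_inf (S x) by split => //; exists 0.
pose q x := inf (S x).
have qle x t : S x t -> q x <= t by move=> St; apply: ge_inf => //; exists 0.
have q_lt x t : q x < t -> S x t.
  move=> /(inf_lt (Sne x))[s [s0 Ds] st]; split; first exact: lt_trans st.
  have t0 := lt_trans s0 st.
  have -> : t^-1 *: x = (s / t) *: (s^-1 *: x).
    by rewrite scalerA mulrAC divff ?mul1r// gt_eqF.
  apply: DZ => //; rewrite (divr_ge0 (ltW s0) (ltW t0))/= ler_pdivrMr// mul1r; exact: ltW.
have q0le x : 0 <= q x by apply: lb_le_inf.
have q0 : q 0 = 0.
  apply/eqP; rewrite eq_le q0le andbT; apply/ler_addgt0Pr => e e0.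
  by rewrite add0r; apply: qle; split => //; rewrite scaler0.
have qZp (a : R) x : 0 < a -> q (a *: x) <= a * q x.
  move=> a0; rewrite -ler_pdivrMl//; apply: lb_le_inf => // t [t0 Dt].
  rewrite ler_pdivrMl//; apply: qle; split; first exact: mulr_gt0.
  by rewrite scalerA invfM mulrAC mulVf ?mul1r// gt_eqF.
have qZp' (a : R) x : 0 < a -> q (a *: x) = a * q x.
  move=> a0; apply/eqP; rewrite eq_le qZp//=.
  have := @qZp a^-1 (a *: x); rewrite invr_gt0 => /(_ a0).
  by rewrite scalerA mulVf ?gt_eqF// scale1r ler_pdivlMl.
have qN x : q (- x) = q x.
  congr (inf _); apply/seteqP; split => t [t0 [D1 D2]]; split => //; split.
  - by move: D2; rewrite -scalerN opprK.
  - by move: D1; rewrite -scalerN.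
  - by move: D2; rewrite -scalerN.
  - by move: D1; rewrite -scalerN opprK.
exists q; split; last first.
  move=> x /q_lt[_]; rewrite invr1 scale1r => -[Cx _]; exact: CN.
apply: csemi_mk.
- move=> x y; apply/ler_addgt0Pr => e e0.
  have e2 : 0 < e / 2 by rewrite divr_gt0.
  have [s0 Ds] : S x (q x + e / 2) by apply: q_lt; rewrite ltrDl.
  have [t0 Dt] : S y (q y + e / 2) by apply: q_lt; rewrite ltrDl.
  have -> : q x + q y + e = (q x + e / 2) + (q y + e / 2).
    by rewrite addrACA -splitr.
  move: Ds Dt s0 t0; set s := q x + _; set t := q y + _ => Ds Dt s0 t0.
  have st0 : 0 < s + t by rewrite addr_gt0.
  apply: qle; split => //.
  have -> : (s + t)^-1 *: (x + y) =
      (s / (s + t)) *: (s^-1 *: x) + (1 - s / (s + t)) *: (t^-1 *: y).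
    have -> : 1 - s / (s + t) = t / (s + t).
      by rewrite -{1}(divff (lt0r_neq0 st0)) -mulrBl addrAC subrr add0r.
    by rewrite !scalerA scalerDr; congr (_ *: _ + _ *: _);
      rewrite mulrAC divff ?mul1r// gt_eqF.
  apply: Dc => //; rewrite (divr_ge0 (ltW s0) (ltW st0))/= ler_pdivrMr// mul1r.
  by rewrite lerDl ltW.
- move=> a x; have [a0|a0|->] := ltgtP a 0.
  + by rewrite ltr0_norm// -qZp' ?oppr_gt0// scaleNr qN.
  + by rewrite gtr0_norm// qZp'.
  + by rewrite scale0r q0 normr0 mul0r.
- move=> e e0.
  have he : 0 < e / 2 by rewrite divr_gt0.
  have sc : (fun x : E => (e / 2)^-1 *: x) @ (0 : E) --> (e / 2)^-1 *: (0 : E).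
    by apply: (@tvs_cvgZ R E _ _ _ (fun=> (e / 2)^-1) id);
      [exact: cvg_cst|exact: cvg_id].
  rewrite scaler0 in sc; near=> x.
  have Dx : D ((e / 2)^-1 *: x) by near: x; exact: (sc _ nD).
  apply: (@le_lt_trans _ _ (e / 2)); first exact: qle.
  by rewrite ltr_pdivrMr// ltr_pMr// ltr1n.
Unshelve. all: by end_near. Qed.

Lemma csemi_nbhsP x (N : set E) : nbhs x N ->
  exists q, continuous_seminorm q /\ forall y, q (y - x) < 1 -> N y.
Proof.
move=> Nx.
have add : (fun y => y + x) @ (0 : E) --> x.
  rewrite -[in X in _ --> X](add0r x).
  by apply: tvs_cvgD; [exact: cvg_id|exact: cvg_cst].
have [q [qs qN]] := csemi_nbhs (add _ Nx).
by exists q; split => // y /qN/=; rewrite subrK.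
Qed.

Lemma csemi_cvgP (T : Type) (F : set_system T) (f : T -> E) l : Filter F ->
  f @ F --> l <-> forall q, continuous_seminorm q -> forall e, 0 < e ->
    \forall t \near F, q (f t - l) < e.
Proof.
move=> FF; split=> [fl q qs e e0|h N /csemi_nbhsP[q [qs qN]]].
  exact: (fl _ (csemi_cvg0 l qs e0)).
have := h q qs 1 ltr01; apply: filterS => t; exact: qN.
Qed.

Lemma csemi_eq0 x : hausdorff_space E ->
  (forall q, continuous_seminorm q -> q x = 0) -> x = 0.
Proof.
move=> Eh h; apply: Eh => P Q Px Q0.
have [q [qs qN]] := csemi_nbhs Q0.
exists x; split; first exact: nbhs_singleton.
by apply: qN; rewrite h.
Qed.

(** Scaling x turns a comparison of unit balls into a comparison of seminorms. *)
Lemma csemi_le q p : continuous_seminorm q -> continuous_seminorm p ->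
  (forall x, p x < 1 -> q x < 1) -> forall x, q x <= p x.
Proof.
move=> qs ps h x; apply/ler_addgt0Pr => e e0.
have t0 : 0 < p x + e by rewrite ltr_wpDl// csemi_ge0.
have := h ((p x + e)^-1 *: x); rewrite !csemiZ// gtr0_norm ?invr_gt0//.
rewrite -![_^-1 * _]mulrC !ltr_pdivrMr// !mul1r ltrDl => /(_ e0); exact: ltW.
Qed.

(** A metrizable topology has a countable base at the origin; summing the
gauges of its members gives an increasing dominating sequence. *)
Lemma metrizable_csemi : metrizable R E ->
  exists Q : nat -> E -> R,
    [/\ forall k, continuous_seminorm (Q k),
        forall k l x, (k <= l)%N -> Q k x <= Q l x &
        forall q, continuous_seminorm q -> exists k, forall x, q x <= Q k x].
Proof.
move=> [d [_ _ _ _ dn]].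
have dk k : nbhs (0 : E) [set y | d 0 y < k.+1%:R^-1].
  by rewrite dn; exists (k.+1%:R^-1) => //=.
have /choice[p pP] k := csemi_nbhs (dk k).
pose Q k x := \sum_(i < k.+1) p i x.
have ps k := (pP k).1.
exists Q; split.
- elim=> [|k ih].
    have -> : Q 0 = p 0%N by apply/funext => x; rewrite /Q big_ord_recl big_ord0 addr0.
    exact: ps.
  have -> : Q k.+1 = (fun x => Q k x + p k.+1 x).
    by apply/funext => x; rewrite /Q big_ord_recr.
  exact: csemi_add.
- move=> k l x /subnK <-; elim: (l - k)%N => [//|j ih].
  apply: (le_trans ih); rewrite addSn [leRHS]/Q big_ord_recr/= lerDl.
  exact: csemi_ge0.
- move=> q qs.
  have [e /= e0 he] : filter_from [set e : R | 0 < e]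
      (fun e => [set y | d 0 y < e]) [set y | q (y - 0) < 1].
    by rewrite -dn; exact: csemi_cvg0.
  have [k ke] : exists k, k.+1%:R^-1 < e.
    have [k] := ltr_add_invr e0; rewrite add0r => ke; by exists k.
  exists k => x; apply: (@le_trans _ _ (p k x)).
    apply: csemi_le => // y /(pP k).2/= dy; have := he y; rewrite /= subr0; apply.
    exact: lt_trans ke.
  rewrite /Q big_ord_recr/= lerDr; apply: sumr_ge0 => i _; exact: csemi_ge0.
Qed.

End Seminorms.

Lemma csemi_norm (R : realType) (V : normedModType R) :
  continuous_seminorm (fun x : V => `|x|).
Proof.
split; [exact: ler_normD|by move=> a x; exact: normrZ|exact: norm_continuous].
Qed.

(** * Directional derivatives and the mean value inequality *)

Lemma near_seq (T : Type) (F : set_system T) (FF : Filter F) (I : eqType)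
    (r : seq I) (P : I -> T -> Prop) :
  (forall i, i \in r -> \forall t \near F, P i t) ->
  \forall t \near F, forall i, i \in r -> P i t.
Proof.
elim: r => [|i r ih] H; first by near=> t.
have Hi := H i (mem_head i r).
have Hr : \forall t \near F, forall j, j \in r -> P j t.
  by apply: ih => j jr; apply: H; rewrite inE jr orbT.
near=> t => j; rewrite inE => /orP[/eqP ->|jr]; first by near: t.
by move: j jr; near: t.
Unshelve. all: by end_near. Qed.

Lemma near_fin (T : Type) (F : set_system T) (FF : Filter F) (I : finType)
    (P : I -> T -> Prop) :
  (forall i, \forall t \near F, P i t) -> \forall t \near F, forall i, P i t.
Proof.
move=> H; have := near_seq FF (r := enum I) (fun i _ => H i).
by apply: filterS => t h i; apply: h; rewrite mem_enum.
Qed.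

Lemma subrBB (V : zmodType) (a b c d : V) : a - b - (c - d) = a - c - (b - d).
Proof. by rewrite !opprB addrACA [RHS]addrACA [- b - c]addrC. Qed.

Section RowVectors.
Variables (R : realType) (n : nat).
Implicit Types x y : 'rV[R]_n.

Definition ei (i : 'I_n) : 'rV[R]_n := delta_mx 0 i.

Lemma rv_coord_le x i : `|x 0 i| <= `|x|.
Proof.
by rewrite [leRHS]/Num.Def.normr/= mx_normrE; apply/bigmax_geP; right => /=; exists (0, i).
Qed.

Lemma rv_norm_le x (c : R) : 0 <= c -> (forall i, `|x 0 i| <= c) -> `|x| <= c.
Proof.
move=> c0 h; rewrite [leLHS]/Num.Def.normr/= mx_normrE; apply/bigmax_leP; split => //.
by move=> [a i] _ /=; rewrite ord1.
Qed.

Lemma norm_ei_le i : `|ei i| <= 1.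
Proof.
apply: rv_norm_le => // j; rewrite mxE eqxx/=.
by case: (j == i); rewrite ?normr1 ?normr0.
Qed.

Lemma interior_nbhs (U : set 'rV[R]_n) x : U° x -> nbhs x U°.
Proof. by move=> Ux; apply: open_nbhs_nbhs; split => //; exact: open_interior. Qed.

End RowVectors.

Section Derivatives.
Variables (R : realType) (E : tvsType R) (n : nat).
Implicit Types (f g : 'rV[R]_n -> E) (x v : 'rV[R]_n) (U : set 'rV[R]_n).

(** Continuity of the restriction of f to U. *)
Definition cont_in U f := forall x, U x -> f @ within U (nbhs x) --> f x.

(** l is the derivative of f at x in the direction v; the increments are compared with
h *: l by seminorms, so that no division by h occurs and h = 0 is harmless. *)
Definition dder f x v (l : E) := forall q, continuous_seminorm q ->
  forall e, 0 < e -> exists2 d, 0 < d & forall h : R, `|h| < d ->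
    q (f (h *: v + x) - f x - h *: l) <= e * `|h|.

Lemma dderP f x v l : dder f x v l <-> dquot f x v h @[h --> (0 : R)^'] --> l.
Proof.
split.
  move=> H; apply/csemi_cvgP => q qs e e0.
  have [d d0 hd] := H q qs (e / 2) (divr_gt0 e0 (ltr0Sn R 1)).
  near=> h.
  have h0 : h != 0 by near: h; exact: nbhs_dnbhs_neq.
  have hp : 0 < `|h| by rewrite normr_gt0.
  have -> : dquot f x v h - l = h^-1 *: (f (h *: v + x) - f x - h *: l).
    by rewrite /dquot [RHS]scalerBr scalerA mulVf// scale1r.
  rewrite csemiZ// normfV mulrC ltr_pdivrMr//.
  apply: le_lt_trans (hd h _) _.
    by near: h; apply: dnbhs0_lt.
  by rewrite ltr_pM2r// ltr_pdivrMr// ltr_pMr// ltr1n.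
move=> /csemi_cvgP H q qs e e0.
have := H q qs e e0; rewrite near_withinE => /nbhs_ballP[d /= d0 hd].
exists d => // h hh; have [->|h0] := eqVneq h 0.
  by rewrite !scale0r add0r subr0 subrr csemi0// normr0 mulr0.
have hp : 0 < `|h| by rewrite normr_gt0.
have : q (dquot f x v h - l) < e.
  by apply: hd => //; rewrite -ball_normE/= sub0r normrN.
have -> : dquot f x v h - l = h^-1 *: (f (h *: v + x) - f x - h *: l).
  by rewrite /dquot [RHS]scalerBr scalerA mulVf// scale1r.
by rewrite csemiZ// normfV mulrC ltr_pdivrMr// => /ltW.
Unshelve. all: by end_near. Qed.

Lemma dder_unique f x v l l' : hausdorff_space E ->
  dder f x v l -> dder f x v l' -> l = l'.
Proof.
move=> Eh /dderP fl /dderP fl'.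
exact: (@cvg_unique E Eh (dquot f x v @ (0 : R)^') _ _ _ fl fl').
Qed.

Lemma dder_near f g x v l : (\forall y \near x, f y = g y) ->
  dder f x v l -> dder g x v l.
Proof.
move=> /[dup] /nbhs_singleton fgx /nbhs_ballP[r /= r0 hr] H q qs e e0.
have [d d0 hd] := H q qs e e0.
have v0 : 0 < `|v| + 1 by rewrite ltr_wpDl.
exists (Num.min d (r / (`|v| + 1))).
  by rewrite lt_min d0 divr_gt0.
move=> h; rewrite lt_min => /andP[hd1 hd2].
rewrite -fgx -hr; first exact: hd.
rewrite -ball_normE/= opprD addrCA subrr addr0 normrN normrZ.
move: hd2; rewrite ltr_pdivlMr//; apply: le_lt_trans.
by rewrite ler_wpM2l// lerDl.
Qed.

Lemma dder_cst (c : E) x v : dder (fun=> c) x v 0.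
Proof.
move=> q qs e e0; exists 1 => // h _.
by rewrite subrr scaler0 subr0 csemi0// mulr_ge0// ltW.
Qed.

Lemma dder_add f g x v l l' : dder f x v l -> dder g x v l' ->
  dder (fun y => f y + g y) x v (l + l').
Proof.
move=> Hf Hg q qs e e0.
have [d d0 hd] := Hf q qs (e / 2) (divr_gt0 e0 (ltr0Sn R 1)).
have [d' d0' hd'] := Hg q qs (e / 2) (divr_gt0 e0 (ltr0Sn R 1)).
exists (Num.min d d'); first by rewrite lt_min d0.
move=> h; rewrite lt_min => /andP[/hd h1 /hd' h2].
have subACA (a b c u : E) : a + b - (c + u) = (a - c) + (b - u).
  by rewrite opprD addrACA.
rewrite scalerDr !subACA.
apply: le_trans (csemiD _ _ qs) _.
by rewrite (splitr e) mulrDl; exact: lerD.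
Qed.

Lemma dder_scale (c : R) f x v l : dder f x v l ->
  dder (fun y => c *: f y) x v (c *: l).
Proof.
move=> Hf q qs e e0.
have c0 : 0 < `|c| + 1 by rewrite ltr_wpDl.
have [d d0 hd] := Hf q qs (e / (`|c| + 1)) (divr_gt0 e0 c0).
exists d => // h /hd; rewrite scalerA [h * c]mulrC -scalerA -!scalerBr csemiZ//.
move=> H; apply: (@le_trans _ _ ((`|c| + 1) * (e / (`|c| + 1) * `|h|))).
  by apply: ler_pM => //; [exact: csemi_ge0|rewrite lerDl].
by rewrite mulrA [_ * (e / _)]mulrCA divff ?gt_eqF// mulr1.
Qed.

Lemma dder_opp f x v l : dder f x v l -> dder (fun y => - f y) x v (- l).
Proof.
move=> /(dder_scale (-1)); rewrite scaleN1r.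
by under eq_fun do rewrite scaleN1r.
Qed.

Lemma dder_sub f g x v l l' : dder f x v l -> dder g x v l' ->
  dder (fun y => f y - g y) x v (l - l').
Proof. by move=> Hf /dder_opp; exact: dder_add. Qed.

Lemma dder_sum (I : Type) (r : seq I) (P : pred I) (F : I -> 'rV[R]_n -> E)
    (l : I -> E) x v : (forall i, P i -> dder (F i) x v (l i)) ->
  dder (fun y => \sum_(i <- r | P i) F i y) x v (\sum_(i <- r | P i) l i).
Proof.
move=> H; elim: r => [|i r ih].
  rewrite big_nil; under eq_fun do rewrite big_nil.
  exact: dder_cst.
have [Pi|nPi] := boolP (P i).
  rewrite big_cons Pi; under eq_fun do rewrite big_cons Pi.
  exact: (dder_add (H _ Pi) ih).
rewrite big_cons (negbTE nPi); under eq_fun do rewrite big_cons (negbTE nPi).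
exact: ih.
Qed.

Lemma dder_dir (c : R) f x v l : dder f x v l -> dder f x (c *: v) (c *: l).
Proof.
move=> Hf q qs e e0.
have c0 : 0 < `|c| + 1 by rewrite ltr_wpDl.
have [d d0 hd] := Hf q qs (e / (`|c| + 1)) (divr_gt0 e0 c0).
exists (d / (`|c| + 1)); first exact: divr_gt0.
move=> h; rewrite ltr_pdivlMr// => hh.
rewrite !scalerA; apply: le_trans (hd _ _) _; rewrite normrM.
  by apply: le_lt_trans hh; rewrite ler_wpM2l// lerDl.
rewrite [ `|h| * _]mulrC mulrA ler_wpM2r// -mulrA ler_piMr ?(ltW e0)//.
by rewrite mulrC ler_pdivrMr// mul1r lerDl.
Qed.

Lemma cont_in_near U f x q e : cont_in U f -> continuous_seminorm q ->
  U x -> 0 < e -> \forall y \near x, U y -> q (f y - f x) < e.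
Proof.
move=> cf qs Ux e0; have /csemi_cvgP/(_ q qs e e0) := cf x Ux.
by rewrite near_withinE.
Qed.

Lemma cont_inP U f : cont_in U f <-> forall x q e, U x ->
  continuous_seminorm q -> 0 < e -> \forall y \near x, U y -> q (f y - f x) < e.
Proof.
split=> [cf x q e Ux qs e0|H x Ux]; first exact: cont_in_near.
by apply/csemi_cvgP => q qs e e0; rewrite near_withinE; exact: H.
Qed.

Lemma cont_in_int U f x q e : cont_in U f -> continuous_seminorm q ->
  U° x -> 0 < e -> \forall y \near x, q (f y - f x) < e.
Proof.
move=> cf qs Ux e0.
have := cont_in_near cf qs (interior_subset Ux) e0.
by apply: filterS2 Ux => y Uy /(_ Uy).
Qed.

(** If the increments of c around each t are at most (M + e)|s - t|, then so is
the global one: the set of t with |c t - c 0| at most (M + e)t is closed under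
suprema, and cannot have its supremum below 1. *)
Lemma mvi_unit q (c : R -> E) (M : R) : continuous_seminorm q ->
  (forall t e, 0 <= t <= 1 -> 0 < e -> exists2 d, 0 < d &
     forall s, 0 <= s <= 1 -> `|s - t| < d ->
       q (c s - c t) <= (M + e) * `|s - t|) ->
  q (c 1 - c 0) <= M.
Proof.
move=> qs H; apply/ler_addgt0Pr => e e0.
pose S := [set t | 0 <= t <= 1 /\ q (c t - c 0) <= (M + e) * t].
have S0 : S 0 by split; rewrite ?lexx ?ler01//= subrr csemi0// mulr0.
have Sb : has_sup S by split; [exists 0|exists 1 => t [/andP[]]].
pose t0 := sup S.
have t00 : 0 <= t0 by apply: ub_le_sup => //; exact: Sb.2.
have t01 : t0 <= 1 by apply: ge_sup => [|t [/andP[]]//]; exists 0.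
have [d d0 hd] := H t0 e (introT andP (conj t00 t01)) e0.
have St0 : S t0.
  split; first by rewrite t00.
  have [t St tt0] : exists2 t, S t & t0 - d < t.
    by apply: sup_adherent.
  have tle : t <= t0 by apply: ub_le_sup => //; exact: Sb.2.
  case: St => /andP[ta tb] qt.
  apply: le_trans (csemi_tri _ (c t) _ qs) _.
  apply: (@le_trans _ _ ((M + e) * (t0 - t) + (M + e) * t)); last first.
    by rewrite -mulrDr subrK.
  have tE : `|t - t0| = t0 - t by rewrite distrC ger0_norm// subr_ge0.
  apply: lerD => //; rewrite csemiC// -tE; apply: hd; first by rewrite ta.
  by rewrite tE ltrBlDr -ltrBlDl.
have [t1|t1] := ltP t0 1; last first.
  have -> : 1 = t0 by apply/eqP; rewrite eq_le t01 t1.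
  case: St0 => _ /le_trans; apply.
  suff -> : t0 = 1 by rewrite mulr1.
  by apply/eqP; rewrite eq_le t01 t1.
pose s := Num.min 1 (t0 + d / 2).
have d2 : 0 < d / 2 by rewrite divr_gt0.
have t0s : t0 < s by rewrite lt_min t1 ltrDl.
have s1 : s <= 1 by rewrite ge_min lexx.
have s0 : 0 <= s by apply: le_trans t00 (ltW t0s).
have sd : s - t0 < d.
  rewrite ltrBlDl gt_min; apply/orP; right.
  by rewrite ltrD2l ltr_pdivrMr// ltr_pMr// ltr1n.
have : s <= t0.
  apply: ub_le_sup; first exact: Sb.2.
  split; first by rewrite s0.
  apply: le_trans (csemi_tri _ (c t0) _ qs) _.
  apply: (@le_trans _ _ ((M + e) * (s - t0) + (M + e) * t0)); last first.
    by rewrite -mulrDr subrK.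
  apply: lerD; last by case: St0.
  have st0 : `|s - t0| = s - t0 by rewrite ger0_norm// subr_ge0 ltW.
  by rewrite -st0; apply: hd; rewrite ?s0 // st0.
by rewrite leNgt t0s.
Qed.

(** Mean value inequality: apply the previous lemma along t |-> t *: v + x, whose
increments are controlled by the derivatives in the direction v. *)
Lemma mvi_dir q f x v (d : R -> E) (M : R) : continuous_seminorm q ->
  (forall t, 0 <= t <= 1 -> dder f (t *: v + x) v (d t) /\ q (d t) <= M) ->
  q (f (v + x) - f x) <= M.
Proof.
move=> qs H.
have := @mvi_unit q (fun t => f (t *: v + x)) M qs.
rewrite scale1r scale0r add0r; apply=> t e t01 e0.
have [Hd HM] := H t t01.
have [r r0 hr] := Hd q qs e e0.
exists r => // s s01 /hr.
rewrite addrA -scalerDl subrK => hh.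
rewrite -(subrK ((s - t) *: d t) (f _ - _)).
apply: le_trans (csemiD _ _ qs) _.
rewrite addrC mulrDl; apply: lerD => //.
by rewrite csemiZ// mulrC ler_wpM2r.
Qed.

End Derivatives.

Section C1Functions.
Variables (R : realType) (E : tvsType R) (n : nat).
Implicit Types (g : 'rV[R]_n -> E) (gi : 'I_n -> 'rV[R]_n -> E).
Implicit Types (x y z v h : 'rV[R]_n) (O D : set 'rV[R]_n).

(** Continuous differentiability on O, with the gi as partial derivatives. *)
Definition C1 O g gi := forall x, O x ->
  (forall i, dder g x (ei R i) (gi i x)) /\
  forall i q e, continuous_seminorm q -> 0 < e ->
    \forall y \near x, q (gi i y - gi i x) < e.

Lemma dder_coord (c : E) i x : dder (fun y => y 0 i *: c) x (ei R i) c.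
Proof.
move=> q qs e e0; exists 1 => // h _.
rewrite -scalerBl -scalerBl !mxE !eqxx mulr1 addrK subrr scale0r csemi0//.
by rewrite mulr_ge0// ltW.
Qed.

(** The increment along h is split into n increments parallel to the axes, to
each of which the mean value inequality applies. *)
Lemma frechet O g gi x q e : open O -> C1 O g gi -> O x ->
  continuous_seminorm q -> 0 < e ->
  exists2 d, 0 < d & forall h, `|h| < d ->
    q (g (h + x) - g x - \sum_i h 0 i *: gi i x) <= e * `|h|.
Proof.
move=> Oo gC Ox qs e0.
pose e' := e / n.+1%:R.
have e'0 : 0 < e' by rewrite divr_gt0.
have : \forall y \near x, O y /\ forall i, q (gi i y - gi i x) < e'.
  apply: filterI; first by apply: open_nbhs_nbhs.
  apply: (@near_fin _ (nbhs x) _ _ (fun i y => q (gi i y - gi i x) < e')) => i.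
  exact: (gC x Ox).2.
move=> /nbhs_ballP[d /= d0 hd]; exists d => // h hh.
pose p (k : nat) : 'rV[R]_n := (\row_j (if (j < k)%N then h 0 j else 0)) + x.
have p0 : p 0%N = x by rewrite /p [X in X + _](_ : _ = 0) ?add0r//; apply/rowP => j; rewrite !mxE.
have pn : p n = h + x by congr (_ + _); apply/rowP => j; rewrite mxE ltn_ord.
have pS (k : 'I_n) : p k.+1 = h 0 k *: ei R k + p k.
  rewrite /p addrA; congr (_ + _); apply/rowP => j; rewrite !mxE eqxx/=.
  rewrite ltnS leq_eqVlt -val_eqE/=; case: eqP => [/val_inj ->|_] /=.
    by rewrite ltnn mulr1 addr0.
  by rewrite mulr0 add0r.
have pB (k : 'I_n) t : 0 <= t <= 1 -> ball x d (t *: (h 0 k *: ei R k) + p k).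
  move=> /andP[t0 t1]; rewrite -ball_normE/= distrC addrA addrK.
  apply: le_lt_trans hh; apply: rv_norm_le => // j.
  rewrite !mxE eqxx/=; have [jk|jk] := ltnP j k.
    by rewrite (_ : j == k = false) ?mulr0 ?add0r ?rv_coord_le// -val_eqE ltn_eqF.
  rewrite addr0; have [_|_] := eqVneq j k; last by rewrite !mulr0 normr0.
  rewrite mulr1 normrM ger0_norm//.
  by apply: le_trans (rv_coord_le h k); rewrite ler_piMl.
have step (k : 'I_n) :
    q (g (p k.+1) - g (p k) - h 0 k *: gi k x) <= e' * `|h|.
  have := @mvi_dir R E n q (fun y => g y - y 0 k *: gi k x) (p k)
    (h 0 k *: ei R k) (fun t => h 0 k *: (gi k (t *: (h 0 k *: ei R k) + p k) - gi k x))
    (e' * `|h|) qs.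
  rewrite -pS subrBB -scalerBl.
  have -> : (p k.+1) 0 k - (p k) 0 k = h 0 k.
    by rewrite pS mxE addrK !mxE !eqxx mulr1.
  apply => t t01; have [Oz zq] := hd _ (pB k t t01).
  split.
    apply: dder_dir; apply: dder_sub; last exact: dder_coord.
    exact: (gC _ Oz).1.
  rewrite csemiZ// mulrC; apply: ler_pM => //; first exact: csemi_ge0.
    exact: ltW.
  exact: rv_coord_le.
have -> : g (h + x) - g x - \sum_i h 0 i *: gi i x =
    \sum_(k < n) (g (p k.+1) - g (p k) - h 0 k *: gi k x).
  rewrite sumrB; congr (_ - _).
  by rewrite -(big_mkord xpredT (fun k => g (p k.+1) - g (p k))) telescope_sumr// pn p0.
apply: le_trans (csemi_sum _ _ _ qs) _.
apply: (@le_trans _ _ (\sum_(k < n) e' * `|h|)); first by apply: ler_sum.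
rewrite sumr_const card_ord -mulr_natl mulrA ler_wpM2r// /e' mulrCA ler_piMr//.
  exact: ltW.
by rewrite ler_pdivrMr// mul1r ler_nat.
Qed.

(** Continuous partial derivatives determine the derivative in every direction, by the
Frechet estimate. *)
Lemma dder_lin O g gi x v : open O -> C1 O g gi -> O x ->
  dder g x v (\sum_i v 0 i *: gi i x).
Proof.
move=> Oo gC Ox q qs e e0.
have v0 : 0 < `|v| + 1 by rewrite ltr_wpDl.
have [d d0 hd] := frechet Oo gC Ox qs (divr_gt0 e0 v0).
exists (d / (`|v| + 1)); first exact: divr_gt0.
move=> t; rewrite ltr_pdivlMr// => tt.
have := hd (t *: v); rewrite normrZ.
have -> : \sum_i (t *: v) 0 i *: gi i x = t *: \sum_i v 0 i *: gi i x.
  by rewrite scaler_sumr; apply: eq_bigr => i _; rewrite mxE scalerA.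
have tv : `|t| * `|v| <= `|t| * (`|v| + 1) by rewrite ler_wpM2l// lerDl.
move=> /(_ (le_lt_trans tv tt)) /le_trans; apply.
rewrite [ `|t| * _]mulrC mulrA ler_wpM2r// -mulrA ler_piMr ?(ltW e0)//.
by rewrite mulrC ler_pdivrMr// mul1r lerDl.
Qed.

Lemma mvi O g gi x y q M : open O -> C1 O g gi -> continuous_seminorm q ->
  (forall t, 0 <= t <= 1 -> O (t *: (y - x) + x)) ->
  (forall i t, 0 <= t <= 1 -> q (gi i (t *: (y - x) + x)) <= M) ->
  q (g y - g x) <= n%:R * M * `|y - x|.
Proof.
move=> Oo gC qs yO yM; rewrite -{1}(subrK x y).
apply: (@mvi_dir R E n q g x (y - x)
  (fun t => \sum_i (y - x) 0 i *: gi i (t *: (y - x) + x))) => // t t01.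
split; first exact: (dder_lin _ Oo gC (yO _ t01)).
apply: le_trans (csemi_sum _ _ _ qs) _.
apply: (@le_trans _ _ (\sum_(i < n) M * `|y - x|)); last first.
  by rewrite sumr_const card_ord -(mulr_natl (M * _)) mulrA.
apply: ler_sum => i _; rewrite csemiZ// mulrC; apply: ler_pM => //.
- exact: csemi_ge0.
- exact: yM.
- exact: rv_coord_le.
Qed.

(** Every segment from a point p of D to c lies in O, except possibly for p itself. *)
Definition star_center O D (c : 'rV[R]_n) :=
  D c /\ forall p t, D p -> 0 < t <= 1 -> O (t *: c + (1 - t) *: p).

Lemma cvg_segment x c : (fun t : R => t *: c + (1 - t) *: x) @ (0 : R) --> x.
Proof.
have h : (fun t : R => t *: c + (1 - t) *: x) @ (0 : R) -->
    (0 : R) *: c + (1 - 0) *: x.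
  apply: tvs_cvgD.
    by apply: tvs_cvgZ; [exact: cvg_id|exact: cvg_cst].
  apply: (@tvs_cvgZ R _ _ _ _ (fun t => 1 - t)); last exact: cvg_cst.
  by apply: cvgB; [exact: cvg_cst|exact: cvg_id].
by rewrite scale0r add0r subr0 scale1r in h.
Qed.

(** Mean value inequality on a convex set of which possibly only the part seen
from c lies in the open set: contract the segment towards c. *)
Lemma mvi_star O D g gi c q M : open O -> C1 O g gi ->
  convex_set D -> star_center O D c -> cont_in D g ->
  continuous_seminorm q -> 0 <= M ->
  (forall i z, D z -> O z -> q (gi i z) <= M) ->
  forall x y, D x -> D y -> q (g y - g x) <= n%:R * M * `|y - x|.
Proof.
move=> Oo gC /convex_setP Dc [Dcc cO] gc qs M0 HM x y Dx Dy.
apply/ler_addgt0Pr => e e0.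
have e2 : 0 < e / 2 by rewrite divr_gt0.
have cvx (z : 'rV[R]_n) : D z -> \forall t \near (0 : R)^'+,
    q (g (t *: c + (1 - t) *: z) - g z) < e / 2.
  move=> Dz; have H := cont_in_near gc qs Dz e2.
  have H1 : \forall t \near (0 : R), D (t *: c + (1 - t) *: z) ->
      q (g (t *: c + (1 - t) *: z) - g z) < e / 2 by exact: (@cvg_segment z c _ H).
  near=> t.
  have : D (t *: c + (1 - t) *: z) ->
      q (g (t *: c + (1 - t) *: z) - g z) < e / 2.
    by near: t; apply: cvg_within.
  by apply; apply: Dc => //; apply/andP; split => //; near: t; exact: nbhs_right_le.
near (0 : R)^'+ => t.
have t0 : 0 < t by [].
have t1 : t <= 1 by near: t; exact: nbhs_right_le.
have hx : q (g (t *: c + (1 - t) *: x) - g x) < e / 2.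
  by near: t; exact: cvx.
have hy : q (g (t *: c + (1 - t) *: y) - g y) < e / 2.
  by near: t; exact: cvx.
pose w (z : 'rV[R]_n) := t *: c + (1 - t) *: z.
have wE s : s *: (w y - w x) + w x = t *: c + (1 - t) *: (s *: y + (1 - s) *: x).
  rewrite /w opprD addrACA subrr add0r -scalerBr scalerA [s * _]mulrC -scalerA.
  rewrite addrCA -scalerDr; congr (_ + _ *: _).
  by rewrite scalerBr scalerBl scale1r -addrA [- _ + _]addrC.
have sD s : 0 <= s <= 1 -> D (s *: y + (1 - s) *: x) by exact: Dc.
have seg s : 0 <= s <= 1 -> O (s *: (w y - w x) + w x) /\
    D (s *: (w y - w x) + w x).
  move=> s01; rewrite wE; split; first by apply: cO; [exact: sD|rewrite t0].
  by apply: Dc => //; [exact: sD|rewrite (ltW t0)].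
have H : q (g (w y) - g (w x)) <= n%:R * M * `|w y - w x|.
  apply: (mvi Oo gC qs) => [s /seg[]//|i s /seg[sO sD']]; exact: HM.
apply: le_trans (csemi_tri _ (g (w y)) _ qs) _.
rewrite (splitr e) addrCA; apply: lerD; first by rewrite csemiC// ltW.
apply: le_trans (csemi_tri _ (g (w x)) _ qs) _.
apply: lerD; last exact: ltW.
apply: (le_trans H); rewrite ler_wpM2l ?mulr_ge0//.
rewrite /w opprD addrACA subrr add0r -scalerBr normrZ ger0_norm ?subr_ge0//.
by rewrite ler_piMl// gerBl ltW.
Unshelve. all: by end_near. Qed.

(** Symmetry of second derivatives: compare the second difference
f(x + s e_i + t e_j) - f(x + s e_i) - f(x + t e_j) + f(x) with st L by two mean
value inequalities, then divide by t and let t tend to 0. *)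
Lemma schwarz O (f fi fj fij : 'rV[R]_n -> E) i j x : open O -> O x ->
  (forall y, O y -> dder f y (ei R i) (fi y)) ->
  (forall y, O y -> dder f y (ei R j) (fj y)) ->
  (forall y, O y -> dder fi y (ei R j) (fij y)) ->
  (forall q e, continuous_seminorm q -> 0 < e ->
    \forall y \near x, q (fij y - fij x) < e) ->
  dder fj x (ei R i) (fij x).
Proof.
move=> Oo Ox Hi Hj Hij cij q qs e e0.
have : \forall y \near x, O y /\ q (fij y - fij x) < e.
  by apply: filterI; [exact: open_nbhs_nbhs|exact: cij].
move=> /nbhs_ballP[d /= d0 hd].
have d2 : 0 < d / 2 by rewrite divr_gt0.
exists (d / 2) => // s sd.
have inO (a b : R) : `|a| < d / 2 -> `|b| < d / 2 ->
    ball x d (a *: ei R i + (b *: ei R j + x)).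
  move=> ha hb; rewrite -ball_normE/= distrC addrA addrK.
  apply: le_lt_trans (ler_normD _ _) _; rewrite !normrZ (splitr d).
  apply: ltrD.
    by apply: le_lt_trans ha; rewrite ler_piMr// norm_ei_le.
  by apply: le_lt_trans hb; rewrite ler_piMr// norm_ei_le.
have sub (a t : R) : 0 <= t <= 1 -> `|a| < d / 2 -> `|t * a| < d / 2.
  move=> /andP[t0 t1]; apply: le_lt_trans; rewrite normrM ger0_norm//.
  by rewrite ler_piMl.
have dd0 : `|0 : R| < d / 2 by rewrite normr0.
(* the increment of fi along e_j *)
have step1 (a b : R) : `|a| < d / 2 -> `|b| < d / 2 ->
    q (fi (b *: ei R j + (a *: ei R i + x)) - fi (a *: ei R i + x) - b *: fij x) <=
    e * `|b|.
  move=> ha hb.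
  have := @mvi_dir R E n q (fun y => fi y - y 0 j *: fij x) (a *: ei R i + x)
    (b *: ei R j) (fun t => b *: (fij (t *: (b *: ei R j) + (a *: ei R i + x)) - fij x))
    (e * `|b|) qs.
  rewrite subrBB -scalerBl.
  set z := a *: ei R i + x.
  have -> : (b *: ei R j + z) 0 j - z 0 j = b.
    by rewrite mxE addrK !mxE !eqxx mulr1.
  apply => t t01.
  have zB : ball x d (t *: (b *: ei R j) + z).
    by rewrite /z scalerA addrCA; apply: inO => //; exact: sub.
  have [Oz zq] := hd _ zB.
  split.
    apply: dder_dir; apply: dder_sub; last exact: dder_coord.
    exact: Hij.
  by rewrite csemiZ// mulrC ler_wpM2r// ltW.
have step2 (b : R) : `|b| < d / 2 ->
    q (f (b *: ei R j + (s *: ei R i + x)) - f (s *: ei R i + x) -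
       (f (b *: ei R j + x) - f x) - s *: (b *: fij x)) <= e * `|b| * `|s|.
  move=> hb.
  have := @mvi_dir R E n q (fun y => f (b *: ei R j + y) - f y - y 0 i *: (b *: fij x)) x
    (s *: ei R i) (fun t => s *: (fi (b *: ei R j + (t *: (s *: ei R i) + x)) -
       fi (t *: (s *: ei R i) + x) - b *: fij x)) (e * `|b| * `|s|) qs.
  rewrite subrBB -scalerBl.
  have -> : (s *: ei R i + x) 0 i - x 0 i = s by rewrite mxE addrK !mxE !eqxx mulr1.
  apply => t t01; have ts : `|t * s| < d / 2 by exact: sub.
  have zB : ball x d (t *: (s *: ei R i) + x).
    by have := inO (t * s) 0 ts dd0; rewrite scale0r add0r scalerA.
  have zB' : ball x d (b *: ei R j + (t *: (s *: ei R i) + x)).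
    by have := inO (t * s) b ts hb; rewrite scalerA addrCA.
  split.
    apply: dder_dir; apply: dder_sub; last exact: dder_coord.
    apply: dder_sub; last exact: Hi (hd _ zB).1.
    move=> q' qs' e' e'0; have [r r0 hr] := Hi _ (hd _ zB').1 q' qs' e' e'0.
    by exists r => // h hh; rewrite addrCA; exact: hr.
  rewrite csemiZ// mulrC ler_wpM2r//.
  by rewrite scalerA; exact: step1.
apply/ler_addgt0Pr => eta eta0.
have eta2 : 0 < eta / 2 by rewrite divr_gt0.
have zO : O (s *: ei R i + x).
  by have := (hd _ (inO s 0 sd dd0)).1; rewrite scale0r add0r.
have [r1 r10 h1] := Hj _ zO q qs _ eta2.
have [r2 r20 h2] := Hj _ Ox q qs _ eta2.
pose r := Num.min (d / 2) (Num.min r1 r2).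
have r0 : 0 < r by rewrite !lt_min d2 r10.
pose b := r / 2.
have b0 : 0 < b by rewrite divr_gt0.
have bn : `|b| = b by rewrite gtr0_norm.
have br : `|b| < r by rewrite bn ltr_pdivrMr// ltr_pMr// ltr1n.
have [bd b1 b2] : [/\ `|b| < d / 2, `|b| < r1 & `|b| < r2].
  by move: br; rewrite !lt_min => /and3P[].
have := step2 b bd; have := h1 b b1; have := h2 b b2; rewrite bn.
set A := f _ - f _; set B := f _ - f _ => qA qB qAB.
rewrite -(ler_pM2l b0) mulrDr -(gtr0_norm b0) -csemiZ// (gtr0_norm b0).
have -> : b *: (fj (s *: ei R i + x) - fj x - s *: fij x) =
   - (B - b *: fj (s *: ei R i + x)) + ((A - b *: fj x) + (B - A - s *: (b *: fij x))).
  rewrite !scalerBr !scalerA [b * s]mulrC.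
  have idZ (P Q Z A' B' : E) : P - Q - Z = - (B' - P) + (A' - Q + (B' - A' - Z)).
    by rewrite opprB (addrACA A') (addrC A') subrK [RHS]addrA subrK addrA.
  exact: idZ.
apply: le_trans (csemiD _ _ qs) _; rewrite csemiN//.
have -> : b * (e * `|s|) + b * eta =
    eta / 2 * b + (eta / 2 * b + e * b * `|s|) by field.
apply: lerD => //; apply: le_trans (csemiD _ _ qs) _; exact: lerD.
Qed.

End C1Functions.

(** * Jets indexed by sequences of directions *)

Section Jets.
Variables (R : realType) (n : nat).
Implicit Types (U V O : set 'rV[R]_n) (x y : 'rV[R]_n) (s t : seq 'I_n).

(** L s is the derivative of L [::] in the directions s, applied from left to
right, up to order k. *)
Definition LJk (E : tvsType R) k U (L : seq 'I_n -> 'rV[R]_n -> E) :=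
  (forall s, (size s <= k)%N -> cont_in U (L s)) /\
  forall s i x, (size s < k)%N -> U° x ->
    dder (L s) x (ei R i) (L (rcons s i) x).

Definition LJ (E : tvsType R) U (L : seq 'I_n -> 'rV[R]_n -> E) :=
  forall k, LJk k U L.

Section Basics.
Variable E : tvsType R.
Implicit Types (L : seq 'I_n -> 'rV[R]_n -> E) (f g : 'rV[R]_n -> E).

Lemma LJ_mk U L : (forall s, cont_in U (L s)) ->
  (forall s i x, U° x -> dder (L s) x (ei R i) (L (rcons s i) x)) -> LJ U L.
Proof. by move=> h1 h2 k; split=> [s _|s i x _]; [exact: h1|exact: h2]. Qed.

Lemma LJ_cont U L s : LJ U L -> cont_in U (L s).
Proof. by move=> /(_ (size s))[+ _]; apply. Qed.
Arguments LJ_cont {U L} s.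

Lemma LJ_dder U L s i x : LJ U L -> U° x ->
  dder (L s) x (ei R i) (L (rcons s i) x).
Proof. by move=> /(_ (size s).+1)[_ +] Ux; apply. Qed.
Arguments LJ_dder {U L} s i {x}.

Lemma LJk_le k l U L : (k <= l)%N -> LJk l U L -> LJk k U L.
Proof.
move=> kl [c d]; split=> [s sk|s i x sk]; first by apply: c; exact: leq_trans kl.
by apply: d; exact: leq_trans kl.
Qed.

Lemma LJk_shift k U L i : LJk k.+1 U L -> LJk k U (fun s => L (i :: s)).
Proof. by move=> [c d]; split=> [s sk|s j x sk Ux]; [exact: c|exact: (d (i :: s))]. Qed.

Lemma LJ_shift U L i : LJ U L -> LJ U (fun s => L (i :: s)).
Proof. by move=> h k; apply: LJk_shift. Qed.

Lemma cont_in_sub U V f : U `<=` V -> cont_in V f -> cont_in U f.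
Proof.
move=> UV /cont_inP h; apply/cont_inP => x q e Ux qs e0.
have := h x q e (UV _ Ux) qs e0; apply: filterS => y + /UV; exact.
Qed.

Lemma LJ_sub U V L : U `<=` V -> LJ V L -> LJ U L.
Proof.
move=> UV h; apply: LJ_mk => [s|s i x /(interiorS UV)].
  exact: (cont_in_sub UV (LJ_cont s h)).
exact: LJ_dder.
Qed.

Lemma LJ_C1 U L s : LJ U L -> C1 U° (L s) (fun i => L (rcons s i)).
Proof.
move=> h x Ux; split=> [i|i q e qs e0]; first exact: LJ_dder.
exact: (cont_in_int (LJ_cont _ h) qs Ux e0).
Qed.

Lemma cont_in_add U f g : cont_in U f -> cont_in U g ->
  cont_in U (fun x => f x + g x).
Proof. by move=> cf cg x Ux; apply: tvs_cvgD; [exact: cf|exact: cg]. Qed.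

Lemma cont_in_scale U (u : 'rV[R]_n -> R^o) f : cont_in U u -> cont_in U f ->
  cont_in U (fun x => u x *: f x).
Proof. by move=> cf cg x Ux; apply: tvs_cvgZ; [exact: cf|exact: cg]. Qed.

Lemma cont_in_cst U (c : E) : cont_in U (fun=> c).
Proof. by move=> x Ux; exact: cvg_cst. Qed.

Lemma cont_in_sum U (I : Type) (r : seq I) (P : pred I)
    (F : I -> 'rV[R]_n -> E) : (forall i, P i -> cont_in U (F i)) ->
  cont_in U (fun x => \sum_(i <- r | P i) F i x).
Proof. by move=> cF x Ux; apply: tvs_cvg_sum => i Pi; exact: cF. Qed.

Lemma LJk_add k U L L' : LJk k U L -> LJk k U L' ->
  LJk k U (fun s x => L s x + L' s x).
Proof.
move=> [c d] [c' d']; split=> [s sk|s i x sk Ux].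
  by apply: cont_in_add; [exact: c|exact: c'].
exact: (dder_add (d _ _ _ sk Ux) (d' _ _ _ sk Ux)).
Qed.

Lemma LJk_scale (c : R) k U L : LJk k U L -> LJk k U (fun s x => c *: L s x).
Proof.
move=> [cL d]; split=> [s sk|s i x sk Ux].
  by apply: (@cont_in_scale _ (fun=> c)); [move=> x Ux; exact: cvg_cst|exact: cL].
exact: (dder_scale c (d _ _ _ sk Ux)).
Qed.

Lemma LJk_sum k U (I : Type) (r : seq I) (P : pred I)
    (F : I -> seq 'I_n -> 'rV[R]_n -> E) : (forall i, P i -> LJk k U (F i)) ->
  LJk k U (fun s x => \sum_(i <- r | P i) F i s x).
Proof.
move=> h; split=> [s sk|s i x sk Ux].
  by apply: cont_in_sum => i Pi; exact: (h i Pi).1.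
by apply: dder_sum => j Pj; exact: (h j Pj).2.
Qed.

Lemma LJ_near U L f x : LJ U L -> U° x -> (forall y, U° y -> L [::] y = f y) ->
  forall i, dder f x (ei R i) (L [:: i] x).
Proof.
move=> h Ux H i; apply: dder_near (LJ_dder [::] i h Ux).
by apply: filterS (interior_nbhs Ux) => y; exact: H.
Qed.

Lemma LJ_eq U L L' : (forall s x, U x -> L s x = L' s x) -> LJ U L -> LJ U L'.
Proof.
move=> H h; apply: LJ_mk => [s|s i x Ux].
  apply/cont_inP => x q e Ux qs e0.
  have := cont_in_near (LJ_cont s h) qs Ux e0; apply: filterS => y Hy Uy.
  by rewrite -!H//; exact: Hy.
rewrite -H; last exact: interior_subset.
apply: dder_near (LJ_dder s i h Ux).
by apply: filterS (interior_nbhs Ux) => y Uy; apply: H; exact: interior_subset.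
Qed.

Hypothesis Eh : hausdorff_space E.

(** A jet is determined in the interior by its component L [::], as derivatives are
unique in a Hausdorff space. *)
Lemma LJ_unique_int U L L' : LJ U L -> LJ U L' ->
  (forall x, U° x -> L [::] x = L' [::] x) ->
  forall s x, U° x -> L s x = L' s x.
Proof.
move=> h h' H; elim/last_ind=> [|s i ih] x Ux; first exact: H.
apply: (dder_unique Eh (LJ_dder s i h Ux)).
apply: dder_near (LJ_dder s i h' Ux).
by apply: filterS (interior_nbhs Ux) => y Uy; rewrite ih.
Qed.

Lemma dense_eq U f g : dense_interior U -> cont_in U f -> cont_in U g ->
  (forall x, U° x -> f x = g x) -> forall x, U x -> f x = g x.
Proof.
move=> Ud cf cg H x Ux; apply/eqP; rewrite -subr_eq0; apply/eqP.
apply: csemi_eq0 => // q qs; apply/eqP; rewrite eq_le csemi_ge0// andbT.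
apply/ler_addgt0Pr => e e0; rewrite add0r.
have e2 : 0 < e / 2 by rewrite divr_gt0.
have hf := cont_in_near cf qs Ux e2; have hg := cont_in_near cg qs Ux e2.
have [y [Uy [/(_ (interior_subset Uy)) fy /(_ (interior_subset Uy)) gy]]] :=
  Ud x Ux _ (filterI hf hg).
apply: le_trans (csemi_tri _ (f y) _ qs) _; rewrite (splitr e).
by apply: lerD; [rewrite csemiC// ltW|rewrite H// ltW].
Qed.

Lemma LJ_unique U L L' : dense_interior U -> LJ U L -> LJ U L' ->
  (forall x, U x -> L [::] x = L' [::] x) ->
  forall s x, U x -> L s x = L' s x.
Proof.
move=> Ud h h' H s; apply: dense_eq => //; [exact: LJ_cont|exact: LJ_cont|].
by apply: LJ_unique_int => // x Ux; apply: H; exact: interior_subset.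
Qed.

(** Jets are symmetric: two adjacent directions commute by Schwarz, hence any
direction can be moved to the end. *)
Lemma LJ_swap U L s t i j x : LJ U L -> U° x ->
  L (s ++ i :: j :: t) x = L (s ++ j :: i :: t) x.
Proof.
move=> h; elim/last_ind: t x => [|t k ih] x Ux; last first.
  rewrite -!rcons_cons -!rcons_cat.
  apply: (dder_unique Eh (LJ_dder _ k h Ux)).
  apply: (dder_near _ (LJ_dder _ k h Ux)).
  by apply: filterS (interior_nbhs Ux) => y Uy; rewrite ih.
have catE a b : s ++ [:: a; b] = rcons (rcons s a) b by rewrite -!cats1 -catA.
rewrite !catE; apply: (dder_unique Eh) (LJ_dder (rcons s j) i h Ux).
apply: (@schwarz R E n U° (L s) (L (rcons s i)) (L (rcons s j))
  (L (rcons (rcons s i) j)) i j x _ Ux).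
- exact: open_interior.
- by move=> y Uy; exact: LJ_dder.
- by move=> y Uy; exact: LJ_dder.
- by move=> y Uy; exact: LJ_dder.
- by move=> q e qs e0; exact: (cont_in_int (LJ_cont _ h) qs Ux e0).
Qed.

Lemma LJ_rot U L s t i x : LJ U L -> U° x ->
  L (s ++ i :: t) x = L (s ++ rcons t i) x.
Proof.
move=> h Ux; elim: t s => [//|j t ih] s.
by rewrite (@LJ_swap U L s t i j x h Ux); have := ih (rcons s j); rewrite !cat_rcons.
Qed.

Lemma LJ_perm_int U L s t x : LJ U L -> U° x -> perm_eq s t -> L s x = L t x.
Proof.
move=> h; elim/last_ind: t s x => [|t i ih] s x Ux.
  by move=> /perm_nilP ->.
move=> st; have : i \in s by rewrite (perm_mem st) mem_rcons mem_head.
move=> /splitPr/= si; case: si st => s1 s2 st.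
rewrite (@LJ_rot U L s1 s2 i x h Ux) -rcons_cat.
apply: (dder_unique Eh (LJ_dder _ i h Ux)).
apply: dder_near (LJ_dder _ i h Ux).
apply: filterS (interior_nbhs Ux) => y Uy; rewrite (ih (s1 ++ s2))//.
rewrite -(perm_cons i); apply: perm_trans (perm_trans st _).
  by rewrite -cat1s perm_catCA.
by rewrite perm_rcons.
Qed.

Lemma LJ_perm U L s t x : dense_interior U -> LJ U L -> U x -> perm_eq s t ->
  L s x = L t x.
Proof.
move=> Ud h Ux st; move: x Ux; apply: dense_eq => //; [exact: LJ_cont|exact: LJ_cont|].
by move=> x Ux; exact: (LJ_perm_int h Ux st).
Qed.

End Basics.

Section Products.
Variable E : tvsType R.

Lemma dder_prod (u : 'rV[R]_n -> R^o) (f : 'rV[R]_n -> E) x v (a : R^o) (b : E) :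
  dder u x v a -> dder f x v b ->
  dder (fun y => u y *: f y) x v (a *: f x + u x *: b).
Proof.
move=> Hu Hf; apply/dderP; move/dderP: Hf => Hf.
have ucont : u (h *: v + x) @[h --> (0 : R)^'] --> u x.
  have : h * dquot u x v h + u x @[h --> (0 : R)^'] --> 0 * a + u x.
    apply: (@tvs_cvgD R R^o); last exact: cvg_cst.
    apply: (@tvs_cvgZ R R^o); last by move/dderP: Hu.
    exact: cvg_within.
  rewrite mul0r add0r; apply: cvg_trans; apply: near_eq_cvg.
  near=> h; have h0 : h != 0 by near: h; exact: nbhs_dnbhs_neq.
  by rewrite /dquot /GRing.scale/= mulrA divff// mul1r subrK.
have : u (h *: v + x) *: dquot f x v h + dquot u x v h *: f x
    @[h --> (0 : R)^'] --> a *: f x + u x *: b.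
  rewrite addrC; apply: tvs_cvgD; apply: tvs_cvgZ => //; last exact: cvg_cst.
  by move/dderP: Hu.
apply: cvg_trans; apply: near_eq_cvg; near=> h.
have idt (c u1 u0 : R) (f1 f0 : E) :
    u1 *: (c *: (f1 - f0)) + (c * (u1 - u0)) *: f0 = c *: (u1 *: f1 - u0 *: f0).
  by rewrite scalerA [u1 * c]mulrC -!scalerA -scalerDr scalerBr scalerBl addrA subrK.
exact: idt.
Unshelve. all: by end_near. Qed.

(** The jet of a product at a point, by Leibniz' rule. *)
Fixpoint prodv (u : seq 'I_n -> R) (v : seq 'I_n -> E) s : E :=
  if s is i :: s' then prodv (fun t => u (i :: t)) v s' +
    prodv u (fun t => v (i :: t)) s' else u [::] *: v [::].

Definition prodL (u : seq 'I_n -> 'rV[R]_n -> R^o)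
    (v : seq 'I_n -> 'rV[R]_n -> E) s x := prodv (u ^~ x) (v ^~ x) s.

Lemma LJk_prod k U (u : seq 'I_n -> 'rV[R]_n -> R^o) (v : seq 'I_n -> 'rV[R]_n -> E) :
  LJk k U u -> LJk k U v -> LJk k U (prodL u v).
Proof.
suff H s : forall k u v, LJk k U u -> LJk k U v ->
    ((size s <= k)%N -> cont_in U (prodL u v s)) /\
    forall i x, (size s < k)%N -> U° x ->
       dder (prodL u v s) x (ei R i) (prodL u v (rcons s i) x).
  move=> Hu Hv; split=> [s|s i x]; have [h1 h2] := H s k u v Hu Hv; first exact: h1.
  exact: h2.
elim: s => [|j s ih] {}k {}u {}v Hu Hv; split.
- by move=> _; apply: cont_in_scale; [exact: Hu.1|exact: Hv.1].
- move=> i x k0 Ux /=; apply: dder_prod; [exact: (Hu.2 [::])|exact: (Hv.2 [::])].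
- case: k Hu Hv => [//|k] Hu Hv; rewrite ltnS => sk.
  apply: cont_in_add.
    exact: (ih k _ _ (LJk_shift j Hu) (LJk_le (leqnSn k) Hv)).1.
  exact: (ih k _ _ (LJk_le (leqnSn k) Hu) (LJk_shift j Hv)).1.
- case: k Hu Hv => [//|k] Hu Hv i x; rewrite ltnS => sk Ux.
  apply: dder_add.
    exact: (ih k _ _ (LJk_shift j Hu) (LJk_le (leqnSn k) Hv)).2.
  exact: (ih k _ _ (LJk_le (leqnSn k) Hu) (LJk_shift j Hv)).2.
Qed.

Lemma LJ_prod U u v : LJ U u -> LJ U v -> LJ U (prodL u v).
Proof. by move=> Hu Hv k; exact: LJk_prod. Qed.

Lemma prodv_ext u v u' v' s :
  (forall t, (size t <= size s)%N -> u t = u' t) ->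
  (forall t, (size t <= size s)%N -> v t = v' t) ->
  prodv u v s = prodv u' v' s.
Proof.
elim: s u v u' v' => [|i s ih] u v u' v' Hu Hv /=; first by rewrite Hu ?Hv.
by congr (_ + _); apply: ih => t ts; rewrite ?Hu ?Hv//; exact: leqW.
Qed.

(** Linearity in the first factor: the sum of a partition of unity can be taken before
the product with a fixed jet. *)
Lemma prodv_suml (I : Type) (r : seq I) (P : pred I) (u : I -> seq 'I_n -> R) v s :
  prodv (fun t => \sum_(i <- r | P i) u i t) v s =
  \sum_(i <- r | P i) prodv (u i) v s.
Proof.
elim: s u v => [|j s ih] u v /=; first by rewrite scaler_suml.
by rewrite ih (ih u) -big_split.
Qed.

Lemma prodvBr u v v' s : prodv u (fun t => v t - v' t) s = prodv u v s - prodv u v' s.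
Proof.
elim: s u v v' => [|j s ih] u v v' /=; first by rewrite scalerBr.
by rewrite !ih opprD addrACA.
Qed.

Lemma prodvBl u u' v s : prodv (fun t => u t - u' t) v s = prodv u v s - prodv u' v s.
Proof.
elim: s u u' v => [|j s ih] u u' v /=; first by rewrite scalerBl.
by rewrite !ih opprD addrACA.
Qed.

Lemma prodv0l u v s : (forall t, u t = 0) -> prodv u v s = 0.
Proof.
elim: s u v => [|j s ih] u v u0 /=; first by rewrite u0 scale0r.
by rewrite !ih// addr0.
Qed.

Lemma prodv0r u v s : (forall t, v t = 0) -> prodv u v s = 0.
Proof.
elim: s u v => [|j s ih] u v v0 /=; first by rewrite v0 scaler0.
by rewrite !ih// addr0.
Qed.

(** The jet of the constant function 1, a unit for prodv. *)
Definition one_jet s : R := (size s == 0%N)%:R.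

Lemma prodv1l u v s : (forall t, u t = one_jet t) -> prodv u v s = v s.
Proof.
elim: s u v => [|j s ih] u v u1 /=; first by rewrite u1 scale1r.
by rewrite prodv0l ?add0r ?ih// => t; rewrite u1.
Qed.

(** Leibniz' rule has 2 ^ |s| terms, each with |s| derivatives in all; when every
derivative costs a factor lam, all terms have the same order of magnitude. *)
Lemma prodv_bound q u v s (A B lam : R) : continuous_seminorm q ->
  0 <= A -> 0 <= lam ->
  (forall t, (size t <= size s)%N -> `|u t| <= A * lam ^+ size t) ->
  (forall t, (size t <= size s)%N -> q (v t) <= B * lam ^+ size t) ->
  q (prodv u v s) <= 2 ^+ size s * A * B * lam ^+ size s.
Proof.
move=> qs A0 l0; elim: s u v A B A0 => [|j s ih] u v A B A0 Hu Hv /=.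
  rewrite csemiZ// expr0 mul1r mulr1.
  by have := Hu [::]; have := Hv [::]; rewrite expr0 !mulr1 => hv hu; apply: ler_pM;
    rewrite ?hu ?hv// csemi_ge0.
apply: le_trans (csemiD _ _ qs) _.
have h1 : q (prodv (fun t => u (j :: t)) v s) <= 2 ^+ size s * (A * lam) * B * lam ^+ size s.
  apply: ih => [|t ts|t ts]; first exact: mulr_ge0.
    by rewrite -mulrA -exprS; exact: Hu.
  by apply: Hv; exact: leqW.
have h2 : q (prodv u (fun t => v (j :: t)) s) <= 2 ^+ size s * A * (B * lam) * lam ^+ size s.
  apply: ih => // t ts; first by apply: Hu; exact: leqW.
  by rewrite -mulrA -exprS; exact: Hv.
apply: le_trans (lerD h1 h2) _.
by rewrite !exprS le_eqVlt; apply/orP; left; apply/eqP; ring.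
Qed.

End Products.

End Jets.

Arguments LJ_cont {R n E U L} s _.
Arguments LJ_dder {R n E U L} s i {x} _ _.

(** * Smooth functions and their jets *)

Section SmoothJets.
Variables (R : realType) (n : nat) (E : tvsType R).
Implicit Types (U : set 'rV[R]_n) (x y : 'rV[R]_n) (s t : seq 'I_n).
Implicit Types (f g : 'rV[R]_n -> E) (L : seq 'I_n -> 'rV[R]_n -> E).
Hypothesis Eh : hausdorff_space E.

Lemma dir_derive_eq f x v l : dder f x v l -> dir_derive f v x = l.
Proof.
move=> /dderP fl; rewrite /dir_derive; case: xgetP => [z _ /= zl|/(_ l)//].
exact: (@cvg_unique E Eh (dquot f x v @ (0 : R)^') _ _ _ zl fl).
Qed.

Lemma dir_derivable_dder f x v : dir_derivable f x v ->
  dder f x v (dir_derive f v x).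
Proof.
move=> [l /dderP fl]; rewrite (dir_derive_eq fl); exact: fl.
Qed.

Lemma dir_derive_near U f g v : (forall x, U° x -> f x = g x) ->
  forall x, U° x -> (forall l, dder f x v l <-> dder g x v l).
Proof.
move=> fg x Ux l; split; apply: dder_near;
  by apply: filterS (interior_nbhs Ux) => y Uy; rewrite fg.
Qed.

(** The jet of the derivative in the direction v. *)
Definition jet_dir (L : seq 'I_n -> 'rV[R]_n -> E) (v : 'rV[R]_n) s x :=
  \sum_i v 0 i *: L (i :: s) x.

Lemma LJ_jet_dir U L v : LJ U L -> LJ U (jet_dir L v).
Proof.
by move=> h k; apply: LJk_sum => i _; apply: LJk_scale; exact: LJ_shift.
Qed.

Lemma iter_derive_jets U f L ys : LJ U L -> (forall x, U° x -> f x = L [::] x) ->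
  LJ U (foldl jet_dir L ys) /\
  forall x, U° x -> iter_derive f ys x = foldl jet_dir L ys [::] x.
Proof.
elim: ys f L => [|v ys ih] f L h H //=.
apply: ih => [|x Ux]; first exact: LJ_jet_dir.
apply: dir_derive_eq; apply/(dir_derive_near v H Ux).
exact: (dder_lin v (@open_interior _ U) (LJ_C1 [::] h) Ux).
Qed.

Lemma foldl_jet_dir_ei L s t : foldl jet_dir L [seq ei R i | i <- s] t = L (s ++ t).
Proof.
elim: s L t => [//|i s ih] L t /=; rewrite ih; apply/funext => x.
rewrite /jet_dir (bigD1 i)//= big1 ?addr0 ?mxE ?eqxx ?scale1r// => j ji.
by rewrite mxE (negbTE ji) andbF scale0r.
Qed.

Definition is_jet_of U f L := LJ U L /\ forall x, U x -> L [::] x = f x.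

Lemma iter_derive_ei U f L s x : is_jet_of U f L -> U° x ->
  iter_derive f [seq ei R i | i <- s] x = L s x.
Proof.
move=> [h H] Ux.
have [_ ->//] := @iter_derive_jets U f L [seq ei R i | i <- s] h
  (fun y Uy => esym (H y (interior_subset Uy))).
by rewrite foldl_jet_dir_ei cats0.
Qed.

(** The continuous extensions of d^(l) f, evaluated at tuples of unit vectors, form a jet
of f on U. *)
Lemma smooth_on_jet U f : smooth_on U f -> exists L, is_jet_of U f L.
Proof.
move=> [fc fd fl].
have h s : exists g, cont_in U g /\
    forall x, U° x -> g x = iter_derive f [seq ei R i | i <- s] x.
  case: s => [|i0 s0]; first by exists f; split => //; exact/subspace_continuousP.
  set s := i0 :: s0.
  have [_ [g [gc gE]]] := fl (size s) isT.
  pose Y : 'M[R]_(size s, n) := \matrix_(k, j) ei R (tnth (in_tuple s) k) 0 j.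
  exists (fun x => g (x, Y)); split.
    move=> x Ux; move/subspace_continuousP: gc => /(_ (x, Y) (conj Ux I)) gc.
    apply: (@cvg_comp _ _ _ (fun y => (y, Y)) g _
      (within (U `*` setT) (nbhs (x, Y)))); last exact: gc.
    move=> N [[A B]/= [xA YB] AB]; apply: filterS xA => y Ay Uy.
    by apply: (AB (y, Y)) => //; split => //=; exact: nbhs_singleton.
  move=> x Ux; rewrite gE// /dl; congr (iter_derive f _ x).
  apply: (@eq_from_nth _ 0); rewrite !size_map -enumT size_enum_ord// => k ks.
  rewrite (nth_map (Ordinal ks)) ?size_enum_ord// (nth_map i0)//.
  apply/rowP => j; rewrite !mxE (tnth_nth i0)/=.
  by rewrite nth_enum_ord.
have [L HL] := choice h.
pose L0 s := if nilp s then f else L s.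
exists L0; split=> //.
have L0E s x : U° x -> L0 s x = iter_derive f [seq ei R i | i <- s] x.
  by move=> Ux; case: s => [//|i s]; exact: (HL _).2.
apply: LJ_mk => [s|s i x Ux].
  by case: s => [|i s]; [exact/subspace_continuousP|exact: (HL _).1].
rewrite L0E// map_rcons /iter_derive foldl_rcons.
have := dir_derivable_dder (fd [seq ei R i | i <- s] (ei R i) x Ux).
apply: dder_near; apply: filterS (interior_nbhs Ux) => y Uy.
by rewrite L0E.
Unshelve. all: by end_near. Qed.

(** The polynomial dependence on the directions gives the continuous extension
of d^(l) f. *)
Lemma foldl_jet_dir_cont (P : topologicalType) U (L : seq 'I_n -> 'rV[R]_n -> E)
    (ys : seq (P -> 'rV[R]_n)) : LJ U L -> (forall v, v \in ys -> continuous v) ->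
  forall s z, (U `*` setT) z ->
    (fun z => foldl jet_dir L [seq v z.2 | v <- ys] s z.1) @ within (U `*` setT) (nbhs z)
      --> foldl jet_dir L [seq v z.2 | v <- ys] s z.1.
Proof.
move=> h yc s z Uz.
suff H (F : seq 'I_n -> 'rV[R]_n * P -> E) :
    (forall s, F s @ within (U `*` setT) (nbhs z) --> F s z) ->
    (fun w => foldl jet_dir (fun s x => F s (x, w.2)) [seq v w.2 | v <- ys] s w.1)
      @ within (U `*` setT) (nbhs z)
      --> foldl jet_dir (fun s x => F s (x, z.2)) [seq v z.2 | v <- ys] s z.1.
  apply: (H (fun s w => L s w.1)) => t.
  have [Uz1 _] := Uz.
  apply: (@cvg_comp _ _ _ fst (L t) _ (within U (nbhs z.1))); last exact: LJ_cont.
  move=> N zN; exists ([set x | U x -> N x], setT) => /=.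
    by split => //; exact: filterT.
  by move=> [a b] /= [Aa _] [Ua _]; exact: Aa.
elim: ys F yc => [|v ys ih] F yc Fc /=.
  by rewrite -surjective_pairing; apply: cvg_trans (Fc s); apply: near_eq_cvg;
    near=> w; rewrite -surjective_pairing.
pose F' s w := \sum_i (v w.2) 0 i *: F (i :: s) w.
apply: (ih F') => [w wy|t]; first by apply: yc; rewrite inE wy orbT.
apply: tvs_cvg_sum => i _; apply: tvs_cvgZ => //.
apply: cvg_within_filter.
apply: (@cvg_comp _ _ _ snd (fun p => (v p) 0 i) _ (nbhs z.2)); first exact: cvg_snd.
apply: (@cvg_comp _ _ _ v (fun p => p 0 i) _ (nbhs (v z.2))); last exact: coord_continuous.
by apply: yc; rewrite mem_head.
Unshelve. all: by end_near. Qed.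

(** Conversely a jet gives the derivatives in all directions as linear combinations of
its components, and these combinations extend continuously to U. *)
Lemma jet_smooth_on U f L : is_jet_of U f L -> smooth_on U f.
Proof.
move=> [h H]; have H' x : U° x -> f x = L [::] x.
  by move=> Ux; rewrite H//; exact: interior_subset.
split.
- apply/subspace_continuousP; apply/cont_inP => x q e Ux qs e0.
  have := cont_in_near (LJ_cont [::] h) qs Ux e0; apply: filterS => y Hy Uy.
  by rewrite /from_subspace -!H//; exact: Hy.
- move=> ys y x Ux; have [hy Hy] := iter_derive_jets ys h H'.
  exists (jet_dir (foldl jet_dir L ys) y [::] x); apply/dderP.
  apply/(dir_derive_near y Hy Ux).
  exact: (dder_lin y (@open_interior _ U) (LJ_C1 [::] hy) Ux).
- move=> l _.
  have rE (Y : 'M[R]_(l, n)) : [seq row i Y | i <- enum 'I_l] =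
      [seq v Y | v <- [seq row i | i <- enum 'I_l]] by rewrite -map_comp.
  have rc v : v \in [seq @row R l n i | i <- enum 'I_l] -> continuous v.
    move=> /mapP[i _ ->] Y N /= [e /= e0 eN].
    exists (fun k j => [set r | k = i -> e 0 j r]) => [k j|Z YZ].
      have [->|/eqP ki] := eqVneq k i; last by apply: filterE => r.
      by have := e0 0 j; rewrite mxE; apply: filterS => r er _.
    by apply: eN => k j; rewrite ord1 mxE; exact: YZ.
  pose g (xy : 'rV[R]_n * 'M[R]_(l, n)) :=
    foldl jet_dir L [seq row i xy.2 | i <- enum 'I_l] [::] xy.1.
  have gc : {within U `*` setT, continuous g}.
    have -> : g = fun xy => foldl jet_dir L
        [seq v xy.2 | v <- [seq row i | i <- enum 'I_l]] [::] xy.1.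
      by apply/funext => z; rewrite /g rE.
    apply/subspace_continuousP => z Uz.
    exact: (@foldl_jet_dir_cont _ U L _ h rc [::] z Uz).
  have gE xy : U° xy.1 -> g xy = dl f xy.
    by move=> Ux; rewrite /dl (iter_derive_jets _ h H').2.
  split; last by exists g.
  apply/subspace_continuousP => -[x Y] [/= Ux _].
  move/subspace_continuousP: gc => /(_ (x, Y) (conj (interior_subset Ux) I)).
  rewrite /from_subspace => gc N; rewrite -(gE (x, Y))// => Nx.
  have K : nbhs (x, Y) (fun z => (U `*` setT) z -> N (g z)) := gc N Nx.
  apply: (@filterS _ (nbhs (x, Y)) _ _
    (fun z => (U° `*` setT) z -> N (dl f z)) _ K).
  move=> -[y Z] /= hN [Uy _]; rewrite -gE//; apply: hN.
  by split => //; exact: interior_subset.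
Qed.

Lemma partial_eq U f L a x : dense_interior U -> is_jet_of U f L -> U x ->
  partial U f a x = L (mnm_seq a) x.
Proof.
move=> Ud h Ux; rewrite /partial; case: xgetP => [g _ [gc gE _]|].
  move: x Ux; apply: dense_eq => //.
  - exact/subspace_continuousP.
  - exact: (LJ_cont _ h.1).
  - by move=> x Ux; rewrite gE// -(iter_derive_ei _ h).
move=> /(_ (patch (fun=> 0) U (L (mnm_seq a))))[]; split.
- apply/subspace_continuousP; apply/cont_inP => y q e Uy qs e0.
  have := cont_in_near (LJ_cont (mnm_seq a) h.1) qs Uy e0.
  by apply: filterS => z Hz Uz; rewrite /from_subspace !patchT ?inE//; exact: Hz.
- move=> y Uy; rewrite patchT ?inE; last exact: interior_subset.
  by rewrite -(iter_derive_ei _ h).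
- by move=> y Uy; rewrite patchN//; apply/negP; rewrite inE.
Qed.

End SmoothJets.

(** * Multi-indices *)

Section MultiIndices.
Variable n : nat.
Implicit Types (a b : multinom n) (s t : seq 'I_n).

(** The multi-index of the iterated derivative in the directions s. *)
Definition mnms s : multinom n := Multinom [tuple count_mem i s | i < n].

Lemma mnmsE s i : mnms s i = count_mem i s.
Proof. by rewrite multinomE tnth_mktuple. Qed.

Lemma mnms_cons i s : mnms (i :: s) = mnm_add (mnms s) (mnm1 i).
Proof. by apply/mnmP => j; rewrite mnmDE !mnmsE mnm1E/= addnC. Qed.

Lemma mnms_rcons s i : mnms (rcons s i) = mnm_add (mnms s) (mnm1 i).
Proof.
by apply/mnmP => j; rewrite mnmDE !mnmsE mnm1E -cats1 count_cat/= addn0.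
Qed.

Lemma mnms_nil : mnms [::] = mnm0.
Proof. by apply/mnmP => j; rewrite [RHS]mnm0E [LHS]mnmsE. Qed.

Lemma count_mnm_seq a i : count_mem i (mnm_seq a) = a i.
Proof.
rewrite /mnm_seq count_flatten -map_comp sumnE big_map big_enum/= (bigD1 i)//= big1.
  by rewrite count_nseq/= eqxx mul1n addn0.
by move=> j ji; rewrite count_nseq/= (negbTE ji) mul0n.
Qed.

Lemma mnms_seq a : mnms (mnm_seq a) = a.
Proof. by apply/mnmP => j; rewrite mnmsE count_mnm_seq. Qed.

Lemma mnm_seqK s : perm_eq (mnm_seq (mnms s)) s.
Proof. by apply/allP => i _ /=; rewrite count_mnm_seq mnmsE. Qed.

Lemma size_mnm_seq a : size (mnm_seq a) = mdeg a.
Proof.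
rewrite /mnm_seq size_flatten /shape -map_comp sumnE big_map big_enum/= mdegE.
by apply: eq_bigr => i _; rewrite /= size_nseq.
Qed.

Lemma mdeg_mnms s : mdeg (mnms s) = size s.
Proof. by rewrite -size_mnm_seq (perm_size (mnm_seqK s)). Qed.

End MultiIndices.

Section Partials.
Variables (R : realType) (n : nat) (E : tvsType R).
Hypothesis Eh : hausdorff_space E.

(** Jets indexed by multi-indices instead of sequences of directions; the two notions
agree because mixed derivatives commute. *)
Definition MJ (U : set 'rV[R]_n) (J : jet R n E) := LJ U (fun s => J (mnms s)).

Lemma partial_mnms U (f : 'rV[R]_n -> E) L s x : dense_interior U ->
  is_jet_of U f L -> U x -> partial U f (mnms s) x = L s x.
Proof.
move=> Ud h Ux; rewrite (partial_eq Eh (mnms s) Ud h Ux).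
exact: (LJ_perm Eh Ud h.1 Ux (mnm_seqK s)).
Qed.

Lemma MJ_partial U (f : 'rV[R]_n -> E) : dense_interior U -> smooth_on U f ->
  MJ U (partial U f) /\ forall x, U x -> partial U f mnm0 x = f x.
Proof.
move=> Ud /(smooth_on_jet Eh)[L hL]; split.
  by apply: (LJ_eq _ hL.1) => s x Ux; rewrite (partial_mnms _ Ud hL).
by move=> x Ux; rewrite -mnms_nil (partial_mnms _ Ud hL)// hL.2.
Qed.

Lemma partial_MJ U (f : 'rV[R]_n -> E) J a x : dense_interior U -> MJ U J ->
  (forall y, U y -> J mnm0 y = f y) -> U x -> partial U f a x = J a x.
Proof.
move=> Ud hJ H Ux; rewrite -(mnms_seq a).
apply: (@partial_mnms U f (fun s => J (mnms s))) => //; split.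
Qed.

End Partials.

(** * The chain rule and the formula of Faa di Bruno *)

Section FaaDiBruno.
Variables (R : realType) (s t : nat) (E : tvsType R).
Implicit Types (F : multinom t -> E) (G : 'I_t -> seq 'I_s -> R).

(** The derivatives of a composite F o g, from the values F b of the derivatives of the
outer function and G j s of those of the components of g: the first direction i
gives the sum over j of (D_i g_j) times (D_j F) o g, to which the remaining directions are
applied by Leibniz' rule. The number k bounds the depth of the recursion. *)
Fixpoint compv k F G (l : seq 'I_s) : E :=
  match l, k with
  | [::], _ => F mnm0
  | i :: l', k'.+1 => \sum_j prodv (fun r => G j (i :: r))
      (fun r => compv k' (fun b => F (mnm_add b (mnm1 j))) G r) l'
  | _, _ => 0
  end.

Lemma compv_fuel k k' F G l : (size l <= k)%N -> (size l <= k')%N ->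
  compv k F G l = compv k' F G l.
Proof.
elim: k k' F l => [|k ih] [|k'] F [|i l]//=; rewrite !ltnS => lk lk'.
apply: eq_bigr => j _; apply: prodv_ext => // r rl.
by apply: ih; [exact: leq_trans lk|exact: leq_trans lk'].
Qed.

Section Blocks.
Variables (T : finType) (lab : T -> 'I_s).
Implicit Types (S B : {set T}) (P : {set {set T}}).

Definition labs B := [seq lab x | x <- enum B].

Lemma enum_filter S B : B \subset S -> enum B = [seq x <- enum S | x \in B].
Proof.
move=> BS; rewrite /enum_mem -filter_predI; apply: eq_filter => x /=.
by case xB: (x \in B) => //=; rewrite (fintype.subsetP BS).
Qed.

Lemma enum_first S x r : enum S = x :: r ->
  x \in S /\ forall B, B \subset S :\ x -> enum (x |: B)%SET = x :: enum B.
Proof.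
move=> e; have xS : x \in S by rewrite -mem_enum e mem_head.
have xr : x \notin r by have := enum_uniq (mem S); rewrite e => /andP[].
split=> // B BS; have BS' := fintype.subset_trans BS (finset.subsetDl _ _).
rewrite (@enum_filter S (x |: B)) ?finset.subUset ?finset.sub1set ?xS//.
rewrite (@enum_filter S B) // e/= !inE eqxx/=.
have -> : x \in B = false by apply: contraTF BS => xB; apply/fintype.subsetPn; exists x; rewrite ?inE ?eqxx.
congr (_ :: _); apply: eq_in_filter => y yr; rewrite !inE.
by case: eqP => // yx; rewrite -yx yr in xr.
Qed.

Lemma labs_first S x r B : enum S = x :: r -> B \subset S :\ x ->
  labs (x |: B)%SET = lab x :: labs B.
Proof. by move=> e BS; rewrite /labs (enum_first e).2. Qed.

Lemma setD1U S x r : enum S = x :: r -> (x |: S :\ x)%SET = S.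
Proof. by move=> /enum_first[xS _]; rewrite finset.setD1K. Qed.

(** Iterated Leibniz rule: the positions of the directions are distributed over the two
factors, so the sum ranges over the subsets of the set S of positions. *)
Lemma prodv_labs (V : tvsType R) u (v : seq 'I_s -> V) S :
  prodv u v (labs S) =
  \sum_(B in powerset S) u (labs B) *: v (labs (S :\: B)%SET).
Proof.
move cS: #|S| => m; elim: m S cS u v => [|m ih] S cS u v.
  move/eqP: cS; rewrite cards_eq0 => /eqP ->.
  by rewrite finset.powerset0 big_set1 finset.setD0 /labs enum_set0/=.
case e: (enum S) => [|x r]; first by move: cS; rewrite cardE e.
have [xS fS] := enum_first e.
rewrite -{1}(setD1U e) (labs_first e)//=.
have cS' : #|S :\ x| = m by move: cS; rewrite (cardsD1 x) xS => -[].
rewrite !ih// [RHS](bigID (fun B : {set T} => x \in B))/=; congr (_ + _).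
  rewrite [RHS](reindex_onto (fun B : {set T} => x |: B)%SET (fun B => B :\ x)%SET)/=; last first.
    by move=> B /andP[_ xB]; rewrite finset.setD1K.
  apply: congr_big => // [B|B].
    rewrite !finset.powersetE; apply/idP/idP => [|/andP[/andP[BS _] /eqP <-]].
      rewrite finset.subsetD1 => /andP[BS xB].
      by rewrite finset.subUset finset.sub1set xS BS finset.setU11 finset.setU1K ?eqxx.
    exact: finset.setSD.
  rewrite finset.powersetE => BS; rewrite (labs_first e)//.
  by rewrite finset.setDDl.
apply: congr_big => // B.
  by rewrite !finset.powersetE finset.subsetD1.
rewrite finset.powersetE => BS; rewrite -(labs_first e); last exact: finset.subsetDl.
congr (_ *: v (labs _)); apply/setP => y; rewrite !inE.
have [->|//] := eqVneq y x; rewrite xS andbT.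
by move: BS; rewrite finset.subsetD1 => /andP[_ ->].
Qed.

Variable G : 'I_t -> seq 'I_s -> R.

(** The contribution of the blocks bs of a partition: one index j for each block B, with
the factor D_B g_j and one more derivative of F in the direction j. *)
Fixpoint bsum (bs : seq {set T}) F : E :=
  if bs is B :: bs' then
    \sum_j G j (labs B) *: bsum bs' (fun b => F (mnm_add b (mnm1 j)))
  else F mnm0.

Lemma bsum_swap B B' bs F : bsum (B :: B' :: bs) F = bsum (B' :: B :: bs) F.
Proof.
rewrite /= (eq_bigr _ (fun _ _ => scaler_sumr _ _ _ _)).
rewrite [RHS](eq_bigr _ (fun _ _ => scaler_sumr _ _ _ _)) exchange_big/=.
apply: eq_bigr => i _; apply: eq_bigr => j _; rewrite !scalerA mulrC.
congr (_ *: bsum _ _); apply/funext => b; congr F.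
by apply/mnmP => r; rewrite !mnmDE addnAC.
Qed.

Lemma bsum_perm bs bs' F : perm_eq bs bs' -> bsum bs F = bsum bs' F.
Proof.
have mid (r1 r2 : seq {set T}) B F' : bsum (r1 ++ B :: r2) F' = bsum (B :: r1 ++ r2) F'.
  elim: r1 F' => [//|C r1 ih] F'.
  rewrite bsum_swap /=; apply: eq_bigr => j _; congr (_ *: _); exact: ih.
elim: bs' bs F => [|B bs' ih] bs F; first by move=> /perm_nilP ->.
move=> st; have : B \in bs by rewrite (perm_mem st) mem_head.
move=> /splitPr si; case: si st => s1 s2 st; rewrite mid/=.
apply: eq_bigr => j _; congr (_ *: _); apply: ih.
by rewrite -(perm_cons B); apply: perm_trans st; rewrite -cat1s perm_catCA.
Qed.

(** The block containing the first element x of S is x together with an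
arbitrary subset of the rest; what remains is partitioned recursively. *)
Lemma compv_labs k F S : (#|S| <= k)%N ->
  compv k F G (labs S) = \sum_(P | finset.partition P S) bsum (enum P) F.
Proof.
elim: k F S => [|k ih] F S.
  rewrite leqn0 cards_eq0 => /eqP ->.
  rewrite (big_pred1 finset.set0) => [|P]; last by rewrite partition_set0.
  by rewrite /labs !enum_set0.
move=> cS; case e: (enum S) => [|x r].
  have -> : S = finset.set0 by apply/eqP; rewrite -cards_eq0 cardE e.
  rewrite (big_pred1 finset.set0) => [|P]; last by rewrite partition_set0.
  by rewrite /labs !enum_set0.
have [xS fS] := enum_first e.
rewrite -{1}(setD1U e) (labs_first e)//=.
have cS' : (#|S :\ x| <= k)%N by move: cS; rewrite (cardsD1 x) xS.
transitivity (\sum_(B in powerset (S :\ x))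
    \sum_(P' | finset.partition P' (S :\ x :\: B)%SET) bsum ((x |: B)%SET :: enum P') F).
  under eq_bigr => j _ do rewrite prodv_labs.
  rewrite exchange_big/=; apply: eq_bigr => B; rewrite finset.powersetE => BS.
  rewrite exchange_big/=; apply: eq_bigr => j _.
  rewrite -scaler_sumr (labs_first e)//; congr (_ *: _); apply: ih.
  by apply: leq_trans cS'; apply: subset_leq_card; exact: finset.subsetDl.
pose blk (P : {set {set T}}) := (finset.pblock P x :\ x)%SET.
rewrite [RHS](partition_big blk (mem (powerset (S :\ x))))/=; last first.
  move=> P Pp; rewrite finset.powersetE /blk finset.setSD//.
  rewrite -(finset.cover_partition Pp); apply: (finset.bigcup_sup _ (finset.pblock_mem _)).
  by rewrite (finset.cover_partition Pp).
apply: eq_bigr => B; rewrite finset.powersetE => BS.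
have [BS1 xB] : B \subset S /\ x \notin B by move: BS; rewrite finset.subsetD1 => /andP[].
have xBS : (x |: B)%SET \subset S by rewrite finset.subUset finset.sub1set xS.
have DE : (S :\ x :\: B = S :\: (x |: B))%SET by rewrite finset.setDDl.
rewrite [RHS](reindex_onto (fun P' => (x |: B) |: P')%SET (fun P => P :\ (x |: B))%SET)/=; last first.
  move=> P /andP[Pp /eqP PB]; apply: finset.setD1K.
  have xc : x \in finset.cover P by rewrite (finset.cover_partition Pp).
  rewrite -PB /blk finset.setD1K ?finset.mem_pblock//; exact: finset.pblock_mem.
have notinP P' : finset.partition P' (S :\ x :\: B)%SET -> (x |: B)%SET \notin P'.
  move=> Pp'; apply/negP => xBP.
  have : x \in finset.cover P'.
    by apply/finset.bigcupP; exists (x |: B)%SET => //; rewrite finset.setU11.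
  by rewrite (finset.cover_partition Pp') !inE eqxx andbF.
apply: congr_big => // [P'|P'].
  apply/idP/idP => [Pp'|/andP[/andP[Pp /eqP PB] /eqP PE]].
    have notin : (x |: B)%SET \notin P'.
      exact: notinP Pp'.
    have Pp : finset.partition ((x |: B) |: P')%SET S.
      have := partitionU1 Pp' (B := (x |: B)%SET).
      rewrite DE; have -> : ((x |: B) :|: (S :\: (x |: B)) = S)%SET.
        by rewrite -{2}(finset.setID S (x |: B)) (finset.setIidPr xBS).
      apply; first by apply/set0Pn; exists x; rewrite !inE eqxx.
      rewrite -finset.setI_eq0; apply/eqP/setP => y; rewrite !inE.
      by case: (y == x); case: (y \in B).
    rewrite Pp finset.setU1K// eqxx andbT /blk.
    rewrite (finset.def_pblock (B := (x |: B)%SET)) ?finset.setU1K//.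
    - by rewrite eqxx.
    - by case/and3P: Pp.
    - by rewrite !inE eqxx.
    - by rewrite finset.setU11.
  rewrite -PE DE; apply: partitionD1 => //.
  by rewrite !inE eqxx.
move=> Pp'; rewrite -[LHS]/(bsum ((x |: B)%SET :: enum P') F).
apply: bsum_perm.
have notin := notinP _ Pp'.
apply: uniq_perm; rewrite ?enum_uniq//=.
  by rewrite mem_enum notin enum_uniq.
by move=> B'; rewrite mem_enum !inE mem_enum.
Qed.

Definition ctype m (i : {ffun 'I_m -> 'I_t}) : multinom t :=
  Multinom [tuple #|[pred l | i l == r]| | r < t].

Lemma ctypeE m (i : {ffun 'I_m -> 'I_t}) r : ctype i r = #|[pred l | i l == r]|.
Proof. by rewrite multinomE tnth_mktuple. Qed.

(** The choices of one index for each block form a function i, and F is differentiated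
according to the number of times each index is chosen. *)
Lemma bsum_ffun m (f : 'I_m -> {set T}) F :
  bsum [seq f l | l <- enum 'I_m] F =
  \sum_(i : {ffun 'I_m -> 'I_t}) (\prod_l G (i l) (labs (f l))) *: F (ctype i).
Proof.
elim: m f F => [|m ih] f F.
  have e0 : enum 'I_0 = [::] by apply: size0nil; rewrite size_enum_ord.
  pose i0 : {ffun 'I_0 -> 'I_t} := ffun0 (card_ord 0).
  rewrite e0 /= (big_pred1 i0).
    rewrite big_ord0 scale1r; congr F; apply/mnmP => r; rewrite ctypeE mnm0E.
    by apply/esym/eq_card0 => -[].
  by move=> i; apply/esym/eqP/ffunP => -[].
rewrite enum_ordSl/= -map_comp.
pose h (p : 'I_t * {ffun 'I_m -> 'I_t}) : {ffun 'I_m.+1 -> 'I_t} :=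
  [ffun l => if unlift ord0 l is Some l' then p.2 l' else p.1].
pose h' (i : {ffun 'I_m.+1 -> 'I_t}) := (i ord0, [ffun l => i (lift ord0 l)]).
have hK : cancel h h'.
  move=> [j i]; rewrite /h' ffunE unlift_none; congr (_, _).
  by apply/ffunP => l; rewrite !ffunE liftK.
have h'K : cancel h' h.
  by move=> i; apply/ffunP => l; rewrite ffunE; case: unliftP => [l' ->|->] /=; rewrite ?ffunE.
rewrite [RHS](reindex h)/=; last by exists h' => p _.
rewrite (eq_bigr (fun p => \prod_l G ((h (p.1, p.2)) l) (labs (f l)) *: F (ctype (h (p.1, p.2))))); last by case.
rewrite -(pair_bigA _ (fun j i => (\prod_l G ((h (j, i)) l) (labs (f l))) *: F (ctype (h (j, i)))))/=.
apply: eq_bigr => j _; rewrite ih scaler_sumr; apply: eq_bigr => i _.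
rewrite scalerA big_ord_recl /h ffunE unlift_none/=.
congr (_ * _ *: F _).
  by apply: eq_bigr => l _; rewrite ffunE liftK.
apply/mnmP => r; rewrite mnmDE mnm1E !ctypeE -!sum1_card big_mkcond [RHS]big_mkcond/=.
rewrite big_ord_recl/= !inE ffunE unlift_none addnC; congr (_ + _)%N.
by apply: eq_bigr => l _; rewrite !inE ffunE liftK.
Qed.

End Blocks.

End FaaDiBruno.

Section ChainRule.
Variables (R : realType) (s t : nat) (E : tvsType R).
Implicit Types (F : multinom t -> E) (U : set 'rV[R]_s) (V : set 'rV[R]_t).

Lemma dder_comp (O : set 'rV[R]_t) (f : 'rV[R]_t -> E) fj (g : 'rV[R]_s -> 'rV[R]_t)
    x v w : open O -> C1 O f fj -> O (g x) -> dder g x v w ->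
  dder (f \o g) x v (\sum_j w 0 j *: fj j (g x)).
Proof.
move=> Oo fC Og gw q qs e e0.
pose B := \sum_j q (fj j (g x)).
have B0 : 0 <= B by apply: sumr_ge0 => j _; exact: csemi_ge0.
pose eta := e / 2 / (B + 1).
have eta0 : 0 < eta by rewrite !divr_gt0// ltr_wpDl.
have w0 : 0 < `|w| + eta by rewrite ltr_wpDl.
have [d d0 hd] := frechet Oo fC Og qs (divr_gt0 (divr_gt0 e0 (ltr0Sn R 1)) w0).
have [r r0 hr] := gw _ (csemi_norm 'rV[R]_t) eta eta0.
exists (Num.min r (d / (`|w| + eta))); first by rewrite lt_min r0 divr_gt0.
move=> h; rewrite lt_min => /andP[/hr hg]; rewrite ltr_pdivlMr// => hh.
pose D := g (h *: v + x) - g x.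
have gE : g (h *: v + x) = D + g x by rewrite subrK.
have Dn : `|D| <= `|h| * (`|w| + eta).
  rewrite -(subrK (h *: w) D); apply: le_trans (ler_normD _ _) _.
  by rewrite normrZ mulrDr addrC lerD// mulrC.
rewrite /= gE.
have -> : f (D + g x) - f (g x) - h *: (\sum_j w 0 j *: fj j (g x)) =
   (f (D + g x) - f (g x) - \sum_j D 0 j *: fj j (g x)) +
   \sum_j (D - h *: w) 0 j *: fj j (g x).
  rewrite -[RHS]addrA; congr (_ + _); rewrite addrC scaler_sumr -sumrN.
  rewrite -sumrB; apply: eq_bigr => j _.
  by rewrite [in RHS]mxE [X in (_ + X) *: _]mxE [X in (_ - X) *: _]mxE scalerBl scalerA addrAC subrr add0r.
apply: le_trans (csemiD _ _ qs) _; rewrite (splitr e) mulrDl; apply: lerD.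
  apply: le_trans (hd _ (le_lt_trans Dn hh)) _.
  have ew : 0 <= e / 2 / (`|w| + eta) by rewrite ltW// !divr_gt0.
  apply: le_trans (ler_wpM2l ew Dn) _.
  by rewrite [ `|h| * _]mulrC mulrA divfK ?gt_eqF.
apply: le_trans (csemi_sum _ _ _ qs) _.
apply: (@le_trans _ _ (\sum_j eta * `|h| * q (fj j (g x)))).
  apply: ler_sum => j _; rewrite csemiZ// ler_wpM2r//; first exact: csemi_ge0.
  by apply: le_trans (rv_coord_le _ _) _.
rewrite -mulr_sumr -/B mulrAC ler_wpM2r// /eta mulrAC -mulrA ler_piMr//.
  by rewrite ltW// divr_gt0.
by rewrite ler_pdivrMr ?mul1r ?lerDl// ltr_wpDl.
Qed.

Lemma LJk_coord k U (L : seq 'I_s -> 'rV[R]_s -> 'rV[R]_t) j : LJk k U L ->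
  LJk k U (fun r x => L r x 0 j : R^o).
Proof.
move=> [c d]; split=> [r rk x Ux|r i x rk Ux].
  apply: (@cvg_comp _ _ _ (L r) (fun p => p 0 j) _ (nbhs (L r x))); first exact: c.
  exact: coord_continuous.
apply/dderP; have /dderP := d r i x rk Ux => H.
have := @cvg_comp _ _ _ _ (fun p => p 0 j) _ _ _ H (@coord_continuous _ _ _ 0 j _).
apply: cvg_trans; apply: near_eq_cvg; near=> h.
by rewrite /dquot /= !mxE.
Unshelve. all: by end_near. Qed.

Lemma MJ_shift V (J : jet R t E) j : MJ V J ->
  MJ V (fun b => J (mnm_add b (mnm1 j))).
Proof.
move=> /(LJ_shift j); apply: LJ_eq => r x _.
by rewrite mnms_cons.
Qed.

(** The derivatives of a composite are obtained from the chain rule and the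
Leibniz rule by recursion on the order. *)
Lemma LJk_comp k U V (g : 'rV[R]_s -> 'rV[R]_t) L (J : jet R t E) :
  is_jet_of U g L -> MJ V J -> (forall x, U x -> V (g x)) ->
  (forall x, U° x -> V° (g x)) ->
  LJk k U (fun l x => compv k (J ^~ (g x)) (fun j r => L r x 0 j) l).
Proof.
move=> [hL Lg] + UV UVi.
have gc : cont_in U g.
  apply/cont_inP => x q e Ux qs e0; have := cont_in_near (LJ_cont [::] hL) qs Ux e0.
  by apply: filterS => y Hy Uy; rewrite -!Lg//; exact: Hy.
have c0 (J' : jet R t E) : MJ V J' -> cont_in U (fun x => J' mnm0 (g x)).
  move=> hJ; apply/cont_inP => x q e Ux qs e0.
  have H : \forall y \near within U (nbhs x), V (g y) -> q (J' mnm0 (g y) - J' mnm0 (g x)) < e.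
    apply: (gc x Ux (fun z => V z -> q (J' mnm0 z - J' mnm0 (g x)) < e)).
    by have := cont_in_near (LJ_cont [::] hJ) qs (UV _ Ux) e0; rewrite mnms_nil.
  by move: H; rewrite near_withinE; apply: filterS => y + Uy; apply => //; exact: UV.
elim: k J => [|k ih] J hJ.
  by split=> [[|//] _|//]; exact: c0.
have hs i := LJk_shift i.
have step i : LJk k U (fun l x => \sum_j prodv (fun r => L (i :: r) x 0 j)
      (fun r => compv k (fun b => J (mnm_add b (mnm1 j)) (g x)) (fun j r => L r x 0 j) r) l).
  apply: LJk_sum => j _; apply: (@LJk_prod _ _ _ _ _ (fun r x => L (i :: r) x 0 j)).
    by apply: (@LJk_coord k U (fun r => L (i :: r))); exact: LJ_shift.
  exact: (ih (fun b => J (mnm_add b (mnm1 j))) (MJ_shift j hJ)).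
split=> [[|i l] lk|[|i l] j x lk Ux].
- exact: c0.
- by have [h _] := step i; exact: h.
- have C := @LJ_C1 _ _ _ _ _ [::] hJ; rewrite mnms_nil in C.
  have := dder_comp (@open_interior _ V) C (UVi _ Ux)
    (LJ_near hL Ux (fun y Uy => Lg y (interior_subset Uy)) j).
  rewrite /=; congr (dder _ _ _ _); apply: eq_bigr => r _.
  by rewrite mnms_cons mnms_nil; case: k {ih step lk hs}.
- by have [_ h] := step i; exact: h.
Qed.

Definition compL (J : jet R t E) (g : 'rV[R]_s -> 'rV[R]_t)
    (L : seq 'I_s -> 'rV[R]_s -> 'rV[R]_t) (l : seq 'I_s) (x : 'rV[R]_s) :=
  compv (size l) (J ^~ (g x)) (fun j r => L r x 0 j) l.

(** The pull-back of a jet of f0 by g is a jet of f0 o g. Interior points have to be sent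
to interior points, where the derivatives of the outer function are defined. *)
Lemma compL_jet U V (g : 'rV[R]_s -> 'rV[R]_t) L (J : jet R t E) (f : 'rV[R]_s -> E) :
  is_jet_of U g L -> MJ V J -> (forall x, U x -> V (g x)) ->
  (forall x, U° x -> V° (g x)) -> (forall x, U x -> f x = J mnm0 (g x)) ->
  is_jet_of U f (compL J g L).
Proof.
move=> hL hJ UV UVi fE; split; last by move=> x Ux; rewrite fE.
apply: LJ_mk => [l|l i x Ux].
  exact: (LJk_comp (size l) hL hJ UV UVi).1.
rewrite /compL size_rcons.
have := (LJk_comp (size l).+1 hL hJ UV UVi).2 l i x (ltnSn _) Ux.
by apply: dder_near; near=> y; exact: compv_fuel.
Unshelve. all: by end_near. Qed.

Lemma mdeg_ctype m (i : {ffun 'I_m -> 'I_t}) : mdeg (ctype i) = m.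
Proof.
rewrite mdegE (eq_bigr (fun r => \sum_(l < m) (i l == r))%N) => [|r _].
  rewrite exchange_big/= (eq_bigr (fun=> 1%N)) => [|l _]; first by rewrite sum_nat_const card_ord muln1.
  by rewrite (bigD1 (i l))//= eqxx big1// => r; rewrite eq_sym => /negbTE ->.
by rewrite ctypeE -sum1_card big_mkcond; apply: eq_bigr => l _; rewrite !inE; case: eqP.
Qed.

Lemma card_partition_le (T : finType) (P : {set {set T}}) (D : {set T}) :
  finset.partition P D -> (#|P| <= #|D|)%N.
Proof.
move=> Pp; rewrite (finset.card_partition Pp) -sum1_card; apply: leq_sum => B BP.
rewrite card_gt0; apply: contraTneq BP => ->.
by case/and3P: Pp.
Qed.

Lemma faaE (a : multinom s) (b : multinom t) (X : multinom s -> 'I_t -> R) :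
  faa_di_bruno a b X =
  \sum_(P : {set {set 'I_(mdeg a)}} | finset.partition P [set: 'I_(mdeg a)]%SET)
    \sum_(i : {ffun 'I_#|P| -> 'I_t} | ctype i == b)
      \prod_(l < #|P|) X (block_mnm (enum_val l)) (i l).
Proof.
have ctE m (i : {ffun 'I_m -> 'I_t}) : [forall r, #|[pred l | i l == r]| == b r] = (ctype i == b).
  apply/forallP/eqP => [h|<- r]; last by rewrite ctypeE.
  by apply/mnmP => r; rewrite ctypeE; exact/eqP.
rewrite /faa_di_bruno; have [b0|b0] := eqVneq (mdeg b) 0%N; last first.
  rewrite big_mkcondr/=; apply: eq_bigr => P Pp.
  case: eqP => [Pb|Pb]; first by apply: eq_bigl => i; exact: ctE.
  by rewrite big_pred0// => i; apply/eqP => ib; apply: Pb; rewrite -ib mdeg_ctype.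
have [a0|a0] := eqVneq (mdeg a) 0%N; last first.
  rewrite big1// => P Pp; rewrite big_pred0// => i; apply/eqP => ib.
  have P0 : P = finset.set0 by apply/eqP; rewrite -cards_eq0 -(mdeg_ctype i) ib b0.
  move: Pp; rewrite P0 => /finset.card_partition; rewrite big_set0 cardsT card_ord.
  by move/eqP; rewrite (negbTE a0).
have T0 : [set: 'I_(mdeg a)]%SET = finset.set0.
  by apply/eqP; rewrite -cards_eq0 cardsT card_ord a0.
rewrite T0 (big_pred1 finset.set0) => [|P]; last by rewrite partition_set0.
have c0 : #|(finset.set0 : {set {set 'I_(mdeg a)}})| = 0%N by rewrite cards0.
have i0 (i : {ffun 'I_#|(finset.set0 : {set {set 'I_(mdeg a)}})| -> 'I_t}) : ctype i == b.
  apply/eqP; move: b0 => /eqP; rewrite mdeg_eq0 => /eqP ->; apply/eqP.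
  by rewrite -mdeg_eq0 mdeg_ctype c0.
pose j0 : {ffun 'I_#|(finset.set0 : {set {set 'I_(mdeg a)}})| -> 'I_t} :=
  ffun0 (etrans (card_ord _) c0).
rewrite (big_pred1 j0) => [|i].
  by rewrite big1// => l; have := ltn_ord l; rewrite {2}c0.
rewrite i0; apply/esym/eqP/ffunP => l; exfalso.
by have := ltn_ord l; rewrite {2}c0.
Qed.

(** The chain rule, unfolded into a sum over partitions of the positions of the
directions, is the formula of Faa di Bruno that defines the pull-back of jets. *)
Lemma pullback_compL U (g : 'rV[R]_s -> 'rV[R]_t) L (J : jet R t E) a x :
  dense_interior U -> is_jet_of U g L -> U x ->
  pullback U g J a x = compL J g L (mnm_seq a) x.
Proof.
move=> Ud hL Ux; rewrite /pullback /compL size_mnm_seq.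
have sz : size (mnm_seq a) == mdeg a by rewrite size_mnm_seq.
pose tup : (mdeg a).-tuple 'I_s := Tuple sz.
pose lab := tnth tup.
have labE : labs lab [set: 'I_(mdeg a)]%SET = mnm_seq a.
  by rewrite /labs enum_setT -enumT map_tnth_enum.
have blkE B : block_mnm B = mnms (labs lab B) :> multinom s.
  apply/mnmP => r; rewrite mnmsE multinomE tnth_mktuple /labs count_map.
  rewrite -size_filter cardE /enum_mem; congr size.
  rewrite -filter_predI; apply: eq_filter => p /=; rewrite !inE andbC; congr andb.
  rewrite /lab (tnth_nth r)/= onthE (nth_map r) ?size_mnm_seq//.
have XE B j : partial U g (block_mnm B) x 0 j = L (labs lab B) x 0 j.
  by rewrite blkE (partial_mnms (@norm_hausdorff _ _) _ Ud hL Ux).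
rewrite -labE (@compv_labs _ _ _ _ _ lab) ?cardsT ?card_ord//.
under eq_bigr => b _ do rewrite faaE scaler_suml.
rewrite exchange_big/=; apply: eq_bigr => P Pp.
have -> : enum P = [seq enum_val l | l <- enum 'I_#|P|].
  apply: (@eq_from_nth _ finset.set0); first by rewrite size_map size_enum_ord -cardE.
  move=> i; rewrite -cardE => iP.
  by rewrite (nth_map (Ordinal iP)) ?size_enum_ord// (enum_val_nth finset.set0) nth_enum_ord.
rewrite bsum_ffun.
under eq_bigr => b _ do rewrite scaler_suml big_mkcond/=.
rewrite exchange_big/=; apply: eq_bigr => i _.
have ib : (mdeg (ctype i) < (mdeg a).+1)%N.
  by rewrite mdeg_ctype ltnS; have := card_partition_le Pp; rewrite cardsT card_ord.
rewrite (bigD1 (BMultinom ib))//= eqxx [X in _ + X]big1 ?addr0 => [|b bi].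
  by congr (_ *: _); apply: eq_bigr => l _; rewrite XE.
case: eqP => // eb; case/negP: bi; apply/eqP/val_inj => /=; exact/esym.
Qed.

End ChainRule.

(** * Taylor polynomials *)

Section TaylorPolynomials.
Variables (R : realType) (n : nat) (E : tvsType R).
Implicit Types (a b : multinom n) (x y z v : 'rV[R]_n) (J : jet R n E).

(** The monomial v ^ b / b!, which is the shape in which the Taylor coefficients occur. *)
Definition mono b v : R := (\prod_(i < n) v 0 i ^+ b i) / (\prod_(i < n) (b i)`!)%N%:R.

Lemma monoE b v : mono b v = \prod_(i < n) (v 0 i ^+ b i / (b i)`!%:R).
Proof. by rewrite /mono natr_prod -prodf_div. Qed.

Lemma mono0 v : mono mnm0 v = 1.
Proof.
by rewrite monoE big1// => i _; rewrite mnm0E expr0 divr1.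
Qed.

Lemma mono_0 b : b != mnm0 -> mono b 0 = 0.
Proof.
move=> b0; have [i bi] : exists i, b i != 0%N.
  apply/existsP; apply: contraNT b0 => /existsPn h; apply/eqP/mnmP => i.
  by rewrite mnm0E; apply/eqP; rewrite -[_ == _]negbK.
by rewrite monoE (bigD1 i)//= mxE expr0n (negbTE bi) mul0r mul0r.
Qed.

Lemma mono_norm b v : `|mono b v| <= `|v| ^+ mdeg b.
Proof.
rewrite monoE normr_prod mdegE expr_sum; apply: ler_prod => i _.
rewrite normr_ge0/= normrM normrX normfV (ger0_norm (ler0n _ _)).
rewrite ler_pdivrMr ?ltr0n ?fact_gt0//.
apply: (@le_trans _ _ (`|v| ^+ b i)); first by rewrite lerXn2r// ?nnegrE// rv_coord_le.
by rewrite ler_peMr ?exprn_ge0// ler1n fact_gt0.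
Qed.

Lemma cont_mono b y : continuous (fun x => mono b (x - y) : R^o).
Proof.
move=> x; rewrite /mono.
apply: (@tvs_cvgZ R R^o _ (nbhs x) _ (fun x => \prod_(i < n) (x - y) 0 i ^+ b i)
  (fun=> ((\prod_(i < n) (b i)`!)%N%:R)^-1)); last exact: cvg_cst.
have pw i k : (fun x => (x - y) 0 i ^+ k : R^o) @ x --> ((x - y) 0 i ^+ k : R^o).
  elim: k => [|k ih]; first exact: (@cvg_cst R^o 1 _ (nbhs x)).
  rewrite exprS; under eq_fun do rewrite exprS.
  apply: (@tvs_cvgZ R R^o _ (nbhs x) _ (fun x => (x - y) 0 i)) => //.
  apply: (@cvg_comp _ _ _ (fun x => x - y) (fun p => p 0 i) _ (nbhs (x - y))).
    by apply: (@tvs_cvgB R _ _ (nbhs x)); [exact: cvg_id|exact: cvg_cst].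
  exact: coord_continuous.
elim: (index_enum _) => [|i r ih].
  rewrite big_nil; under eq_fun do rewrite big_nil.
  exact: (@cvg_cst R^o 1 _ (nbhs x)).
rewrite big_cons; under eq_fun do rewrite big_cons.
exact: (@tvs_cvgZ R R^o _ (nbhs x)).
Qed.

Lemma dder_pow (y : 'rV[R]_n) i k x :
  dder (fun x => (x - y) 0 i ^+ k.+1 / k.+1`!%:R : R^o) x (ei R i)
    ((x - y) 0 i ^+ k / k`!%:R).
Proof.
have H j : dder (fun x => (x - y) 0 i ^+ j.+1 : R^o) x (ei R i)
    (j.+1%:R * (x - y) 0 i ^+ j).
  elim: j => [|j ih].
    rewrite expr0 mulr1; under eq_fun do rewrite expr1.
    move=> q qs e e0; exists 1 => // h _.
    have -> : (h *: ei R i + x - y) 0 i - (x - y) 0 i - h *: (1%:R : R^o) = 0.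
      by rewrite !mxE !eqxx mulr1 -addrA addrK /GRing.scale/= mulr1 subrr.
    by rewrite csemi0// mulr_ge0// ltW.
  have H1 : dder (fun x => (x - y) 0 i : R^o) x (ei R i) 1.
    move=> q qs e e0; exists 1 => // h _.
    have -> : (h *: ei R i + x - y) 0 i - (x - y) 0 i - h *: (1%:R : R^o) = 0.
      by rewrite !mxE !eqxx mulr1 -addrA addrK /GRing.scale/= mulr1 subrr.
    by rewrite csemi0// mulr_ge0// ltW.
  have := dder_prod H1 ih; rewrite /GRing.scale/=.
  under [in X in dder X]eq_fun do rewrite -exprS.
  suff -> : 1 * (x - y) 0 i ^+ j.+1 + (x - y) 0 i * (j.+1%:R * (x - y) 0 i ^+ j) =
     j.+2%:R * (x - y) 0 i ^+ j.+1 by [].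
  by rewrite -(natr1 j.+1) exprS; ring.
have := @dder_scale R R^o n (k.+1`!%:R^-1) _ _ _ _ (H k); rewrite /GRing.scale/=.
under [in X in dder X]eq_fun do rewrite mulrC.
suff -> : (k.+1)`!%:R^-1 * (k.+1%:R * (x - y) 0 i ^+ k) = (x - y) 0 i ^+ k / k`!%:R by [].
rewrite factS natrM invfM.
have k0 : k.+1%:R != 0 :> R by rewrite pnatr_eq0.
have k1 : k`!%:R != 0 :> R by rewrite pnatr_eq0 -lt0n fact_gt0.
by field; rewrite k1 addrC natr1.
Qed.

Lemma dder_mono b y i x : dder (fun x => mono b (x - y) : R^o) x (ei R i)
  (if b i == 0%N then 0 else mono (mnm_sub b (mnm1 i)) (x - y)).
Proof.
pose c := \prod_(j < n | j != i) ((x - y) 0 j ^+ b j / (b j)`!%:R).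
have ME h : mono b (h *: ei R i + x - y) =
    c * ((h *: ei R i + x - y) 0 i ^+ b i / (b i)`!%:R).
  rewrite monoE (bigD1 i)//= mulrC; congr (_ * _); apply: eq_bigr => j ji.
  by rewrite !mxE (negbTE ji) andbF mulr0 add0r.
have ME0 : mono b (x - y) = c * ((x - y) 0 i ^+ b i / (b i)`!%:R).
  by have := ME 0; rewrite scale0r add0r.
suff H : dder (fun z => c * ((z - y) 0 i ^+ b i / (b i)`!%:R) : R^o) x (ei R i)
    (if b i == 0%N then 0 else mono (mnm_sub b (mnm1 i)) (x - y)).
  move=> q qs e e0; have [d d0 hd] := H q qs e e0.
  by exists d => // h hh; rewrite ME ME0; exact: hd.
case: eqP => bi; first by rewrite bi; exact: (@dder_cst R R^o n (c * (1 / 0`!%:R))).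
have bk : b i = (b i).-1.+1 by rewrite prednK// lt0n; exact/eqP.
have -> : mono (mnm_sub b (mnm1 i)) (x - y) =
    c * ((x - y) 0 i ^+ (b i).-1 / (b i).-1`!%:R).
  rewrite monoE (bigD1 i)//= mulrC mnmBE mnm1E eqxx subn1; congr (_ * _).
  by apply: eq_bigr => j ji; rewrite mnmBE mnm1E eq_sym (negbTE ji) subn0.
have := @dder_scale R R^o n c _ _ _ _ (@dder_pow y i (b i).-1 x).
by rewrite -bk.
Qed.

Lemma sum_bm (V : nmodType) (G : multinom n -> V) M N : (M <= N)%N ->
  \sum_(b : bmultinom n N | (mdeg b < M)%N) G b = \sum_(b : bmultinom n M) G b.
Proof.
move=> MN.
pose h (b : bmultinom n M) : bmultinom n N := BMultinom (leq_trans (bmdeg b) MN).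
case: M => [|M] in MN h *.
  rewrite big_pred0// big1// => b _; by have := bmdeg b.
pose h' (b : bmultinom n N) : bmultinom n M.+1 := insubd bm0 (bmnm b).
rewrite (reindex_onto h h')/=; last first.
  by move=> b bM; apply: val_inj => /=; rewrite insubdK.
apply: eq_big => [b|//]; rewrite bmdeg/=.
by apply/eqP/val_inj; rewrite insubdK//; exact: (bmdeg b).
Qed.

(** Multi-indices b with b i > 0 correspond to those of degree one less by subtracting
the i-th unit: this is the effect of the i-th derivative on a Taylor polynomial. *)
Lemma sum_bm_shift (V : nmodType) (G : multinom n -> V) i M :
  \sum_(b : bmultinom n M.+1 | b i != 0%N) G (mnm_sub b (mnm1 i)) =
  \sum_(b : bmultinom n M) G b.
Proof.
have dS b : mdeg (mnm_add b (mnm1 i)) = (mdeg b).+1 by rewrite mdegD mdeg1 addn1.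
have hP (b : bmultinom n M) : (mdeg (mnm_add b (mnm1 i)) < M.+1)%N.
  by rewrite dS ltnS; exact: bmdeg.
pose h (b : bmultinom n M) : bmultinom n M.+1 := BMultinom (hP b).
have sK b : b i != 0%N -> mnm_add (mnm_sub b (mnm1 i)) (mnm1 i) = b.
  by move=> bi; apply/mnmP => j; rewrite mnmDE mnmBE mnm1E subnK//;
    case: eqP => // <-; rewrite lt0n.
case: M => [|M] in hP h *.
  rewrite [RHS]big1 => [|b _]; last by have := bmdeg b.
  rewrite big_pred0// => b; apply: negbTE; rewrite negbK.
  have := bmdeg b; rewrite ltnS leqn0 mdeg_eq0 => /eqP ->.
  by rewrite mnm0E.
pose h' (b : bmultinom n M.+2) : bmultinom n M.+1 := insubd bm0 (mnm_sub b (mnm1 i)).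
rewrite (reindex_onto h h')/=; last first.
  move=> b bi; have bM : (mdeg (mnm_sub b (mnm1 i)) < M.+1)%N.
    by rewrite -ltnS -dS sK//; exact: (bmdeg b).
  by apply: val_inj => /=; rewrite insubdK ?sK.
have addK b : mnm_sub (mnm_add b (mnm1 i)) (mnm1 i) = b.
  by apply/mnmP => j; rewrite mnmBE mnmDE addnK.
apply: eq_big => [b|b _]; last by rewrite addK.
rewrite mnmDE mnm1E eqxx addn1/=.
by apply/eqP/val_inj; rewrite /h' /= addK insubdK//; exact: (bmdeg b).
Qed.

(** The jet of the Taylor polynomial of order l of J at y. *)
Definition TJ l J y a x : E := if (mdeg a <= l)%N then
  \sum_(b : bmultinom n (l - mdeg a).+1) mono b (x - y) *: J (mnm_add a b) y else 0.

Lemma remainderE J l a y x : (mdeg a <= l)%N ->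
  remainder J l a y x = J a x - TJ l J y a x.
Proof. by move=> al; rewrite /TJ al. Qed.

Lemma TJ_center l J y a : (mdeg a <= l)%N -> TJ l J y a y = J a y.
Proof.
move=> al; rewrite /TJ al (bigD1 bm0)//= big1 => [|b b0].
  by rewrite subrr mono0 scale1r addr0; congr (J _ y); apply/mnmP => i; rewrite mnmDE mnm0E addn0.
by rewrite subrr mono_0 ?scale0r.
Qed.

Lemma MJ_taylor U l J y : MJ U (TJ l J y).
Proof.
apply: (@LJ_sub R n E U setT (fun s => TJ l J y (mnms s)) (@subsetT _ _)).
apply: LJ_mk => [s|s i x _].
  rewrite /TJ; case: (mdeg (mnms s) <= l)%N; last exact: cont_in_cst.
  move=> x _; apply: tvs_cvg_sum => b _; apply: tvs_cvgZ; last exact: cvg_cst.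
  by apply: cvg_within_filter; exact: cont_mono.
rewrite mnms_rcons; move: (mnms s) => a.
have dS : mdeg (mnm_add a (mnm1 i)) = (mdeg a).+1 by rewrite mdegD mdeg1 addn1.
rewrite /TJ dS; case: (leqP (mdeg a) l) => al; last by rewrite leqNgt ltnS (ltnW al)/=; exact: dder_cst.
have -> : (if (mdeg a < l)%N then \sum_(b : bmultinom n (l - (mdeg a).+1).+1)
      mono b (x - y) *: J (mnm_add (mnm_add a (mnm1 i)) b) y else 0) =
    \sum_(b : bmultinom n (l - mdeg a).+1)
      (if b i == 0%N then 0 else mono (mnm_sub b (mnm1 i)) (x - y)) *: J (mnm_add a b) y.
  rewrite [RHS](bigID (fun b : bmultinom n _ => b i == 0%N))/= [X in _ = X + _]big1 ?add0r; last first.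
    by move=> b ->; rewrite scale0r.
  rewrite [RHS](eq_bigr (fun b : bmultinom n (l - mdeg a).+1 =>
      (fun c => mono c (x - y) *: J (mnm_add (mnm_add a (mnm1 i)) c) y) (mnm_sub b (mnm1 i)))).
    rewrite (sum_bm_shift (fun c => mono c (x - y) *: J (mnm_add (mnm_add a (mnm1 i)) c) y)).
    case: (ltnP (mdeg a) l) => al'.
      by rewrite -subSn// subSS.
    have -> : (l - mdeg a = 0)%N by apply/eqP; rewrite subn_eq0.
    by rewrite big1// => b _; have := bmdeg b.
  move=> b bi; rewrite (negbTE bi); congr (_ *: J _ y); apply/mnmP => j.
  rewrite !mnmDE mnmBE mnm1E -addnA subnKC//.
  by case: eqP => // <-; rewrite lt0n.
apply: dder_sum => b _.
have := dder_prod (dder_mono b y i x) (dder_cst (J (mnm_add a b) y) x (ei R i)).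
by rewrite scaler0 addr0.
Qed.

(** Bounds at one point propagate by descending induction on the order of
differentiation, through the mean value inequality. *)
Lemma descend (O D : set 'rV[R]_n) c (G : jet R n E) l q (M r : R) y : open O ->
  (forall s, C1 O (G (mnms s)) (fun i => G (mnms (rcons s i)))) ->
  (forall a, cont_in D (G a)) ->
  convex_set D -> star_center O D c -> continuous_seminorm q ->
  0 <= M -> 0 <= r -> D y -> (forall z, D z -> `|z - y| <= r) ->
  (forall a, (mdeg a < l)%N -> q (G a y) <= M * r ^+ (l - mdeg a)) ->
  (forall a z, mdeg a = l -> D z -> q (G a z) <= M) ->
  forall a z, (mdeg a <= l)%N -> D z -> q (G a z) <= M * (n.+1%:R * r) ^+ (l - mdeg a).
Proof.
move=> Oo GC Gc Dc Ds qs M0 r0 Dy Dr Gy Gtop a z al.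
move ek : (l - mdeg a)%N => k; elim: k a al ek z => [|k ih] a al ek z Dz.
  rewrite expr0 mulr1; apply: Gtop => //; apply/eqP.
  by rewrite eqn_leq al /= -subn_eq0 ek.
have al' : (mdeg a < l)%N by rewrite -subn_gt0 ek.
have dS i : mdeg (mnms (rcons (mnm_seq a) i)) = (mdeg a).+1.
  by rewrite mdeg_mnms size_rcons size_mnm_seq.
have H := mvi_star Oo (GC (mnm_seq a)) Dc Ds (Gc _) qs
  (_ : 0 <= M * (n.+1%:R * r) ^+ k).
have {}H : q (G a z - G a y) <= n%:R * (M * (n.+1%:R * r) ^+ k) * `|z - y|.
  have := H _ _ y z Dy Dz; rewrite mnms_seq; apply.
    by rewrite mulr_ge0// exprn_ge0// mulr_ge0.
  move=> i w Dw _; apply: ih => //; rewrite dS//.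
  by rewrite subnS ek.
rewrite -(subrK (G a y) (G a z)); apply: le_trans (csemiD _ _ qs) _.
have h1 : q (G a y) <= M * r ^+ k.+1 by rewrite -ek; exact: Gy.
have h2 : n%:R * (M * (n.+1%:R * r) ^+ k) * `|z - y| <= n%:R * (M * (n.+1%:R * r) ^+ k) * r.
  by rewrite ler_wpM2l ?Dr// !mulr_ge0// exprn_ge0// mulr_ge0.
apply: le_trans (lerD (le_trans H h2) h1) _.
have -> : n%:R * (M * (n.+1%:R * r) ^+ k) * r = M * r ^+ k.+1 * (n%:R * n.+1%:R ^+ k).
  by rewrite exprMn exprS; ring.
have -> : M * (n.+1%:R * r) ^+ k.+1 = M * r ^+ k.+1 * (n.+1%:R * n.+1%:R ^+ k).
  by rewrite exprMn !exprS; ring.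
rewrite -[X in _ + X]mulr1 -mulrDr ler_wpM2l ?mulr_ge0 ?exprn_ge0//.
rewrite -(natr1 n) mulrDl mul1r lerD2l natr1 -natrX ler1n expn_gt0//.
Qed.

(** For x, y in D the function z |-> remainder J l a y z has vanishing jet of
order l at y. *)
Lemma taylor_bound U D c J l q (M r : R) y : MJ U J -> D `<=` U ->
  convex_set D -> star_center U° D c -> continuous_seminorm q ->
  0 <= M -> 0 <= r -> D y -> (forall z, D z -> `|z - y| <= r) ->
  (forall a z, mdeg a = l -> D z -> q (J a z - J a y) <= M) ->
  forall a x, (mdeg a <= l)%N -> D x ->
    q (remainder J l a y x) <= M * (n.+1%:R * r) ^+ (l - mdeg a).
Proof.
move=> hJ DU Dc Ds qs M0 r0 Dy Dr H a x al Dx.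
pose G : jet R n E := fun a x => J a x + (-1) *: TJ l J y a x.
have hG : MJ U G.
  by move=> k; apply: LJk_add; [exact: hJ|apply: LJk_scale; exact: MJ_taylor].
have GE b z : G b z = J b z - TJ l J y b z by rewrite /G scaleN1r.
rewrite remainderE// -GE.
apply: (@descend U° D c G l q M r y) => //.
- exact: open_interior.
- by move=> s; exact: (LJ_C1 s hG).
- move=> b; apply: cont_in_sub DU _.
  by have := LJ_cont (mnm_seq b) hG; rewrite mnms_seq.
- move=> b bl; rewrite GE TJ_center ?subrr; last exact: ltnW.
  by rewrite csemi0// mulr_ge0// exprn_ge0.
- move=> b z bl Dz; rewrite GE /TJ bl leqnn subnn (bigD1 bm0)//= big1 => [|c0 c0n].
    rewrite mono0 scale1r addr0.
    have -> : mnm_add b mnm0 = b by apply/mnmP => i; rewrite mnmDE mnm0E addn0.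
    exact: H.
  have := bmdeg c0; rewrite ltnS leqn0 mdeg_eq0 => /eqP c00.
  by case/negP: c0n; apply/eqP/val_inj.
Qed.

End TaylorPolynomials.

(** * Taylor remainders on locally convex sets *)

Section EuclideanNorm.
Variables (R : realType) (n : nat).
Implicit Types x y z c : 'rV[R]_n.

Lemma norm_le_euclidean x : `|x| <= euclidean_norm x.
Proof.
apply: rv_norm_le => [|i]; first exact: sqrtr_ge0.
rewrite -sqrtr_sqr; apply: ler_wsqrtr.
by rewrite (bigD1 i)//= lerDl; apply: sumr_ge0 => j _; exact: sqr_ge0.
Qed.

Lemma euclidean_le_norm x : euclidean_norm x <= n.+1%:R * `|x|.
Proof.
rewrite -[leRHS]ger0_norm ?mulr_ge0// -sqrtr_sqr; apply: ler_wsqrtr.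
apply: (@le_trans _ _ (\sum_(i < n) `|x| ^+ 2)).
  apply: ler_sum => i _; rewrite -real_normK ?num_real//.
  by rewrite lerXn2r ?nnegrE// rv_coord_le.
rewrite sumr_const card_ord -[leLHS]mulr_natl exprMn ler_wpM2r ?exprn_ge0//.
by rewrite -natrX ler_nat expnS expn1; apply: leq_trans (leqnSn n) _; rewrite leq_pmull.
Qed.

Lemma euclidean_gt0 x : (0 < euclidean_norm x) = (x != 0).
Proof.
apply/idP/idP => [|x0]; last by apply: lt_le_trans (norm_le_euclidean x); rewrite normr_gt0.
by apply: contraTneq => ->; rewrite -leNgt; apply: le_trans (euclidean_le_norm 0) _;
  rewrite normr0 mulr0.
Qed.

End EuclideanNorm.

Section StarGeometry.
Variables (R : realType) (n : nat).
Implicit Types (x y z c : 'rV[R]_n) (U C : set 'rV[R]_n).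

(** The triangle with vertices x, y, c. *)
Definition hull3 x y c := [set z : 'rV[R]_n | exists a b g : R,
  [/\ 0 <= a, 0 <= b, 0 <= g, a + b + g = 1 & z = a *: x + b *: y + g *: c]].

Lemma hull3_convex x y c : convex_set (hull3 x y c).
Proof.
apply/convex_setP => z w t [a [b [g [a0 b0 g0 s ->]]]] [a' [b' [g' [a0' b0' g0' s' ->]]]].
move=> /andP[t0 t1]; have t1' : 0 <= 1 - t by rewrite subr_ge0.
exists (t * a + (1 - t) * a'), (t * b + (1 - t) * b'), (t * g + (1 - t) * g').
split; rewrite ?addr_ge0 ?mulr_ge0//.
  have -> : t * a + (1 - t) * a' + (t * b + (1 - t) * b') + (t * g + (1 - t) * g') =
    t * (a + b + g) + (1 - t) * (a' + b' + g') by ring.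
  by rewrite s s'; ring.
by apply/rowP => i; rewrite !mxE; ring.
Qed.

Lemma hull3P x y c z : hull3 x y c z <-> exists t u : R,
  [/\ 0 <= t <= 1, 0 <= u <= 1 & z = t *: c + (1 - t) *: (u *: x + (1 - u) *: y)].
Proof.
split=> [[a [b [g [a0 b0 g0 s ->]]]]|[t [u [/andP[t0 t1] /andP[u0 u1] ->]]]]; last first.
  exists ((1 - t) * u), ((1 - t) * (1 - u)), t.
  split; rewrite ?mulr_ge0 ?subr_ge0//; first by ring.
  by apply/rowP => i; rewrite !mxE; ring.
have bE : b = 1 - a - g by rewrite -s; ring.
have gle : g <= 1 by rewrite -s lerDr addr_ge0.
have [g1|g1] := eqVneq g 1.
  exists 1, 0; split; rewrite ?lexx ?ler01//.
  have a0' : a = 0 by apply/eqP; rewrite eq_le a0 andbT; lra.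
  by rewrite bE a0' g1; apply/rowP => i; rewrite !mxE; ring.
have g1' : 0 < 1 - g by rewrite subr_gt0 lt_neqAle g1.
exists g, (a / (1 - g)); split; first by rewrite g0.
  rewrite divr_ge0 ?(ltW g1')//= ler_pdivrMr// mul1r; lra.
by rewrite bE; apply/rowP => i; rewrite !mxE; field; rewrite gt_eqF.
Qed.

Lemma hull3_sub x y c C : convex_set C -> C x -> C y -> C c -> hull3 x y c `<=` C.
Proof.
move=> /convex_setP Cc Cx Cy Cz z /hull3P[t [u [t01 u01 ->]]].
by apply: (Cc) => //; exact: (Cc).
Qed.

Lemma hull3_l x y c : hull3 x y c x.
Proof. by exists 1, 0, 0; split=> //; rewrite ?addr0// scale1r !scale0r !addr0. Qed.

Lemma hull3_m x y c : hull3 x y c y.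
Proof. by exists 0, 1, 0; split=> //; rewrite ?addr0 ?add0r// scale1r !scale0r addr0 add0r. Qed.

Lemma hull3_r x y c : hull3 x y c c.
Proof. by exists 0, 0, 1; split=> //; rewrite ?addr0 ?add0r// scale1r !scale0r !add0r. Qed.

(** Near z0 any two points of U span, together with a point of the interior of U
close to them, a triangle which lies in the interior of U up to one side. *)
Lemma locally_star U z0 : locally_convex_set U -> dense_interior U -> U z0 ->
  exists r c, 0 < r /\ forall x y, U x -> U y -> `|x - z0| < r -> `|y - z0| < r ->
    hull3 x y c `<=` U /\
    (x != y -> exists D c', [/\ convex_set D, D `<=` hull3 x y c,
      star_center U° D c', D x /\ D y & forall z, D z -> `|z - y| <= 2 * `|x - y|]).
Proof.
move=> Ul Ud Uz; have [C [Cc CU]] := Ul _ Uz.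
rewrite /within/= => /nbhs_ballP[r /= r0 rC].
have CP := (convex_setP _).1 Cc.
have inC x : U x -> `|x - z0| < r -> C x.
  by move=> Ux xr; apply: rC => //; rewrite -ball_normE/= distrC.
have [c [Uc cr]] := Ud _ Uz _ (nbhsx_ballx z0 r r0).
have /nbhs_ballP[e /= e0 eC] : nbhs c (U° `&` ball z0 r).
  apply: filterI; first exact: interior_nbhs.
  by apply: open_nbhs_nbhs; split => //; exact: ball_open.
have ballC c1 : ball c e c1 -> C c1.
  by move=> /eC[Uc1 c1r]; apply: rC => //; exact: interior_subset.
have CC : C c by apply: (ballC); exact: ballxx.
have star p t : C p -> 0 < t <= 1 -> U° (t *: c + (1 - t) *: p).
  move=> Cp /andP[t0 t1]; apply: (@filterS _ _ _ (ball (t *: c + (1 - t) *: p) (t * e))); last first.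
    by apply: nbhsx_ballx; rewrite mulr_gt0.
  move=> w wb; apply: (CU).
  have -> : w = t *: (t^-1 *: (w - (1 - t) *: p)) + (1 - t) *: p.
    by apply/rowP => i; rewrite !mxE; field; rewrite gt_eqF.
  apply: (CP) => //; last by rewrite (ltW t0).
  apply: (ballC); rewrite -ball_normE/=.
  have -> : c - t^-1 *: (w - (1 - t) *: p) = t^-1 *: (t *: c + (1 - t) *: p - w).
    by apply/rowP => i; rewrite !mxE; field; rewrite gt_eqF.
  rewrite normrZ gtr0_norm ?invr_gt0// ltr_pdivrMl//.
  by move: wb; rewrite -ball_normE.
exists r, c; split => // x y Ux Uy xr yr.
have Cx := inC x Ux xr; have Cy := inC y Uy yr.
split; first by move=> z /(hull3_sub Cc Cx Cy CC); exact: CU.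
move=> xy; have xy0 : 0 < `|x - y| by rewrite normr_gt0 subr_eq0.
have cx0 : 0 < `|c - x| + 1 by rewrite ltr_wpDl.
pose t := Num.min 1 (`|x - y| / (`|c - x| + 1)).
have t0 : 0 < t by rewrite lt_min ltr01 divr_gt0.
have t1 : t <= 1 by rewrite ge_min lexx.
pose c' := t *: c + (1 - t) *: x.
have c'h : hull3 x y c c'.
  exists (1 - t), 0, t; split; rewrite ?subr_ge0 ?(ltW t0)//.
    by rewrite addr0 subrK.
  by rewrite scale0r addr0 addrC.
have c'x : `|c' - x| <= `|x - y|.
  have -> : c' - x = t *: (c - x).
    by rewrite /c' scalerBl scale1r scalerBr addrA addrAC addrK.
  rewrite normrZ gtr0_norm//; apply: (@le_trans _ _ (t * (`|c - x| + 1))).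
    by rewrite ler_wpM2l ?lerDl// ltW.
  by rewrite -ler_pdivlMr// ge_min lexx orbT.
have HC : hull3 x y c' `<=` C.
  by apply: hull3_sub => //; exact: (hull3_sub Cc Cx Cy CC c'h).
exists (hull3 x y c'), c'; split.
- exact: hull3_convex.
- apply: hull3_sub => //; [exact: hull3_convex|exact: hull3_l|exact: hull3_m].
- split; first exact: hull3_r.
  move=> p s /HC Cp /andP[s0 s1].
  have [st1|st1] := eqVneq (s * t) 1.
    have s1' : s = 1.
      apply/eqP; rewrite eq_le s1 -st1 /=; rewrite ger_pMr//.
    have t1' : t = 1 by move: st1; rewrite s1' mul1r.
    rewrite s1' /c' t1' subrr scale0r scale0r !addr0 !scale1r.
    by have := star x 1 Cx; rewrite ltr01 lexx subrr scale0r addr0 scale1r; apply.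
  have st0 : 0 < s * t by rewrite mulr_gt0.
  have stle : s * t <= 1 by rewrite mulr_ile1 // ltW.
  have st1' : 0 < 1 - s * t by rewrite subr_gt0 lt_neqAle st1.
  have -> : s *: c' + (1 - s) *: p = (s * t) *: c + (1 - s * t) *:
     ((s * (1 - t) / (1 - s * t)) *: x + (1 - s * (1 - t) / (1 - s * t)) *: p).
    by apply/rowP => i; rewrite !mxE; field; rewrite gt_eqF.
  apply: (star); last by rewrite st0.
  have st2 : 0 <= s * (1 - t) by rewrite mulr_ge0 ?subr_ge0// ltW.
  apply: (CP) => //; rewrite divr_ge0 ?(ltW st1')//= ler_pdivrMr// mul1r.
  by rewrite mulrBr mulr1 lerD2r.
- by split; [exact: hull3_l|exact: hull3_m].
- move=> z [a [b [g [a0 b0 g0 s ->]]]].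
  have -> : a *: x + b *: y + g *: c' - y = a *: (x - y) + g *: (c' - y).
    have -> : b = 1 - a - g by rewrite -s; ring.
    by apply/rowP => i; rewrite !mxE; ring.
  apply: le_trans (ler_normD _ _) _; rewrite !normrZ !ger0_norm//.
  have cy : `|c' - y| <= 2 * `|x - y|.
    rewrite -(subrKA x); apply: le_trans (ler_normD _ _) _.
    by rewrite mulr2n mulrDl mul1r lerD.
  have xy2 : `|x - y| <= 2 * `|x - y| by rewrite ler_peMl// ler1n.
  apply: le_trans (lerD (ler_wpM2l a0 xy2) (ler_wpM2l g0 cy)) _.
  rewrite -mulrDl ler_piMl// ?mulr_ge0//.
  by rewrite -s -addrA lerD2l lerDr.
Qed.

End StarGeometry.

Section CompactSets.
Variables (R : realType) (n : nat).
Implicit Types (x y z c : 'rV[R]_n) (U K L : set 'rV[R]_n).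

Lemma cont_in_bound (E : tvsType R) U (f : 'rV[R]_n -> E) K q : cont_in U f ->
  compact K -> K `<=` U -> continuous_seminorm q ->
  exists2 M, 0 <= M & forall z, K z -> q (f z) <= M.
Proof.
move=> fc /compact_near_coveringP Kc KU qs.
have : \forall M \near +oo, K `<=` (fun z => U z -> q (f z) <= M).
  apply: Kc => z Kz.
  exists ([set z' | U z' -> q (f z' - f z) < 1], [set M | q (f z) + 1 <= M]) => /=.
    split; first exact: (cont_in_near fc qs (KU _ Kz) ltr01).
    by apply: nbhs_pinfty_ge; exact: num_real.
  move=> [z' M] /= [h1 h2] Uz'; apply: le_trans h2.
  rewrite -(subrK (f z) (f z')); apply: le_trans (csemiD _ _ qs) _.
  by rewrite addrC lerD2l ltW// h1.
move=> H; have [M M0 HM] : exists2 M, 0 <= M & K `<=` (fun z => U z -> q (f z) <= M).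
  near (+oo : set_system R) => M; exists M; last by near: M.
  near: M; by apply: nbhs_pinfty_ge; exact: num_real.
by exists M => // z Kz; apply: HM => //; exact: KU.
Unshelve. all: by end_near. Qed.

(** The points of the triangles with vertices c, x, y as a continuous image of a compact
product. *)
Definition cone3 c (w : ('rV[R]_n * 'rV[R]_n) * (R^o * R^o)) : 'rV[R]_n :=
  w.2.1 *: c + (1 - w.2.1) *: (w.2.2 *: w.1.1 + (1 - w.2.2) *: w.1.2).

Lemma cone3_continuous c : continuous (cone3 c).
Proof.
move=> w.
have c1 : (fun w : ('rV[R]_n * 'rV[R]_n) * (R^o * R^o) => w.1) @ w --> w.1 by exact: cvg_fst.
have c2 : (fun w : ('rV[R]_n * 'rV[R]_n) * (R^o * R^o) => w.2) @ w --> w.2 by exact: cvg_snd.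
have c11 : (fun w : ('rV[R]_n * 'rV[R]_n) * (R^o * R^o) => w.1.1) @ w --> w.1.1.
  by apply: (cvg_comp _ _ c1); exact: cvg_fst.
have c12 : (fun w : ('rV[R]_n * 'rV[R]_n) * (R^o * R^o) => w.1.2) @ w --> w.1.2.
  by apply: (cvg_comp _ _ c1); exact: cvg_snd.
have c21 : (fun w : ('rV[R]_n * 'rV[R]_n) * (R^o * R^o) => w.2.1) @ w --> w.2.1.
  by apply: (cvg_comp _ _ c2); exact: cvg_fst.
have c22 : (fun w : ('rV[R]_n * 'rV[R]_n) * (R^o * R^o) => w.2.2) @ w --> w.2.2.
  by apply: (cvg_comp _ _ c2); exact: cvg_snd.
have cB (u : ('rV[R]_n * 'rV[R]_n) * (R^o * R^o) -> R^o) a : u @ w --> a -> (fun w => 1 - u w) @ w --> 1 - a.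
  by move=> ua; apply: (@tvs_cvgB R R^o) => //; exact: cvg_cst.
apply: tvs_cvgD; first by apply: tvs_cvgZ => //; exact: cvg_cst.
apply: tvs_cvgZ; first exact: cB.
by apply: tvs_cvgD; apply: tvs_cvgZ => //; exact: cB.
Qed.

Lemma closed_ball_compact z (r : R) : compact [set x | `|x - z| <= r].
Proof.
apply: bounded_closed_compact.
  exists (r + `|z|); split; first exact: num_real.
  move=> M hM x /= xr; apply: le_trans (ltW hM).
  rewrite -(subrK z x); apply: le_trans (ler_normD _ _) _.
  by rewrite lerD2r.
rewrite (_ : [set x | _] = (fun x => `|x - z|) @^-1` [set t | t <= r]); last by [].
apply: closed_comp; last exact: closed_le.
move=> x _; apply: (@cvg_comp _ _ _ (fun x => x - z) (fun x => `|x|) _ (nbhs (x - z))).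
  by apply: (@tvs_cvgB R _ _ (nbhs x)); [exact: cvg_id|exact: cvg_cst].
exact: norm_continuous.
Qed.

(** Finitely many cones over pieces of K contain all the triangles needed to
estimate the Taylor remainders between close points of K. *)
Lemma compact_star U K : locally_convex_set U -> dense_interior U ->
  compact K -> K `<=` U ->
  exists L d, [/\ compact L, L `<=` U, K `<=` L, 0 < d &
    forall x y, K x -> K y -> x != y -> `|x - y| < d ->
      exists D c', [/\ convex_set D, D `<=` L,
        star_center U° D c', D x /\ D y & forall z, D z -> `|z - y| <= 2 * `|x - y|]].
Proof.
move=> Ul Ud Kc KU.
have /choice[rc H] z : exists rc : R * 'rV[R]_n, U z -> 0 < rc.1 /\
    forall x y, U x -> U y -> `|x - z| < rc.1 -> `|y - z| < rc.1 ->
    hull3 x y rc.2 `<=` U /\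
    (x != y -> exists D c', [/\ convex_set D, D `<=` hull3 x y rc.2,
      star_center U° D c', D x /\ D y & forall w, D w -> `|w - y| <= 2 * `|x - y|]).
  have [Uz|nUz] := pselect (U z); last by exists (0, 0).
  by have [r [c h]] := locally_star Ul Ud Uz; exists (r, c).
pose r z := (rc z).1; pose c z := (rc z).2.
have cv : cover_compact K by rewrite -compact_cover.
have [||D' D'K cov] := cv _ K (fun z => ball z (r z / 4)).
- by move=> z Kz; exact: ball_open.
- move=> z Kz; exists z => //; apply: ballxx; rewrite divr_gt0//.
  exact: (H z (KU _ Kz)).1.
pose Kz z := K `&` [set x | `|x - z| <= r z / 2].
have Kzc z : compact (Kz z).
  by apply: compact_closedI => //; apply: compact_closed (@closed_ball_compact _ _); exact: norm_hausdorff.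
pose Lz z := cone3 (c z) @` ((Kz z `*` Kz z) `*` (`[0, 1] `*` `[0, 1])).
have Lzc z : compact (Lz z).
  apply: continuous_compact; first exact/continuous_subspaceT/cone3_continuous.
  by do 2 apply: compact_setX => //; exact: segment_compact.
have hullL z x y : Kz z x -> Kz z y -> hull3 x y (c z) `<=` Lz z.
  move=> xK yK w /hull3P[t [u [t01 u01 ->]]].
  by exists ((x, y), (t, u)) => //; split => //; split; rewrite /= in_itv.
have D'r z : z \in D' -> 0 < r z.
  by move=> /D'K; rewrite inE => /KU /H[].
have Lsub z : z \in D' -> Lz z `<=` U.
  move=> zD; have r0 := D'r z zD.
  have r2 : r z / 2 < r z by rewrite ltr_pdivrMr// ltr_pMr// ltr1n.
  move: (zD) => /D'K; rewrite inE => /KU Uz w [[[x y] [t u]] [[[Kx xr] [Ky yr]] [/= t01 u01]] <-].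
  have := (H z Uz).2 x y (KU _ Kx) (KU _ Ky) (le_lt_trans xr r2) (le_lt_trans yr r2).
  move=> [+ _]; apply; apply/hull3P; exists t, u.
  by split.
have [d d0 dr] : exists2 d : R, 0 < d & forall z, z \in D' -> d < r z / 4.
  have : \forall d \near (0 : R)^'+, forall z, z \in D' -> d < r z / 4.
    have := near_seq (at_right_proper_filter (0 : R)) (r := D')
      (P := fun z d => d < r z / 4); apply => z zD.
    by apply: nbhs_right_lt; rewrite divr_gt0// D'r.
  move=> h; near (0 : R)^'+ => d; exists d => //.
  by near: d.
exists (K `|` \big[setU/set0]_(z <- D') Lz z), d; split => //.
- by apply: compactU => //; exact: bigsetU_compact.
- move=> w [/KU//|]; rewrite -bigcup_seq => -[z /= zD]; exact: Lsub.
move=> x y Kx Ky xy xyd; have [z /= zD zx] := cov x Kx.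
move: zx; rewrite -ball_normE/= distrC => zx.
have r0 := D'r z zD; have dz := dr z zD.
have Uz : U z by move: zD => /D'K; rewrite inE => /KU.
have zy : `|y - z| < r z / 2.
  rewrite -(subrKA x); apply: le_lt_trans (ler_normD _ _) _; rewrite distrC.
  have -> : r z / 2 = r z / 4 + r z / 4 by field.
  by rewrite ltrD// (lt_trans xyd).
have zx' : `|x - z| < r z / 2.
  by apply: lt_trans zx _; rewrite ltr_pM2l// ltf_pV2 ?posrE// ltr_nat.
have r2 : r z / 2 < r z by rewrite ltr_pdivrMr// ltr_pMr// ltr1n.
have [_ /(_ xy)[D [c' [D1 D2 D3 D4 D5]]]] := (H z Uz).2 x y (KU _ Kx) (KU _ Ky)
  (lt_trans zx' r2) (lt_trans zy r2).
exists D, c'; split => // w /D2 Hw; right; rewrite -bigcup_seq; exists z => //=.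
by apply: hullL Hw; split => //; exact: ltW.
Unshelve. all: by end_near. Qed.

End CompactSets.

Section SmoothWhitney.
Variables (R : realType) (n : nat) (E : tvsType R).
Implicit Types (x y z c : 'rV[R]_n) (U K L : set 'rV[R]_n) (J : jet R n E).

(** The o(|x - y|^(l - |a|)) comes from the uniform continuity of the derivatives of
order l on a compact set containing the triangles spanned by close points of K. *)
Lemma smooth_whitney U K J l a q e : locally_convex_set U -> dense_interior U ->
  MJ U J -> compact K -> K `<=` U -> (mdeg a <= l)%N -> continuous_seminorm q ->
  0 < e ->
  exists2 d : R, 0 < d & forall x y, K x -> K y -> 0 < `|x - y| < d ->
    q (remainder J l a y x) <= e * `|x - y| ^+ (l - mdeg a).
Proof.
move=> Ul Ud hJ /compact_near_coveringP Kc KU al qs e0.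
pose A : R := (n.+1%:R * 2) ^+ (l - mdeg a).
have A0 : 0 < A by rewrite exprn_gt0// mulr_gt0.
pose e1 := e / A; have e10 : 0 < e1 by rewrite divr_gt0.
have e12 : 0 < e1 / 2 by rewrite divr_gt0.
have : \forall d \near (0 : R)^'+, K `<=` (fun x => K x -> forall y, K y -> 0 < `|x - y| < d ->
    q (remainder J l a y x) <= e * `|x - y| ^+ (l - mdeg a)).
  apply: Kc => z /KU Uz.
  have [r [c [r0 H]]] := locally_star Ul Ud Uz.
  have : \forall w \near z, forall b : bmultinom n l.+1, U w -> q (J b w - J b z) < e1 / 2.
    apply: (@near_fin _ (nbhs z) _ _ (fun (b : bmultinom n l.+1) w => U w -> q (J b w - J b z) < e1 / 2)) => b.
    by have := cont_in_near (LJ_cont (mnm_seq b) hJ) qs Uz e12; rewrite mnms_seq.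
  move=> /nbhs_ballP[r' /= r'0 Hr'].
  pose m := Num.min r r' / 4; have m0 : 0 < m by rewrite divr_gt0// lt_min r0.
  have m4 : 4 * m = Num.min r r' by rewrite /m mulrC divfK.
  exists (ball z m, [set d | d < m]) => /=.
    by split; [exact: nbhsx_ballx|exact: nbhs_right_lt].
  move=> [x d] /= []; rewrite -ball_normE/= distrC => xz dm Kx y Ky /andP[xy0 xyd].
  have xym := lt_trans xyd dm.
  have yz : `|y - z| < 2 * m.
    rewrite -(subrKA x); apply: le_lt_trans (ler_normD _ _) _; rewrite distrC; lra.
  have mr : 4 * m <= r by rewrite m4 ge_min lexx.
  have mr' : 4 * m <= r' by rewrite m4 ge_min lexx orbT.
  have xy : x != y by rewrite -subr_eq0 -normr_gt0.
  have [] := H x y (KU _ Kx) (KU _ Ky).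
  - lra.
  - lra.
  move=> hU /(_ xy)[D [c' [D1 D2 D3 [Dx Dy] D5]]].
  have DU : D `<=` U by move=> w /D2 /hU.
  have small w b : D w -> mdeg b = l -> q (J b w - J b z) < e1 / 2.
    move=> Dw bl; have bl' : (mdeg b < l.+1)%N by rewrite bl.
    apply: (Hr' w _ (BMultinom bl')); last exact: DU.
    rewrite -ball_normE/= distrC -(subrKA y); apply: le_lt_trans (ler_normD _ _) _.
    have := D5 w Dw; lra.
  have := @taylor_bound R n E U D c' J l q e1 (2 * `|x - y|) y hJ DU D1 D3 qs.
  move=> /(_ (ltW e10) _ Dy D5 _ a x al Dx) HT.
  apply: (le_trans (HT _ _)).
  - by rewrite mulr_ge0.
  - move=> b w bl Dw; apply: le_trans (csemi_tri _ (J b z) _ qs) _.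
    rewrite (splitr e1); apply: lerD; first by rewrite ltW// small.
    by rewrite csemiC// ltW// small.
  rewrite mulrA exprMn -/A mulrA /e1 divfK// gt_eqF//.
move=> h; have [d d0 Hd] : exists2 d : R, 0 < d & K `<=` (fun x => K x -> forall y, K y -> 0 < `|x - y| < d ->
    q (remainder J l a y x) <= e * `|x - y| ^+ (l - mdeg a)).
  by near (0 : R)^'+ => d; exists d => //; near: d.
by exists d => // x y Kx Ky; exact: Hd.
Unshelve. all: by end_near. Qed.

(** Between close points Taylor's formula applies on a triangle; the remainder at points
at a distance bounded below is estimated term by term. The constant does not
depend on the jet, which is what continuity of the restriction map needs. *)
Lemma whitney_bound U K : locally_convex_set U -> dense_interior U ->
  compact K -> K `<=` U ->
  exists L, [/\ compact L, L `<=` U, K `<=` L &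
    forall (l : nat) (q : E -> R), continuous_seminorm q -> exists2 C : R, 0 <= C &
      forall J (S : R), MJ U J -> 0 <= S ->
      (forall b z, (mdeg b <= l)%N -> L z -> q (J b z) <= S) ->
      forall a x y, (mdeg a <= l)%N -> K x -> K y -> x != y ->
        q (remainder J l a y x) <= C * S * `|x - y| ^+ (l - mdeg a)].
Proof.
move=> Ul Ud Kc KU; have [L [d [Lc LU KL d0 H]]] := compact_star Ul Ud Kc KU.
exists L; split=> // l q qs.
have [B B1 HB] : exists2 B : R, 1 <= B & forall x y, K x -> K y -> `|x - y| <= B.
  have [M [Mr HM]] := compact_bounded Kc.
  have M1 : M < Num.max M 1 + 1 by rewrite ltr_pwDr// le_max lexx.
  exists ((Num.max M 1 + 1) * 2).
    rewrite -[leLHS]mulr1 ler_pM// ?ler1n//.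
    by rewrite ler_wpDr// le_max lexx orbT.
  move=> x y /(HM _ M1)/= hx /(HM _ M1)/= hy.
  by apply: le_trans (ler_normB _ _) _; rewrite mulr_natr mulr2n lerD.
pose d1 := Num.min d 1; have d10 : 0 < d1 by rewrite lt_min d0 ltr01.
pose N : R := #|{: bmultinom n l.+1}|%:R.
pose C1 : R := 2 * (n.+1%:R * 2) ^+ l.
pose C2 : R := (1 + N * B ^+ l) / d1 ^+ l.
have C10 : 0 <= C1 by rewrite mulr_ge0// exprn_ge0// mulr_ge0.
have B0 : 0 <= B by apply: le_trans B1.
have C20 : 0 <= C2 by rewrite divr_ge0// ?exprn_ge0 ?(ltW d10)// addr_ge0// mulr_ge0// exprn_ge0.
exists (C1 + C2); first exact: addr_ge0.
move=> J S hJ S0 HS a x y al Kx Ky xy.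
have xy0 : 0 < `|x - y| by rewrite normr_gt0 subr_eq0.
pose j := (l - mdeg a)%N.
have jl : (j <= l)%N by exact: leq_subr.
have [xyd|xyd] := ltP `|x - y| d.
  have [D [c' [D1 D2 D3 [Dx Dy] D5]]] := H x y Kx Ky xy xyd.
  have DU : D `<=` U by move=> w /D2 /LU.
  have := @taylor_bound R n E U D c' J l q (2 * S) (2 * `|x - y|) y hJ DU D1 D3 qs.
  move=> /(_ _ _ Dy D5 _ a x al Dx) HT; apply: (le_trans (HT _ _ _)).
  - by rewrite mulr_ge0.
  - by rewrite mulr_ge0.
  - move=> b w bl Dw; apply: le_trans (csemiB _ _ qs) _.
    by rewrite mulr2n mulrDl mul1r lerD// HS ?bl//; apply: D2.
  rewrite -/j mulrA exprMn mulrA ler_wpM2r ?exprn_ge0//.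
  apply: (@le_trans _ _ (C1 * S)); last by rewrite ler_wpM2r// lerDl.
  rewrite /C1 mulrAC ler_wpM2r// ler_wpM2l// ler_weXn2l//.
  by rewrite -natrM ler1n muln2.
have h1 : q (remainder J l a y x) <= (1 + N * B ^+ l) * S.
  rewrite /remainder; apply: le_trans (csemiB _ _ qs) _; rewrite mulrDl mul1r.
  apply: lerD; first by apply: HS => //; exact: KL.
  apply: le_trans (csemi_sum _ _ _ qs) _.
  apply: (@le_trans _ _ (\sum_(b : bmultinom n (l - mdeg a).+1) B ^+ l * S)).
    apply: ler_sum => b _; rewrite csemiZ//.
    have bl : (mdeg b <= l - mdeg a)%N by rewrite -ltnS; exact: bmdeg.
    have bl' : (mdeg b <= l)%N := leq_trans bl (leq_subr _ _).
    apply: ler_pM => //; first exact: csemi_ge0.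
      apply: le_trans (mono_norm b (x - y)) _.
      apply: (@le_trans _ _ (B ^+ mdeg b)); first by rewrite lerXn2r ?nnegrE// HB.
      by rewrite ler_weXn2l.
    apply: HS; last exact: KL.
    by rewrite mdegD -leq_subRL.
  rewrite sumr_const -[leLHS]mulr_natl mulrA ler_wpM2r// ler_wpM2r ?exprn_ge0//.
  rewrite ler_nat -!sum1_card -(sum_bm (fun=> 1%N) (_ : ((l - mdeg a).+1 <= l.+1)%N)).
    by rewrite [leqRHS](bigID (fun b : bmultinom n l.+1 => (mdeg b < (l - mdeg a).+1)%N))/= leq_addr.
  by rewrite ltnS leq_subr.
have d1j : d1 ^+ l <= `|x - y| ^+ j.
  have d1le : d1 <= 1 by rewrite /d1 ge_min lexx orbT.
  have d1xy : d1 <= `|x - y| by rewrite /d1 ge_min xyd.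
  apply: (@le_trans _ _ (d1 ^+ j)); first by rewrite ler_wiXn2l// ltW.
  by rewrite lerXn2r// nnegrE ?normr_ge0// ltW.
apply: (le_trans h1); rewrite -/j.
apply: (@le_trans _ _ (C2 * S * d1 ^+ l)).
  by rewrite /C2 [leRHS]mulrAC divfK ?lexx// gt_eqF ?exprn_gt0.
apply: ler_pM => //; first by rewrite mulr_ge0.
  by rewrite exprn_ge0 ?(ltW d10).
by rewrite ler_wpM2r// lerDr.
Qed.

End SmoothWhitney.

(** * A smooth partition of unity on the line *)

Section SmoothStep.
Variable R : realType.
Implicit Types (f g : R -> R) (t u h : R).

(** Differentiability of order k, as a predicate stable under products and inverses by
induction on k. *)
Fixpoint smo k f : Prop := if k is k'.+1 then
  exists f' : R -> R, (forall t, is_derive t 1 f (f' t)) /\ smo k' f' else True.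

Lemma smoS k f : smo k.+1 f -> smo k f.
Proof. by elim: k f => [//|k ih] f [f' [h /ih h']]; exists f'. Qed.

Lemma smo_add k f g : smo k f -> smo k g -> smo k (fun t => f t + g t).
Proof.
elim: k f g => [//|k ih] f g [f' [h h']] [g' [i i']].
exists (fun t => f' t + g' t); split; last exact: ih.
by move=> t; have := h t; have := i t => ? ?; exact: is_deriveD.
Qed.

Lemma smo_scale k (c : R) f : smo k f -> smo k (fun t => c * f t).
Proof.
elim: k f => [//|k ih] f [f' [h h']].
exists (fun t => c * f' t); split; last exact: ih.
by move=> t; have := h t => ?; exact: is_deriveZ.
Qed.

Lemma smo_mul k f g : smo k f -> smo k g -> smo k (fun t => f t * g t).
Proof.
elim: k f g => [//|k ih] f g hf hg; have [f' [h h']] := hf; have [g' [i i']] := hg.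
exists (fun t => f t * g' t + g t * f' t); split.
  by move=> t; have := h t; have := i t => ? ?; exact: is_deriveM.
by apply: smo_add; apply: ih => //; exact: smoS.
Qed.

Lemma smo_inv k f : (forall t, f t != 0) -> smo k f -> smo k (fun t => (f t)^-1).
Proof.
move=> f0; elim: k => [//|k ih] hf; have [f' [h h']] := hf.
exists (fun t => - ((f t)^-1 * ((f t)^-1 * f' t))); split.
  move=> t; apply: (is_derive_eq (is_deriveV (f0 t) (h t))).
  by rewrite /GRing.scale/= mulNr -exprVn expr2 mulrA.
have hi : smo k (fun t => (f t)^-1) by apply: ih; exact: smoS.
have := smo_scale (-1) (smo_mul hi (smo_mul hi h')).
by congr (smo k _); apply/funext => t; rewrite mulN1r.
Qed.

Lemma smo_flip k f : smo k f -> smo k (fun t => f (1 - t)).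
Proof.
elim: k f => [//|k ih] f [f' [h h']].
exists (fun t => -1 * f' (1 - t)); split; last by apply: smo_scale; exact: ih.
move=> t; have := h (1 - t) => H.
have H2 : is_derive t 1 (fun t : R => 1 - t) (-1).
  by apply: (is_derive_eq (is_deriveB (is_derive_cst (1 : R) t 1) (is_derive_id t 1))); rewrite sub0r.
have := @is_derive1_comp _ f (fun t => 1 - t) t _ _ H H2.
by rewrite mulrC.
Qed.

(** The functions t^-j exp(-1/t), extended by 0 to t <= 0: derivatives of exp(-1/t) are
combinations of such functions, so that flatness at 0 is proved once for all j. *)
Definition flatexp j t := if 0 < t then t^-1 ^+ j * expR (- t^-1) else 0.

Lemma pow_expN m u : 0 <= u -> u ^+ m * expR (- u) <= m%:R ^+ m.
Proof.
move=> u0; case: m => [|m].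
  by rewrite !expr0 mul1r -expR0 ler_expR lerNl oppr0.
have m0 : (0 : R) < m.+1%:R by [].
rewrite expRN ler_pdivrMr ?expR_gt0//.
pose v := u / m.+1%:R; have v0 : 0 <= v by rewrite divr_ge0.
have -> : u = m.+1%:R * v by rewrite mulrC divfK// gt_eqF.
rewrite expRM_natl exprMn ler_wpM2l ?exprn_ge0//.
rewrite lerXn2r ?nnegrE ?expR_ge0//.
by apply: le_trans (expR_ge1Dx _); rewrite lerDr.
Qed.

Lemma flatexp_le j t : 0 < t -> flatexp j t <= (j.+1)%:R ^+ j.+1 * t.
Proof.
move=> t0; rewrite /flatexp t0.
have := pow_expN j.+1 (ltW (_ : 0 < t^-1)); rewrite invr_gt0 => /(_ t0).
by rewrite exprSr mulrAC -ler_pdivrMr.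
Qed.

Lemma flatexp_ge0 j t : 0 <= flatexp j t.
Proof.
rewrite /flatexp; case: ifP => // t0.
by rewrite mulr_ge0 ?expR_ge0// exprn_ge0// invr_ge0 ltW.
Qed.

Lemma is_derive_flatexp j t :
  is_derive t 1 (flatexp j) (- j%:R * flatexp j.+1 t + flatexp j.+2 t).
Proof.
have [t0|t0|->] := ltgtP t 0.
- have E : \forall s \near t, cst 0 s = flatexp j s.
    near=> s; rewrite /flatexp ltNge ltW//.
    by near: s; exact: lt_nbhsl.
  rewrite /flatexp !ltNge !(ltW t0)/= mulr0 addr0.
  by apply: near_eq_is_derive E _ => //; exact: is_derive_cst.
- have E : \forall s \near t, s^-1 ^+ j * expR (- s^-1) = flatexp j s.
    near=> s; rewrite /flatexp (_ : 0 < s)//.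
    by near: s; exact: lt_nbhsr.
  apply: near_eq_is_derive E _ => //.
  have tn0 : t != 0 by rewrite gt_eqF.
  have hV : is_derive t 1 (fun s : R => s^-1) (- t^-1 ^+ 2).
    by apply: (is_derive_eq (@is_deriveV _ id t 1 1 tn0 _));
      rewrite /GRing.scale/= mulr1 exprVn.
  have hE : is_derive t 1 (fun s : R => expR (- s^-1)) (t^-1 ^+ 2 * expR (- t^-1)).
    have hN : is_derive t 1 (fun s : R => - s^-1) (t^-1 ^+ 2).
      by apply: (is_derive_eq (is_deriveN hV)); rewrite opprK.
    apply: (is_derive_eq (@is_derive1_comp _ expR (fun s => - s^-1) t _ _
      (is_derive_expR _) hN)).
    by rewrite mulrC.
  have hP i : is_derive t 1 (fun s : R => s^-1 ^+ i) (- i%:R * t^-1 ^+ i.+1).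
    elim: i => [|i ih].
      by rewrite oppr0 mul0r; exact: is_derive_cst.
    have H := is_deriveM hV ih.
    have -> : (fun s : R => s^-1 ^+ i.+1) = (fun s => s^-1) * (fun s => s^-1 ^+ i).
      by apply/funext => s; rewrite exprS.
    apply: (is_derive_eq H).
    by rewrite /GRing.scale/= -natr1 !exprS; ring.
  apply: (is_derive_eq (is_deriveM (hP j) hE)).
  by rewrite /flatexp t0 /GRing.scale/= !exprS; ring.
have F0 i : flatexp i 0 = 0 by rewrite /flatexp ltxx.
rewrite !F0 mulr0 addr0.
suff H : h^-1 *: (flatexp j (h *: 1 + 0) - flatexp j 0) @[h --> (0 : R)^'] --> (0 : R).
  by apply: DeriveDef; [apply/cvg_ex; exists 0|apply: cvg_lim].
apply/cvgr0Pnorm_le => e e0.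
pose C : R := (j.+2)%:R ^+ j.+2; have C0 : 0 < C by rewrite exprn_gt0.
near=> h; have h0 : h != 0 by near: h; exact: nbhs_dnbhs_neq.
rewrite F0 subr0 addr0 /GRing.scale/= mulr1.
have [hn|hp] := leP h 0.
  by rewrite /flatexp ltNge hn/= mulr0 normr0 ltW.
have -> : h^-1 * flatexp j h = flatexp j.+1 h.
  by rewrite /flatexp hp exprS mulrA.
rewrite ger0_norm ?flatexp_ge0//; apply: le_trans (flatexp_le _ hp) _.
have : `|h| <= e / C by near: h; apply: dnbhs0_le; rewrite divr_gt0.
by rewrite gtr0_norm// ler_pdivlMr// mulrC.
Unshelve. all: by end_near. Qed.

Lemma smo_flatexp k j : smo k (flatexp j).
Proof.
elim: k j => [//|k ih] j.
exists (fun t => - j%:R * flatexp j.+1 t + flatexp j.+2 t); split.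
  exact: is_derive_flatexp.
by apply: smo_add => //; exact: smo_scale.
Qed.

Definition sstep t := flatexp 0 t / (flatexp 0 t + flatexp 0 (1 - t)).

Lemma flatexp0_gt0 t : 0 < t -> 0 < flatexp 0 t.
Proof. by move=> t0; rewrite /flatexp t0 expr0 mul1r expR_gt0. Qed.

Lemma sstep_den t : flatexp 0 t + flatexp 0 (1 - t) != 0.
Proof.
rewrite gt_eqF//; have [t0|t0] := ltP 0 t.
  by rewrite ltr_pwDl ?flatexp0_gt0 ?flatexp_ge0.
by rewrite ltr_wpDl ?flatexp_ge0// flatexp0_gt0// subr_gt0 (le_lt_trans t0).
Qed.

Lemma smo_sstep k : smo k sstep.
Proof.
apply: smo_mul; first exact: smo_flatexp.
apply: smo_inv; first exact: sstep_den.
apply: smo_add; first exact: smo_flatexp.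
by apply: smo_flip; exact: smo_flatexp.
Qed.

Lemma sstep_le0 t : t <= 0 -> sstep t = 0.
Proof. by move=> t0; rewrite /sstep {1}/flatexp ltNge t0/= mul0r. Qed.

Lemma sstep_ge1 t : 1 <= t -> sstep t = 1.
Proof.
move=> t1; have := sstep_den t.
by rewrite /sstep [flatexp 0 (1 - t)]/flatexp subr_gt0 ltNge t1/= addr0 => /divff.
Qed.

(** The derivative of a real function, in the form in which dder is stated. *)
Definition der1 f t (d : R) := forall e, 0 < e -> exists2 r, 0 < r &
  forall h, `|h| < r -> `|f (h + t) - f t - h * d| <= e * `|h|.

Lemma is_derive_der1 f t d : is_derive t 1 f d -> der1 f t d.
Proof.
move=> [df dE] e e0.
have : h^-1 *: (f (h *: 1 + t) - f t) @[h --> (0 : R)^'] --> d.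
  by rewrite -dE; exact: df.
move=> /cvgrPdist_le/(_ e e0); rewrite near_withinE => /nbhs_ballP[r /= r0 hr].
exists r => // h hh; have [->|h0] := eqVneq h 0.
  by rewrite add0r subrr mul0r subr0 normr0 mulr0.
have := hr h; rewrite /= -ball_normE/= sub0r normrN => /(_ hh h0).
rewrite /GRing.scale/= mulr1 => H.
have -> : f (h + t) - f t - h * d = - h * (d - h^-1 * (f (h + t) - f t)).
  by field.
by rewrite normrM normrN mulrC ler_wpM2r.
Qed.

(** The bump is sstep (t + 1) - sstep t, with its successive derivatives; its integer
translates telescope to a partition of unity. *)
Lemma bump_exists : exists w : nat -> R -> R,
  [/\ forall k t, der1 (w k) t (w k.+1 t),
      forall k t, 1 <= `|t| -> w k t = 0,
      forall k, exists2 C, 0 <= C & forall t, `|w k t| <= C &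
      forall N t, `|t| <= N%:R ->
        \sum_(j < N.*2.+1) w 0%N (t - (j%:R - N%:R)) = 1].
Proof.
have /choice[dn Hdn] (f : R -> R) : exists f', forall k, smo k.+1 f ->
    (forall t, is_derive t 1 f (f' t)) /\ smo k f'.
  have [[f1 H1]|nH] := pselect (exists f1 : R -> R, forall t, is_derive t 1 f (f1 t)); last first.
    by exists f => k [f2 [H2 _]]; case: nH; exists f2.
  exists f1 => k [f2 [H2 s2]]; split => //.
  have -> : f1 = f2; last by [].
  by apply/funext => t; have [_ <-] := H1 t; have [_ <-] := H2 t.
pose sg k := iter k dn sstep.
have sgs k j : smo j (sg k).
  by elim: k j => [|k ih] j; [exact: smo_sstep|exact: (Hdn (sg k) j (ih j.+1)).2].
have sgd k t : is_derive t 1 (sg k) (sg k.+1 t).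
  exact: (Hdn (sg k) 0%N (sgs k 1%N)).1.
have sgc k : continuous (sg k).
  by move=> t; apply: differentiable_continuous; apply/derivable1_diffP; case: (sgd k t).
have sg0 k t : t < 0 -> sg k t = 0.
  elim: k t => [|k ih] t t0; first by apply: sstep_le0; exact: ltW.
  have H : is_derive t 1 (sg k) 0.
    apply: (near_eq_is_derive _ (is_derive_cst (0 : R) t 1)).
    by near=> s; rewrite ih//; near: s; exact: lt_nbhsl.
  by have [_ <-] := sgd k t; have [_ ->] := H.
have sg1 k t : 1 < t -> sg k t = (k == 0%N)%:R.
  elim: k t => [|k ih] t t0; first by apply: sstep_ge1; exact: ltW.
  have H : is_derive t 1 (sg k) 0.
    apply: (near_eq_is_derive _ (is_derive_cst ((k == 0%N)%:R : R) t 1)).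
    by near=> s; rewrite ih//; near: s; exact: lt_nbhsr.
  by have [_ <-] := sgd k t; have [_ ->] := H.
have lim_ext k (c x : R) (F : set_system R) : ProperFilter F -> F --> x ->
    (\forall s \near F, sg k s = c) -> sg k x = c.
  move=> FF Fx H; have h1 : sg k s @[s --> F] --> sg k x.
    exact: (cvg_comp _ _ Fx (sgc k x)).
  have h2 : sg k s @[s --> F] --> c.
    apply: cvg_trans (@cvg_cst _ c _ F _); apply: near_eq_cvg.
    by apply: filterS H => s ->.
  exact: (@cvg_unique _ (@Rhausdorff R) _ _ _ _ h1 h2).
have sg0' k t : t <= 0 -> sg k t = 0.
  rewrite le_eqVlt => /predU1P[->|]; last exact: sg0.
  apply: (lim_ext k 0 0 (0 : R)^'-); first exact: cvg_within.
  by near=> s; apply: sg0.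
have sg1' k t : 1 <= t -> sg k t = (k == 0%N)%:R.
  rewrite le_eqVlt => /predU1P[<-|]; last exact: sg1.
  apply: (lim_ext k _ 1 (1 : R)^'+); first exact: cvg_within.
  by near=> s; apply: sg1.
have sgb k : exists2 C, 0 <= C & forall t, `|sg k t| <= C.
  have [M [Mr HM]] := compact_bounded (continuous_compact
    (continuous_subspaceT (sgc k)) (@segment_compact R 0 1)).
  pose C := Num.max M 1 + 1; have MC : M < C by rewrite ltr_pwDr// le_max lexx.
  have C1 : 1 <= C by rewrite /C ler_wpDl// le_max ler01 orbT.
  exists C => [|t]; first exact: le_trans C1.
  have [t0|t0] := leP t 0; first by rewrite sg0'// normr0 (le_trans _ C1).
  have [t1|t1] := leP 1 t.
    by rewrite sg1'// (le_trans _ C1)//; case: (k == 0%N); rewrite ?normr1 ?normr0.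
  by apply: (HM _ MC); exists t => //; rewrite /= in_itv/= (ltW t0) ltW.
exists (fun k t => sg k (t + 1) - sg k t); split.
- move=> k t e e0; have e2 : 0 < e / 2 by rewrite divr_gt0.
  have [r r0 hr] := is_derive_der1 (sgd k (t + 1)) e2.
  have [r' r0' hr'] := is_derive_der1 (sgd k t) e2.
  exists (Num.min r r'); first by rewrite lt_min r0.
  move=> h; rewrite lt_min => /andP[/hr h1 /hr' h2]; rewrite -(addrA h t 1).
  have -> : sg k (h + (t + 1)) - sg k (h + t) - (sg k (t + 1) - sg k t) -
      h * (sg k.+1 (t + 1) - sg k.+1 t) =
    (sg k (h + (t + 1)) - sg k (t + 1) - h * sg k.+1 (t + 1)) -
    (sg k (h + t) - sg k t - h * sg k.+1 t) by ring.
  apply: le_trans (ler_normB _ _) _.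
  by rewrite (splitr e) mulrDl lerD.
- move=> k t; rewrite ler_normr => /orP[t1|t1].
    by rewrite !sg1' ?subrr// ler_wpDr// (le_trans _ t1).
  by rewrite !sg0' ?subrr//; lra.
- move=> k; have [C C0 HC] := sgb k; exists (C + C); first exact: addr_ge0.
  by move=> t; apply: le_trans (ler_normB _ _) _; exact: lerD.
- move=> N t tN.
  transitivity (\sum_(0 <= j < N.*2.+1) (- sg 0%N (t + N%:R + 1 - j.+1%:R) - - sg 0%N (t + N%:R + 1 - j%:R))).
    rewrite big_mkord; apply: eq_bigr => j _; rewrite opprK addrC.
    by congr (- sg 0%N _ + sg 0%N _); rewrite -?natr1; ring.
  rewrite telescope_sumr// opprK subr0.
  move: tN; rewrite ler_norml => /andP[tN1 tN2].
  rewrite sg0' ?sg1' ?oppr0 ?add0r//; first by lra.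
  by rewrite -addnn -natr1 natrD; lra.
Unshelve. all: by end_near. Qed.

End SmoothStep.

(** * Lattices of bumps in R^n *)

Section LatticeBumps.
Variables (R : realType) (n : nat) (w : nat -> R -> R).
Hypothesis w_der : forall k t, der1 (w k) t (w k.+1 t).
Hypothesis w_out : forall k t, 1 <= `|t| -> w k t = 0.
Hypothesis w_bound : forall k, exists2 C, 0 <= C & forall t, `|w k t| <= C.
Hypothesis w_sum : forall N t, `|t| <= N%:R ->
  \sum_(j < N.*2.+1) w 0%N (t - (j%:R - N%:R)) = 1.
Implicit Types (x y : 'rV[R]_n) (s : seq 'I_n) (lam : R) (c : 'I_n -> R).

(** The jet of x |-> w (lam x_i - c): derivatives in directions other than i vanish. *)
Definition coord_bump i lam (c : R) s x : R^o :=
  if all (pred1 i) s then lam ^+ size s * w (size s) (lam * x 0 i - c) else 0.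

Lemma w_cont k : continuous (w k : R -> R^o).
Proof.
move=> t; apply/cvgrPdist_le => e e0.
have [r r0 hr] := @w_der k t 1 ltr01.
have W0 : 0 < 1 + `|w k.+1 t| by rewrite ltr_pwDl.
near=> u.
have ur : `|u - t| < r by near: u; apply: cvgr_distC_lt => //; exact: cvg_id.
have ue : `|u - t| < e / (1 + `|w k.+1 t|).
  by near: u; apply: cvgr_distC_lt; [exact: cvg_id|exact: divr_gt0].
have := hr (u - t) ur; rewrite subrK mul1r => H.
rewrite distrC -(subrK ((u - t) * w k.+1 t) (w k u - w k t)).
apply: le_trans (ler_normD _ _) _; rewrite normrM.
apply: le_trans (lerD H (lexx _)) _.
by rewrite -[X in X + _]mulr1 -mulrDr -ler_pdivlMr// ltW.
Unshelve. all: by end_near. Qed.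

Lemma LJ_coord_bump i lam (c0 : R) : LJ setT (coord_bump i lam c0).
Proof.
apply: LJ_mk => [s|s j x _].
  rewrite /coord_bump; case: (all _ s); last exact: cont_in_cst.
  move=> x _; apply: (@tvs_cvgZ R R^o _ _ _ (fun=> lam ^+ size s)); first exact: cvg_cst.
  apply: cvg_within_filter.
  apply: (@cvg_comp _ _ _ (fun x : 'rV[R]_n => lam * x 0 i - c0) (w (size s)) _
    (nbhs (lam * x 0 i - c0))); last exact: w_cont.
  apply: (@tvs_cvgB R R^o _ (nbhs x)); last exact: cvg_cst.
  apply: (@tvs_cvgZ R R^o _ (nbhs x) _ (fun=> lam)); first exact: cvg_cst.
  exact: coord_continuous.
rewrite /coord_bump all_rcons size_rcons /=.
have [sa|sa] := boolP (all (pred1 i) s); last by rewrite andbF; exact: dder_cst.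
rewrite andbT exprSr -mulrA.
suff H : dder (fun x => w (size s) (lam * x 0 i - c0) : R^o) x (ei R j)
    (if j == i then lam * w (size s).+1 (lam * x 0 i - c0) else 0).
  have := dder_scale (lam ^+ size s) H; rewrite /GRing.scale/=.
  by case: (j == i); rewrite ?mulr0.
have xE h : (h *: ei R j + x) 0 i = h * (j == i)%:R + x 0 i.
  by rewrite !mxE eqxx/= eq_sym.
case: (eqVneq j i) xE => [ji|ji] xE; last first.
  move=> q qs e e0; exists 1 => // h _.
  by rewrite xE mulr0 add0r subrr scaler0 subr0 csemi0// mulr_ge0// ltW.
move=> q qs e e0.
have q1 (u : R) : q u = `|u| * q 1.
  by have := csemiZ u (1 : R^o) qs; rewrite /GRing.scale/= mulr1.
have Q0 : 0 < q 1 + 1 by rewrite ltr_wpDl// csemi_ge0.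
have L0 : 0 < `|lam| + 1 by rewrite ltr_wpDl.
have [r r0 hr] := @w_der (size s) (lam * x 0 i - c0) (e / (q 1 + 1) / (`|lam| + 1))
  (divr_gt0 (divr_gt0 e0 Q0) L0).
exists (r / (`|lam| + 1)); first exact: divr_gt0.
move=> h; rewrite ltr_pdivlMr// => hh.
rewrite xE mulr1 q1.
have lh : `|lam * h| < r.
  by apply: le_lt_trans hh; rewrite normrM mulrC ler_wpM2l// lerDl.
have := hr _ lh; have -> : lam * h + (lam * x 0 i - c0) = lam * (h + x 0 i) - c0 by ring.
set W := w _ _; set W' := w _ _; set W1 := w _ _ => H.
have -> : W - W' - h *: (lam * W1 : R^o) = W - W' - lam * h * W1.
  by rewrite /GRing.scale/=; ring.
apply: le_trans (ler_pM _ _ H (_ : q 1 <= q 1 + 1)) _ => //.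
- exact: csemi_ge0.
- by rewrite lerDl.
rewrite normrM mulrAC [_ * (q 1 + 1)]mulrAC divfK ?gt_eqF//.
rewrite mulrA ler_wpM2r// -mulrA ler_piMr ?(ltW e0)//.
by rewrite mulrC ler_pdivrMr// mul1r lerDl.
Qed.

(** The product over i of the bumps w (lam x_i - c_i), with its jet: a bump supported in
the cube of half side 1 / lam centred at c / lam. *)
Definition cube_bump lam c : seq 'I_n -> 'rV[R]_n -> R^o :=
  foldr (fun i P => prodL (coord_bump i lam (c i)) P) (fun s _ => one_jet R s) (enum 'I_n).

Lemma LJ_one U : LJ U (fun s _ => one_jet R s : R^o).
Proof.
apply: LJ_mk => [s|s i x _]; first exact: cont_in_cst.
by rewrite /one_jet size_rcons; exact: dder_cst.
Qed.

Lemma LJ_cube_bump lam c : LJ setT (cube_bump lam c).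
Proof.
rewrite /cube_bump; elim: (enum _) => [|i r ih] /=; first exact: LJ_one.
by apply: LJ_prod => //; exact: LJ_coord_bump.
Qed.

Lemma cube_bump_out lam c s x i : 1 <= `|lam * x 0 i - c i| ->
  cube_bump lam c s x = 0.
Proof.
move=> H; rewrite /cube_bump.
have : i \in enum 'I_n by rewrite mem_enum.
elim: (enum _) s => [//|j r ih] s; rewrite inE => /orP[/eqP <-|ir] /=.
  apply: prodv0l => t; rewrite /coord_bump w_out// mulr0.
  by case: (all _ t).
by apply: prodv0r => t; exact: ih.
Qed.

Lemma cube_bump0 lam c x : cube_bump lam c [::] x = \prod_i w 0%N (lam * x 0 i - c i).
Proof.
rewrite -big_enum/= /cube_bump; elim: (enum _) => [|i r ih] /=.
  by rewrite big_nil /one_jet eqxx.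
by rewrite big_cons -ih /prodL/= /coord_bump/= expr0 mul1r.
Qed.

Lemma cube_bump_bound N : exists2 C : R, 0 <= C & forall lam c s x, 0 <= lam ->
  (size s <= N)%N -> `|cube_bump lam c s x| <= C * lam ^+ size s.
Proof.
have [A A0 HA] : exists2 A : R, 0 <= A & forall k t, (k <= N)%N -> `|w k t| <= A.
  elim: N => [|N [A A0 HA]].
    by have [C C0 HC] := w_bound 0; exists C => // k t; rewrite leqn0 => /eqP ->.
  have [C C0 HC] := w_bound N.+1; exists (A + C); first exact: addr_ge0.
  move=> k t; rewrite leq_eqVlt ltnS => /orP[/eqP ->|kN].
    by apply: le_trans (HC t) _; rewrite lerDr.
  by apply: le_trans (HA k t kN) _; rewrite lerDl.
rewrite /cube_bump; elim: (enum _) => [|i r [C C0 HC]].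
  exists 1 => // lam c s x l0 _ /=; rewrite /one_jet; case: s => [|i s] /=.
    by rewrite normr1 expr0 mulr1.
  by rewrite normr0 mulr_ge0// exprn_ge0.
exists (2 ^+ N * A * C); first by rewrite !mulr_ge0// exprn_ge0.
move=> lam c s x l0 sN /=.
have := @prodv_bound R n R^o (fun u : R^o => `|u|) (fun t => coord_bump i lam (c i) t x)
  (fun t => foldr (fun i P => prodL (coord_bump i lam (c i)) P) (fun s _ => one_jet R s) r t x)
  s A C lam (csemi_norm _) A0 l0.
move=> H; apply: le_trans (H _ _) _ => [t ts|t ts|].
- rewrite /coord_bump; case: (all _ t); last by rewrite normr0 mulr_ge0// exprn_ge0.
  rewrite normrM normrX (ger0_norm l0) mulrC ler_wpM2r ?exprn_ge0//.
  by apply: HA; exact: leq_trans sN.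
- by apply: HC => //; exact: leq_trans sN.
- by rewrite ler_wpM2r ?exprn_ge0// ler_wpM2r// ler_wpM2r// ler_weXn2l// ler1n.
Qed.

(** The integral point coded by z: the integers from - N to N are coded by the ordinals
below 2 N + 1. *)
Definition grid N (z : {ffun 'I_n -> 'I_N.*2.+1}) (i : 'I_n) : R := (z i)%:R - N%:R.

(** The sum over the sites is a product of one-dimensional sums, each equal to 1. *)
Lemma cube_bump_sum N lam x : lam * `|x| <= N%:R -> 0 <= lam ->
  \sum_(z : {ffun 'I_n -> 'I_N.*2.+1}) cube_bump lam (grid z) [::] x = 1.
Proof.
move=> xN l0; under eq_bigr do rewrite cube_bump0.
rewrite -(bigA_distr_bigA (fun i j => w 0%N (lam * x 0 i - ((j : 'I_N.*2.+1)%:R - N%:R))))/=.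
apply: big1 => i _; apply: w_sum.
rewrite normrM (ger0_norm l0); apply: le_trans xN.
by rewrite ler_wpM2l// rv_coord_le.
Qed.

Lemma card_close_int N (t : R) :
  (#|[pred j : 'I_N.*2.+1 | (`|t - (j%:R - N%:R)| < 1)%R]| <= 2)%N.
Proof.
set P := [pred j | _].
have [k kP|P0] := pickP P; last by rewrite (eq_card0 P0).
have [k0 k0P kmin] := arg_minnP (fun j : 'I_N.*2.+1 => j : nat) kP.
pose k1 : 'I_N.*2.+1 := insubd k0 k0.+1.
apply: (@leq_trans #|[set k0; k1]%SET|); last by rewrite cards2; case: (_ != _).
apply: subset_leq_card; apply/fintype.subsetP => j jP; rewrite !inE.
have jk : (j <= k0.+1)%N.
  move: jP k0P; rewrite !inE => jP k0P.
  have : (j%:R : R) < (k0.+2)%:R.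
    move: jP k0P; rewrite !ltr_norml => /andP[j1 j2] /andP[h1 h2].
    by rewrite -natr1 -natr1; lra.
  by rewrite ltr_nat ltnS.
have := kmin j jP; rewrite leq_eqVlt => /orP[/eqP kj|kj].
  by rewrite -val_eqE/= kj eqxx.
have jk' : j = k0.+1 :> nat by apply/eqP; rewrite eqn_leq jk kj.
by apply/orP; right; rewrite -val_eqE/= /k1 insubdK -?jk'//; exact: (ltn_ord j).
Qed.

(** Two integers at most are at distance less than 1 from a given real, so at most 2 ^ n
lattice bumps do not vanish at a given point, whatever the scale. *)
Lemma card_grid N lam x :
  (#|[pred z : {ffun 'I_n -> 'I_N.*2.+1} | [forall i, (`|lam * x 0 i - grid z i| < 1)%R]]|
    <= 2 ^ n)%N.
Proof.
pose F i := [pred j : 'I_N.*2.+1 | `|lam * x 0 i - (j%:R - N%:R)| < 1].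
have -> : #|[pred z : {ffun 'I_n -> 'I_N.*2.+1} | [forall i, (`|lam * x 0 i - grid z i| < 1)%R]]| = #|family F|.
  by apply: eq_card => z; rewrite !inE; apply: eq_forallb => i.
rewrite card_family foldrE big_map big_enum/=.
apply: (@leq_trans (\prod_(i < n) 2)); last by rewrite prod_nat_const card_ord.
by apply: leq_prod => i _; exact: card_close_int.
Qed.

End LatticeBumps.

(** * Whitney extension from a compact subset of R^n *)

Section WhitneyExtension.
Variables (R : realType) (n : nat) (E : tvsType R).
Variable Q : nat -> E -> R.
Hypothesis Qs : forall k, continuous_seminorm (Q k).
Hypothesis Qle : forall k l x, (k <= l)%N -> Q k x <= Q l x.
Hypothesis Qdom : forall q, continuous_seminorm q -> exists k, forall x, q x <= Q k x.
Variable w : nat -> R -> R.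
Hypothesis w_der : forall k t, der1 (w k) t (w k.+1 t).
Hypothesis w_out : forall k t, 1 <= `|t| -> w k t = 0.
Hypothesis w_bound : forall k, exists2 C, 0 <= C & forall t, `|w k t| <= C.
Hypothesis w_sum : forall N t, `|t| <= N%:R ->
  \sum_(j < N.*2.+1) w 0%N (t - (j%:R - N%:R)) = 1.
Variables (K : set 'rV[R]_n) (f : jet R n E).
Hypothesis Kc : compact K.
Hypothesis W : forall l b q e, (mdeg b <= l)%N -> continuous_seminorm q -> 0 < e ->
  exists2 d : R, 0 < d & forall x y, K x -> K y -> 0 < `|x - y| < d ->
    q (remainder f l b y x) <= e * `|x - y| ^+ (l - mdeg b).

Implicit Types (x y a : 'rV[R]_n) (b c : multinom n) (q : E -> R) (s : seq 'I_n).

Lemma TJ_top l (J : jet R n E) y b x : mdeg b = l -> TJ l J y b x = J b y.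
Proof.
move=> bl; rewrite /TJ bl leqnn subnn (bigD1 bm0)//= big1 => [|c0 c0n].
  rewrite mono0 scale1r addr0; congr (J _ y); apply/mnmP => i.
  by rewrite mnmDE mnm0E addn0.
have := bmdeg c0; rewrite ltnS leqn0 mdeg_eq0 => /eqP c00.
by case/negP: c0n; apply/eqP/val_inj.
Qed.

Lemma jet_unif b q e : continuous_seminorm q -> 0 < e -> exists2 d : R, 0 < d &
  forall x y, K x -> K y -> `|x - y| < d -> q (f b x - f b y) <= e.
Proof.
move=> qs e0; have [d d0 hd] := W (leqnn (mdeg b)) qs e0.
exists d => // x y Kx Ky xyd; have [->|xy] := eqVneq x y.
  by rewrite subrr csemi0// ltW.
have := hd x y Kx Ky; rewrite normr_gt0 subr_eq0 xy xyd => /(_ isT).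
by rewrite remainderE// TJ_top// subnn expr0 mulr1.
Qed.

Lemma jet_cont b : cont_in K (f b).
Proof.
apply/cont_inP => x q e Kx qs e0.
have [d d0 hd] := jet_unif b qs (divr_gt0 e0 (ltr0Sn R 1)).
apply/nbhs_ballP; exists d => //= y; rewrite -ball_normE/= distrC => yx Ky.
apply: le_lt_trans (hd y x Ky Kx yx) _.
by rewrite ltr_pdivrMr// ltr_pMr// ltr1n.
Qed.

Lemma jet_bound q k : continuous_seminorm q -> exists2 B : R, 0 <= B &
  forall c a, (mdeg c <= k)%N -> K a -> q (f c a) <= B.
Proof.
move=> qs; have /choice[M HM] (c : bmultinom n k.+1) : exists M : R, 0 <= M /\
    forall a, K a -> q (f c a) <= M.
  by have [M M0 H] := cont_in_bound (@jet_cont c) Kc (@subset_refl _ K) qs; exists M.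
exists (\sum_c M c); first by apply: sumr_ge0 => c _; exact: (HM c).1.
move=> c a ck Ka; have ck' : (mdeg c < k.+1)%N by [].
rewrite (bigD1 (BMultinom ck'))//=; apply: le_trans ((HM (BMultinom ck')).2 a Ka) _.
by rewrite lerDl; apply: sumr_ge0 => c' _; exact: (HM c').1.
Qed.

Lemma jet_B_exists : exists B : nat -> R, forall k, 0 <= B k /\
  forall c a, (mdeg c <= k)%N -> K a -> Q k (f c a) <= B k.
Proof.
have /choice[B HB] k : exists B : R, 0 <= B /\
    forall c a, (mdeg c <= k)%N -> K a -> Q k (f c a) <= B.
  by have [B B0 H] := jet_bound k (Qs k); exists B.
by exists B.
Qed.

Definition lam (m : nat) : R := 2 ^+ m.

Lemma lam_gt0 m : 0 < lam m. Proof. exact: exprn_gt0. Qed.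
Lemma lam_ge1 m : 1 <= lam m. Proof. by rewrite exprn_ege1// ler1n. Qed.
Lemma lamS m : lam m.+1 = 2 * lam m. Proof. by rewrite /lam exprS. Qed.
Lemma lam_le m m' : (m <= m')%N -> lam m <= lam m'.
Proof. by move=> mm; rewrite /lam ler_weXn2l// ler1n. Qed.

Lemma lam_large (M : R) : exists m0, forall m, (m0 <= m)%N -> M < lam m.
Proof.
exists (Num.bound `|M|) => m mm; apply: lt_le_trans (lam_le mm).
apply: (@lt_trans _ _ (Num.bound `|M|)%:R).
  by apply: le_lt_trans (ler_norm M) _; exact: archi_boundP.
by rewrite /lam -natrX ltr_nat ltn_expl.
Qed.

(** The Taylor order kk m used at scale m tends to infinity so slowly that all the
terms of order above k0 of the Taylor polynomials involved, whose coefficients grow with the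
order without any control, are absorbed by one factor 2 ^ - m. A countable family of
seminorms is essential here: the seminorm also varies with m. *)
Lemma order_exists : exists kk : nat -> nat, forall k0, exists m0, forall m, (m0 <= m)%N ->
  (k0 <= kk m)%N /\ exists2 B : R, (forall c a, (mdeg c <= kk m)%N -> K a -> Q (kk m) (f c a) <= B) &
     0 <= B /\ 6 ^+ kk m * B * #|{: bmultinom n (kk m).+1}|%:R <= lam m.
Proof.
have [B HB] := jet_B_exists.
pose M k := 6 ^+ k * B k * #|{: bmultinom n k.+1}|%:R.
exists (fun m => \max_(k < m.+1 | (M k <= lam m)%R) k)%N => k0.
have [m0 Hm0] := lam_large (M k0).
exists (maxn m0 k0) => m; rewrite geq_max => /andP[mm0 mk0].
have k0m : (k0 < m.+1)%N by [].
have c0 : M (Ordinal k0m) <= lam m by rewrite ltW//; exact: Hm0.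
split; first exact: (@leq_bigmax_cond _ (fun k : 'I_m.+1 => M k <= lam m) _ (Ordinal k0m)).
have [|k kM ->] := @eq_bigmax_cond _ [pred k : 'I_m.+1 | M k <= lam m] (fun k => k : nat).
  by apply/card_gt0P; exists (Ordinal k0m).
by exists (B k); [exact: (HB k).2|split; [exact: (HB k).1|exact: kM]].
Qed.

Variable kk : nat -> nat.
Hypothesis Hkk : forall k0, exists m0, forall m, (m0 <= m)%N ->
  (k0 <= kk m)%N /\ exists2 B : R, (forall c a, (mdeg c <= kk m)%N -> K a -> Q (kk m) (f c a) <= B) &
     0 <= B /\ 6 ^+ kk m * B * #|{: bmultinom n (kk m).+1}|%:R <= lam m.

Let rho m : R := (lam m)^-1.
Let rho_gt0 m : 0 < rho m. Proof. by rewrite invr_gt0 lam_gt0. Qed.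
Let rho_le1 m : rho m <= 1. Proof. by rewrite invf_le1 ?lam_ge1 ?lam_gt0. Qed.

(** The difference consists of the terms of degree above k1 - |b|. *)
Lemma taylor_order_diff (k1 k2 : nat) q (M B r : R) a x b : continuous_seminorm q ->
  (k1 <= k2)%N -> (mdeg b <= k1)%N -> 0 <= M -> 0 <= B -> `|x - a| <= r ->
  (forall i, (k1 - mdeg b < i <= k2 - mdeg b)%N -> r ^+ i <= M) ->
  (forall c, (mdeg c <= k2)%N -> q (f c a) <= B) ->
  q (TJ k2 f a b x - TJ k1 f a b x) <= M * B * #|{: bmultinom n k2.+1}|%:R.
Proof.
move=> qs k12 bk1 M0 B0 xa rM fB; have bk2 := leq_trans bk1 k12.
have r0 : 0 <= r by apply: le_trans xa.
rewrite /TJ bk1 bk2.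
have le : ((k1 - mdeg b).+1 <= (k2 - mdeg b).+1)%N by rewrite ltnS leq_sub2r.
rewrite -(sum_bm (fun c => mono c (x - a) *: f (mnm_add b c) a) le).
rewrite (bigID (fun c : bmultinom n (k2 - mdeg b).+1 => (mdeg c < (k1 - mdeg b).+1)%N))/=.
rewrite addrAC subrr add0r; apply: le_trans (csemi_sum _ _ _ qs) _.
apply: (@le_trans _ _ (\sum_(c : bmultinom n (k2 - mdeg b).+1) M * B)).
  rewrite big_mkcond/=; apply: ler_sum => c _; case: ifP => cj; last exact: mulr_ge0.
  have cj' : (k1 - mdeg b < mdeg c)%N by rewrite ltnNge -ltnS cj.
  have cm : (mdeg c <= k2 - mdeg b)%N by rewrite -ltnS; exact: bmdeg.
  rewrite csemiZ//; apply: ler_pM => //; first exact: csemi_ge0.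
    apply: le_trans (mono_norm _ _) _; apply: le_trans (rM (mdeg c) _); last exact/andP.
    by rewrite lerXn2r ?nnegrE.
  by apply: fB; rewrite mdegD -leq_subRL.
rewrite sumr_const -[leLHS]mulr_natr ler_wpM2l ?mulr_ge0//.
rewrite ler_nat -!sum1_card -(sum_bm (fun=> 1%N) (_ : ((k2 - mdeg b).+1 <= k2.+1)%N)).
  by rewrite [leqRHS](bigID (fun c : bmultinom n k2.+1 => (mdeg c < (k2 - mdeg b).+1)%N))/= leq_addr.
by rewrite ltnS leq_subr.
Qed.

Lemma taylor_order_change (k0 p : nat) q : continuous_seminorm q ->
  (forall z, q z <= Q p z) -> (p <= k0)%N ->
  exists m0, forall m, (m0 <= m)%N -> forall a x b, K a -> `|x - a| <= 6 * rho m ->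
    (mdeg b <= k0)%N ->
    q (TJ (kk m) f a b x - TJ k0 f a b x) <= rho m ^+ (k0 - mdeg b).
Proof.
move=> qs qQ pk; have [m0 Hm0] := Hkk k0; exists m0 => m mm a x b Ka xa bk0.
have [kkm [B HB [B0 BM]]] := Hm0 m mm.
set j := (k0 - mdeg b)%N.
apply: (@le_trans _ _ (6 ^+ kk m * rho m ^+ j.+1 * B * #|{: bmultinom n (kk m).+1}|%:R)).
  apply: (@taylor_order_diff k0 (kk m) q _ B _ a x b qs kkm bk0 _ B0 xa).
  - by rewrite mulr_ge0// exprn_ge0// ltW.
  - move=> i /andP[ji im]; rewrite exprMn; apply: ler_pM; rewrite ?exprn_ge0 ?(ltW (rho_gt0 m))//.
      by rewrite ler_weXn2l ?ler1n// (leq_trans im)// leq_subr.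
    by rewrite ler_wiXn2l// ltW.
  - move=> c ck; apply: le_trans (qQ _) _; apply: le_trans (Qle _ (leq_trans pk kkm)) _.
    exact: HB.
have -> : 6 ^+ kk m * rho m ^+ j.+1 * B * #|{: bmultinom n (kk m).+1}|%:R =
  rho m ^+ j * (rho m * (6 ^+ kk m * B * #|{: bmultinom n (kk m).+1}|%:R)).
  by rewrite exprS; ring.
rewrite ler_piMr ?exprn_ge0 ?(ltW (rho_gt0 m))//.
by rewrite mulrC ler_pdivrMr ?lam_gt0// mul1r.
Qed.

(** Two Taylor polynomials of the same order at nearby points of K differ by a
polynomial whose derivatives at one of the two points are the remainders that
the Whitney condition bounds. *)
Lemma taylor_center_change (k0 : nat) q (e : R) : continuous_seminorm q -> 0 < e ->
  exists2 d : R, 0 < d & forall a a' x b r, K a -> K a' -> r < d ->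
    `|x - a| <= r -> `|x - a'| <= r -> (mdeg b <= k0)%N ->
    q (TJ k0 f a b x - TJ k0 f a' b x) <= e * r ^+ (k0 - mdeg b).
Proof.
move=> qs e0; pose N := (n.+1%:R * 2 : R) ^+ k0.
have N0 : 0 < N by rewrite exprn_gt0// mulr_gt0.
have e1 : 0 < e / N by rewrite divr_gt0.
have [d d0 hd] : exists2 d : R, 0 < d & forall b : bmultinom n k0.+1,
    forall x y, K x -> K y -> 0 < `|x - y| < d ->
    q (remainder f k0 b y x) <= e / N * `|x - y| ^+ (k0 - mdeg b).
  have : \forall d \near (0 : R)^'+, forall b : bmultinom n k0.+1,
      forall x y, K x -> K y -> 0 < `|x - y| < d ->
      q (remainder f k0 b y x) <= e / N * `|x - y| ^+ (k0 - mdeg b).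
    apply: near_fin => b; have bk : (mdeg b <= k0)%N by rewrite -ltnS; exact: bmdeg.
    have [d d0 hd] := W bk qs e1; near=> d' => x y Kx Ky /andP[xy0 xyd].
    apply: hd => //; rewrite xy0/=; apply: lt_le_trans xyd _.
    by near: d'; exact: nbhs_right_le.
  by move=> H; near (0 : R)^'+ => d; exists d => //; near: d.
exists (d / 2); first exact: divr_gt0.
move=> a a' x b r Ka Ka' rd xa xa' bk0.
have r0 : 0 <= r by apply: le_trans xa.
have r2 : 2 * r < d by rewrite mulrC -ltr_pdivlMr.
have aa' : `|a - a'| <= 2 * r.
  rewrite -(subrKA x); apply: le_trans (ler_normD _ _) _; rewrite distrC; lra.
pose G : jet R n E := fun b x => TJ k0 f a b x + (-1) *: TJ k0 f a' b x.
have hG : MJ setT G.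
  by move=> k; apply: LJk_add; [exact: MJ_taylor|apply: LJk_scale; exact: MJ_taylor].
have GE c z : G c z = TJ k0 f a c z - TJ k0 f a' c z by rewrite /G scaleN1r.
have Ga c : (mdeg c <= k0)%N -> q (G c a) <= e / N * (2 * r) ^+ (k0 - mdeg c).
  move=> ck; rewrite GE TJ_center// -remainderE//.
  have [->|na] := eqVneq a a'.
    by rewrite remainderE// TJ_center// subrr csemi0// mulr_ge0 ?(ltW e1)// exprn_ge0// mulr_ge0.
  have ck' : (mdeg c < k0.+1)%N by [].
  have := hd (BMultinom ck') a a' Ka Ka'.
  rewrite normr_gt0 subr_eq0 na (le_lt_trans aa' r2) => /(_ isT) /le_trans; apply.
  by rewrite ler_wpM2l ?(ltW e1)// lerXn2r ?nnegrE// mulr_ge0// ltW.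
pose D := [set z | `|z - a| <= r].
have Da : D a by rewrite /D/= subrr normr0.
have Dcv : convex_set D.
  apply/convex_setP => z v t; rewrite /D/= => za va /andP[t0 t1].
  have -> : t *: z + (1 - t) *: v - a = t *: (z - a) + (1 - t) *: (v - a).
    by apply/rowP => i; rewrite !mxE; ring.
  apply: le_trans (ler_normD _ _) _; rewrite !normrZ !ger0_norm ?subr_ge0//.
  have -> : r = t * r + (1 - t) * r by ring.
  by rewrite lerD// ler_wpM2l// subr_ge0.
have st : star_center setT D a by split.
rewrite -GE; apply: le_trans (_ : e / N * (n.+1%:R * (2 * r)) ^+ (k0 - mdeg b) <= _).
  apply: (@descend R n E setT D a G k0 q (e / N) (2 * r) a (@openT _)) => //.
  - by move=> s z _; have := @LJ_C1 _ _ _ _ _ s hG; rewrite interiorT => h; exact: h.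
  - by move=> c; have := LJ_cont (mnm_seq c) hG; rewrite mnms_seq; exact: cont_in_sub.
  - exact: ltW.
  - exact: mulr_ge0.
  - by move=> z za; apply: le_trans za _; lra.
  - by move=> c ck; exact/Ga/ltnW.
  - move=> c z ck _; have := Ga c; rewrite ck subnn expr0 mulr1 => /(_ (leqnn _)).
    by rewrite !GE !(TJ_top _ _ _ ck).
rewrite mulrA exprMn mulrA ler_wpM2r ?exprn_ge0// mulrAC ler_pdivrMr// ler_wpM2l ?(ltW e0)//.
rewrite /N ler_weXn2l ?leq_subr//.
by rewrite -natrM ler1n.
Unshelve. all: by end_near. Qed.

(** At distance O(2^-m) from a and a', the Taylor polynomials used at scale m differ from
the one of fixed order k0 by no more than a remainder of order k0 would. *)
Lemma taylor_compare (k0 p : nat) q : continuous_seminorm q ->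
  (forall z, q z <= Q p z) -> (p <= k0)%N ->
  exists2 C : R, 0 <= C & exists m0, forall m, (m0 <= m)%N -> forall a a' x b, K a -> K a' ->
    `|x - a| <= 6 * rho m -> `|x - a'| <= 6 * rho m -> (mdeg b <= k0)%N ->
    q (TJ (kk m) f a b x - TJ k0 f a' b x) <= C * rho m ^+ (k0 - mdeg b).
Proof.
move=> qs qQ pk; have [m1 H1] := taylor_order_change qs qQ pk.
have [d d0 H2] := taylor_center_change k0 qs ltr01.
have [m2 Hm2] := lam_large (6 / d).
exists (1 + 6 ^+ k0); first by rewrite addr_ge0// exprn_ge0.
exists (maxn m1 m2) => m; rewrite geq_max => /andP[mm1 mm2] a a' x b Ka Ka' xa xa' bk.
apply: le_trans (csemi_tri _ (TJ k0 f a b x) _ qs) _; rewrite mulrDl mul1r.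
apply: lerD; first exact: H1.
have rd : 6 * rho m < d.
  by have := Hm2 m mm2; rewrite ltr_pdivrMr// mulrC => ?; rewrite ltr_pdivrMr ?lam_gt0// mulrC.
apply: le_trans (H2 a a' x b _ Ka Ka' rd xa xa' bk) _.
rewrite mul1r exprMn ler_wpM2r ?exprn_ge0 ?(ltW (rho_gt0 m))//.
by rewrite ler_weXn2l ?leq_subr ?ler1n.
Qed.

Variable Lb : nat.
Hypothesis HLb : forall a, K a -> `|a| + 3 <= Lb%:R.

(** Lattice points with coordinates up to this number, scaled by 2^-m, fill a cube that
contains all points at distance at most 3 from K. *)
Definition lattice_size m := (2 ^ m * Lb)%N.
Notation idx m := {ffun 'I_n -> 'I_(lattice_size m).*2.+1}.
Definition near_site m (z : idx m) x := [forall i, `|lam m * x 0 i - grid R z i| < 1].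
(** The points of K at which the Taylor polynomial attached to the site z may be taken.
The bound is 4 = 3 + 1: if x is within 3/2^m of a in K and the bump of z does not vanish
at x, then a is a possible centre for z. *)
Definition centres m (z : idx m) : set 'rV[R]_n :=
  [set a | K a /\ forall i, `|lam m * a 0 i - grid R z i| <= 4].
Definition active m (z : idx m) := `[< centres z !=set0 >].
Definition centre m (z : idx m) : 'rV[R]_n := xget 0 (centres z).
Definition Psi m (z : idx m) := cube_bump w (lam m) (grid R z).
Definition chi m s x : R^o := \sum_(z : idx m | active z) Psi z s x.
Definition local_taylor m s x : E := \sum_(z : idx m | active z)
  prodL (Psi z) (fun t => TJ (kk m) f (centre z) (mnms t)) s x.
(** The approximation at scale m is replaced by the one at scale m + 1 where chi (m + 1)
is 1, that is, near K. *)
Fixpoint glue m : seq 'I_n -> 'rV[R]_n -> E := if m is m'.+1 then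
  fun s x => prodL (fun t y => one_jet R t - chi m t y : R^o) (glue m') s x + local_taylor m s x
  else local_taylor 0.

Lemma Psi_out m (z : idx m) s x : ~~ near_site z x -> Psi z s x = 0.
Proof. by case/forallPn => i; rewrite -leNgt; exact: cube_bump_out. Qed.

Lemma centreP m (z : idx m) : active z -> centres z (centre z).
Proof. by move=> /asboolP[a za]; exact: (xgetPex 0 (ex_intro _ a za)). Qed.

Lemma centre_near m (z : idx m) x : active z -> near_site z x ->
  lam m * `|x - centre z| <= 5.
Proof.
move=> /centreP[_ ca] /forallP zx.
rewrite -(gtr0_norm (lam_gt0 m)) -normrZ; apply: rv_norm_le => // i; rewrite !mxE mulrBr.
have -> : lam m * x 0 i - lam m * centre z 0 i =
  (lam m * x 0 i - grid R z i) - (lam m * centre z 0 i - grid R z i) by ring.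
apply: le_trans (ler_normB _ _) _; have := ca i; have := zx i; lra.
Qed.

(** The bound is 5 = 4 + 1: at such a point every active bump of scale m vanishes. *)
Definition far m x := forall a, K a -> 5 < lam m * `|x - a|.

Lemma Psi_far m (z : idx m) s x : far m x -> active z -> Psi z s x = 0.
Proof.
move=> fx az; apply: Psi_out; apply/negP => /(centre_near az).
by rewrite leNgt fx//; exact: (centreP az).1.
Qed.

Lemma far_le m m' x : (m <= m')%N -> far m x -> far m' x.
Proof.
move=> mm fx a Ka; apply: lt_le_trans (fx a Ka) _.
by rewrite ler_wpM2r// lam_le.
Qed.

Lemma LJ_chi m : LJ setT (chi m).
Proof. by move=> k; apply: LJk_sum => z _; exact: LJ_cube_bump. Qed.

Lemma LJ_local_taylor m : LJ setT (local_taylor m).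
Proof.
move=> k; apply: LJk_sum => z _; apply: LJk_prod; first exact: LJ_cube_bump.
exact: MJ_taylor.
Qed.

Lemma LJ_sub_one m : LJ setT (fun t y => one_jet R t - chi m t y : R^o).
Proof.
apply: (@LJ_eq _ _ R^o _ (fun t y => one_jet R t + (-1) *: chi m t y : R^o)).
  by move=> s x _; rewrite scaleN1r.
by move=> k; apply: LJk_add; [exact: LJ_one|apply: LJk_scale; exact: LJ_chi].
Qed.

Lemma LJ_glue m : LJ setT (glue m).
Proof.
elim: m => [|m IH] k; first exact: LJ_local_taylor.
apply: LJk_add; last exact: LJ_local_taylor.
by apply: LJk_prod; [exact: LJ_sub_one|exact: IH].
Qed.

(** Away from K the construction becomes stationary. *)
Lemma glue_far m s x : far m.+1 x -> glue m.+1 s x = glue m s x.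
Proof.
move=> fx; rewrite /= /local_taylor big1 ?addr0 => [|z az].
  rewrite /prodL prodv1l// => t; rewrite /chi big1 ?subr0// => z az; exact: Psi_far.
by rewrite /prodL prodv0l// => t; exact: Psi_far.
Qed.

Lemma glue_stable m m' s x : (m <= m')%N -> far m.+1 x -> glue m' s x = glue m s x.
Proof.
move=> mm fx; rewrite -(subnKC mm); elim: (m' - m)%N => [|j IH]; first by rewrite addn0.
by rewrite addnS glue_far//; apply: far_le fx; rewrite ltnS leq_addr.
Qed.

(** Within distance 3/2^m of K every lattice site whose bump does not vanish is
active, so that the sum of the active bumps is locally the constant 1. *)
Lemma chi_close m s x a : K a -> lam m * `|x - a| < 3 -> chi m s x = one_jet R s.
Proof.
move=> Ka xa; pose O := [set y | lam m * `|y - a| < 3].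
have Oo : open O.
  have -> : O = ball a (3 / lam m).
    apply/seteqP; split => y; rewrite /O -ball_normE/= distrC ltr_pdivlMr ?lam_gt0// mulrC//.
  exact: ball_open.
apply: (@LJ_unique_int _ _ R^o (@norm_hausdorff _ _) O (chi m) (fun t _ => one_jet R t)).
- exact: (LJ_sub (@subsetT _ _) (@LJ_chi m)).
- exact: LJ_one.
- move=> y /interior_subset Oy; rewrite /one_jet/=.
  rewrite -(cube_bump_sum w_sum (N := lattice_size m) (lam := lam m) (x := y)) ?(ltW (lam_gt0 m))//.
    rewrite /chi [in RHS](bigID (@active m))/= [X in _ = _ + X]big1 ?addr0// => z /negP nz.
    apply: Psi_out; apply/negP => /forallP zy; apply: nz; apply/asboolP; exists a; split => // i.
    have := rv_coord_le (y - a) i; rewrite !mxE => ya.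
    have := zy i; have lya : `|lam m * (y 0 i - a 0 i)| < 3.
      rewrite normrM gtr0_norm ?lam_gt0//; apply: le_lt_trans Oy.
      by rewrite ler_pM2l ?lam_gt0.
    move: lya; rewrite mulrBr !ltr_norml ler_norml => /andP[h1 h2] /andP[h3 h4].
    by apply/andP; split; lra.
  rewrite natrM natrX ler_pM2l ?lam_gt0//; apply: le_trans (HLb Ka).
  rewrite -[y](subrK a) addrC; apply: le_trans (ler_normD _ _) _; rewrite lerD2l.
  apply: ltW; apply: le_lt_trans Oy; rewrite ler_peMl//; exact: lam_ge1.
- by rewrite ((interior_id O).1 Oo).
Qed.

Lemma glue_close m s x a : K a -> lam m * `|x - a| < 3 -> glue m s x = local_taylor m s x.
Proof.
case: m => [//|m] Ka xa /=.
by rewrite /prodL prodv0l ?add0r// => t; rewrite (chi_close t Ka xa) subrr.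
Qed.

Lemma lattice_sum_le m x (G : idx m -> R) (B : R) : 0 <= B ->
  (forall z, active z -> near_site z x -> G z <= B) ->
  (forall z, ~~ near_site z x -> G z = 0) ->
  \sum_(z | active z) G z <= (2 ^ n)%:R * B.
Proof.
move=> B0 GB G0.
apply: (@le_trans _ _ (\sum_(z : idx m | near_site z x) B)).
  rewrite big_mkcond [leRHS]big_mkcond; apply: ler_sum => z _.
  case: (boolP (near_site z x)) => zx; case: ifP => az //; first exact: GB.
  by rewrite G0.
rewrite sumr_const -[leLHS]mulr_natl ler_wpM2r// ler_nat.
exact: card_grid.
Qed.

Lemma chi_bound S : exists2 C : R, 0 <= C & forall m s x, (size s <= S)%N ->
  `|chi m s x| <= C * lam m ^+ size s.
Proof.
have [C C0 HC] := cube_bump_bound n w_bound S.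
exists ((2 ^ n)%:R * C); first exact: mulr_ge0.
move=> m s x sS; apply: le_trans (ler_norm_sum _ _ _) _; rewrite -mulrA.
apply: (@lattice_sum_le m x (fun z => `|Psi z s x|)).
- by rewrite mulr_ge0// exprn_ge0// ltW// lam_gt0.
- by move=> z _ _; apply: HC => //; exact/ltW/lam_gt0.
- by move=> z zx; rewrite Psi_out// normr0.
Qed.

Let rho_lam m k j : (j <= k)%N -> rho m ^+ (k - j) = rho m ^+ k * lam m ^+ j.
Proof.
move=> jk; rewrite -[in RHS](subnK jk) exprD -mulrA -exprMn /rho.
by rewrite mulVf ?gt_eqF ?lam_gt0// expr1n mulr1.
Qed.

(** Each of the at most 2^n active bumps at x contributes its derivatives, which cost
2^(m |s|), times a difference of Taylor polynomials. *)
Lemma local_taylor_estimate (k0 p : nat) q S : continuous_seminorm q ->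
  (forall z, q z <= Q p z) -> (p <= k0)%N -> (S <= k0)%N ->
  exists2 C : R, 0 <= C & exists m0, forall m, (m0 <= m)%N -> forall a x s, K a ->
    `|x - a| <= 6 * rho m -> (size s <= S)%N ->
    q (local_taylor m s x - prodv (chi m ^~ x) (fun t => TJ k0 f a (mnms t) x) s)
      <= C * rho m ^+ k0 * lam m ^+ size s.
Proof.
move=> qs qQ pk Sk; have [C1 C10 [m0 Hm0]] := taylor_compare qs qQ pk.
have [Cb Cb0 HCb] := cube_bump_bound n w_bound S.
exists ((2 ^ n)%:R * (2 ^+ S * Cb * C1)); first by rewrite !mulr_ge0// exprn_ge0.
exists m0 => m mm a x s Ka xa sS.
rewrite /chi prodv_suml /local_taylor -sumrB.
apply: le_trans (csemi_sum _ _ _ qs) _.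
have r0 := ltW (rho_gt0 m); have l0 := ltW (lam_gt0 m).
rewrite -!mulrA; apply: (@lattice_sum_le m x).
- by rewrite !mulr_ge0// ?exprn_ge0.
- move=> z az zx; rewrite -prodvBr.
  apply: le_trans (@prodv_bound _ _ _ _ _ _ _ Cb (C1 * rho m ^+ k0) (lam m) qs Cb0 l0 _ _) _.
  + by move=> t ts; apply: HCb => //; exact: leq_trans sS.
  + move=> t ts; rewrite -mulrA -rho_lam; last by rewrite (leq_trans ts)// (leq_trans sS).
    rewrite -(mdeg_mnms t); apply: Hm0 => //.
    * exact: (centreP az).1.
    * have := centre_near az zx; rewrite -ler_pdivlMl ?lam_gt0// mulrC => /le_trans; apply.
      by rewrite ler_wpM2r// ler_nat.
    * by rewrite mdeg_mnms (leq_trans ts)// (leq_trans sS).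
  + rewrite -!mulrA ler_wpM2r//; first by rewrite !mulr_ge0// ?exprn_ge0.
    by rewrite ler_weXn2l// ler1n.
- by move=> z zx; rewrite /prodL !prodv0l ?subrr ?csemi0// => t; exact: Psi_out.
Qed.

(** Where chi m = 1, the m-th function is the local Taylor approximation of scale m, and
the next one interpolates between those of the scales m and m + 1; both are close to the
Taylor polynomial at a, which the interpolation preserves. *)
Lemma glue_estimate (k0 p : nat) q S : continuous_seminorm q ->
  (forall z, q z <= Q p z) -> (p <= k0)%N -> (S <= k0)%N ->
  exists2 C : R, 0 <= C & exists m0, forall m, (m0 <= m)%N -> forall a x s, K a ->
    lam m * `|x - a| < 3 -> (size s <= S)%N ->
    q (glue m.+1 s x - TJ k0 f a (mnms s) x) <= C * rho m ^+ (k0 - size s).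
Proof.
move=> qs qQ pk Sk; have [C1 C10 [m0 Hm0]] := local_taylor_estimate qs qQ pk Sk.
have [C2 C20 HC2] := chi_bound S.
exists (2 ^+ S * ((1 + C2) * 2 ^+ S) * C1 + C1 * 2 ^+ S).
  by rewrite addr_ge0// !mulr_ge0// ?exprn_ge0// addr_ge0.
exists m0 => m mm a x s Ka xa sS; pose T t := TJ k0 f a (mnms t) x.
have r0 := ltW (rho_gt0 m); have l0 := ltW (lam_gt0 m).
have l1 t : (size t <= S)%N -> lam m.+1 ^+ size t <= 2 ^+ S * lam m ^+ size t.
  move=> tS; rewrite lamS exprMn ler_wpM2r ?exprn_ge0// ler_weXn2l// ler1n//.
have xa3 : `|x - a| <= 3 * rho m by rewrite ler_pdivlMr ?lam_gt0// mulrC ltW.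
have G t : (size t <= S)%N -> q (glue m t x - T t) <= C1 * rho m ^+ k0 * lam m ^+ size t.
  move=> tS; rewrite (glue_close t Ka xa).
  rewrite -(@prodv1l _ _ _ (chi m ^~ x) T t); last by move=> t'; exact: chi_close Ka xa.
  by apply: Hm0 => //; apply: le_trans xa3 _; rewrite ler_wpM2r// ler_nat.
rewrite rho_lam ?(leq_trans sS)//.
have -> : glue m.+1 s x - T s =
    prodv (fun t => one_jet R t - chi m.+1 t x) (fun t => glue m t x - T t) s +
    (local_taylor m.+1 s x - prodv (chi m.+1 ^~ x) T s).
  rewrite prodvBr (prodvBl _ _ T) (@prodv1l _ _ _ _ T)// /= /prodL.
  by rewrite opprB addrACA; congr (_ + _); rewrite addrAC subrr add0r.
have A0 : 0 <= (1 + C2) * 2 ^+ S by rewrite mulr_ge0 ?exprn_ge0// addr_ge0.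
set A := (1 + C2) * 2 ^+ S in A0 *.
apply: le_trans (csemiD _ _ qs) _; rewrite !mulrDl; apply: lerD.
  apply: le_trans (@prodv_bound _ _ _ _ _ _ _ _ (C1 * rho m ^+ k0) (lam m) qs A0 l0 _ _) _.
  + move=> t ts; have tS := leq_trans ts sS; apply: le_trans (ler_normB _ _) _.
    rewrite /A -mulrA; apply: (@le_trans _ _ ((1 + C2) * lam m.+1 ^+ size t)).
      rewrite mulrDl mul1r lerD ?HC2// /one_jet; case: eqP => [->|_]; rewrite ?normr1 ?normr0//.
      by rewrite exprn_ge0// ltW// lam_gt0.
    by rewrite ler_wpM2l ?addr_ge0// l1.
  + by move=> t ts; apply: G; exact: leq_trans sS.
  + rewrite -!mulrA ler_wpM2r//; last by rewrite ler_weXn2l// ler1n.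
    rewrite mulr_ge0 ?addr_ge0// !mulr_ge0 ?exprn_ge0//.
have mm' : (m0 <= m.+1)%N by rewrite ltnW.
apply: le_trans (Hm0 _ mm' a x s Ka _ sS) _.
  by apply: le_trans xa3 _; rewrite /rho lamS invfM mulrA ler_wpM2r//; lra.
rewrite -!mulrA ler_wpM2l//.
rewrite [leRHS](_ : _ = rho m ^+ k0 * (2 ^+ S * lam m ^+ size s)); last by ring.
apply: ler_pM; rewrite ?exprn_ge0 ?(ltW (lam_gt0 _)) ?(ltW (rho_gt0 _)) ?l1//.
rewrite lerXn2r ?nnegrE ?(ltW (rho_gt0 _))//.
by rewrite /rho lef_pV2 ?posrE ?lam_gt0// lam_le.
Qed.

Lemma K_closed : closed K.
Proof. exact: compact_closed (@norm_hausdorff _ _) Kc. Qed.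

Lemma far_near x : ~ K x -> exists m, \forall y \near x, far m.+1 y.
Proof.
move=> nKx; have /nbhs_ballP[d /= d0 hd] : nbhs x (~` K).
  by apply: open_nbhs_nbhs; split => //; apply: closed_openC; exact: K_closed.
have [m Hm] := lam_large (10 / d); exists m.
apply/nbhs_ballP; exists (d / 2); first exact: divr_gt0.
move=> y; rewrite -ball_normE/= => xy a Ka.
have xa : d <= `|x - a|.
  by rewrite leNgt; apply/negP => xa; apply: (hd a) => //; rewrite -ball_normE.
have ya : d / 2 <= `|y - a|.
  have := ler_distD y x a; lra.
have := Hm m.+1 (leqnSn m); rewrite ltr_pdivrMr// => h.
apply: lt_le_trans (_ : lam m.+1 * (d / 2) <= _); first lra.
by rewrite ler_pM2l// lam_gt0.
Qed.

(** Any scale m at which x is far from K gives the same value, as the construction is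
stationary from there on. *)
Definition ext s x : E := if `[< K x >] then f (mnms s) x
  else glue (xget 0%N [set m | far m.+1 x]) s x.

Lemma ext_in s x : K x -> ext s x = f (mnms s) x.
Proof. by move=> Kx; rewrite /ext asboolT. Qed.

Lemma ext_far m s x : far m.+1 x -> ext s x = glue m s x.
Proof.
move=> fx; rewrite /ext asboolF; last first.
  by move=> Kx; have := fx x Kx; rewrite subrr normr0 mulr0 ltrn0.
set m' := xget _ _; have fx' : far m'.+1 x by exact: (@xgetPex _ 0%N [set m | far m.+1 x] (ex_intro _ m fx)).
have [mm|mm] := leqP m m'; first exact: glue_stable.
by rewrite (@glue_stable m' m)// ltnW.
Qed.

Lemma nearest x a : K a -> exists a', K a' /\ forall y, K y -> `|x - a'| <= `|x - y|.
Proof.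
move=> Ka; have K0 : K !=set0 by exists a.
have cf : {within K, continuous (fun y => `|x - y|)}.
  apply: continuous_subspaceT => y; apply: (@cvg_norm _ _ _ (nbhs y) _ (fun y => x - y)).
  by apply: (@tvs_cvgB R _ _ (nbhs y) _ (fun=> x) id); [exact: cvg_cst|exact: cvg_id].
have [c cK Hc] := EVT_min_rV K0 Kc cf.
by exists c; split => [|y Ky]; [exact: set_mem|apply: Hc; exact: mem_set].
Qed.

(** The last scale for which a point at distance r from K lies in the zone where
chi m = 1. *)
Lemma scale_exists (m0 : nat) (r : R) : 0 < r -> lam m0 * r < 3 ->
  exists m, [/\ (m0 <= m)%N, lam m * r < 3 & 3 <= lam m.+1 * r].
Proof.
move=> r0 m0r; have [m1 Hm1] := lam_large (3 / r).
have ex : exists m, 3 <= lam m * r.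
  by exists m1; rewrite -ler_pdivrMr// ltW// Hm1.
have := ex_minnP ex; case=> -[|m] H min.
  have := lam_le (leq0n m0); rewrite -(ler_pM2r r0) => h.
  by have := le_lt_trans (le_trans H h) m0r; rewrite ltxx.
have mr : lam m * r < 3 by rewrite ltNge; apply/negP => /min; rewrite ltnn.
exists m; split => //; rewrite leqNgt; apply/negP => mm0.
have := lam_le mm0; rewrite -(ler_pM2r r0) => h.
by have := le_lt_trans (le_trans H h) m0r; rewrite ltxx.
Qed.

(** At a point outside K with nearest point a' in K, the extension is the
Taylor polynomial of high order at a' up to O(r^2), r being the distance, and
changing the order and the centre of the Taylor polynomial costs o(|x - a|). *)
Lemma ext_taylor s a q e : K a -> continuous_seminorm q -> 0 < e ->
  exists2 d : R, 0 < d & forall x, `|x - a| < d ->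
    q (ext s x - TJ (size s).+1 f a (mnms s) x) <= e * `|x - a|.
Proof.
move=> Ka qs e0; have [p qQ] := Qdom qs.
(* the order |s| + 2 makes the error O(r^2), the order p allows the use of Q p *)
pose k1 := (size s).+1; pose k0 := ((size s).+2 + p)%N.
have pk : (p <= k0)%N by rewrite leq_addl.
have sk : (size s <= k0)%N by rewrite /k0 addSn ltnW// ltnS (leq_trans _ (leq_addr _ _)).
have k10 : (k1 <= k0)%N by rewrite /k0 addSn ltnW// ltnS leq_addr.
have sk1 : (mdeg (mnms s) <= k1)%N by rewrite mdeg_mnms.
have [C1 C10 [m0 Hm0]] := glue_estimate qs qQ pk sk.
have [B B0 HB] := jet_bound k0 qs.
pose D := B * #|{: bmultinom n k0.+1}|%:R.
have D0 : 0 <= D by exact: mulr_ge0.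
have e4 : 0 < e / 4 by exact: divr_gt0.
have [d3 d30 H3] := taylor_center_change k1 qs e4.
have [dW dW0 HW] := W sk1 qs e0.
pose A := [:: 3 / lam m0; 1; e / 4 / (C1 + 1); e / 4 / (D + 1); d3; dW].
have [d d0 dA] : exists2 d : R, 0 < d & forall r, r \in A -> d <= r.
  have : \forall d \near (0 : R)^'+, forall r, r \in A -> d <= r.
    apply: near_seq => r; rewrite !inE => rA; apply: nbhs_right_le.
    case/or4P: rA => [/eqP->|/eqP->|/eqP->|/or3P[] /eqP->]//.
    - by rewrite divr_gt0// lam_gt0.
    - by rewrite divr_gt0// ltr_wpDl.
    - by rewrite divr_gt0// ltr_wpDl.
  by move=> H; near (0 : R)^'+ => d; exists d => //; near: d.
exists d => // x xad.
have dm0 : d <= 3 / lam m0 by apply: dA; rewrite !inE eqxx.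
have d1 : d <= 1 by apply: dA; rewrite !inE eqxx !orbT.
have dC1 : d <= e / 4 / (C1 + 1) by apply: dA; rewrite !inE eqxx !orbT.
have dD : d <= e / 4 / (D + 1) by apply: dA; rewrite !inE eqxx !orbT.
have dd3 : d <= d3 by apply: dA; rewrite !inE eqxx !orbT.
have ddW : d <= dW by apply: dA; rewrite !inE eqxx !orbT.
have [Kx|nKx] := pselect (K x).
  rewrite ext_in//; have [->|xa] := eqVneq x a.
    by rewrite TJ_center// !subrr csemi0// normr0 mulr0.
  rewrite -remainderE//; apply: le_trans (HW x a Kx Ka _) _.
    by rewrite normr_gt0 subr_eq0 xa (lt_le_trans xad).
  by rewrite mdeg_mnms subSnn expr1.
have [a' [Ka' a'P]] := nearest x Ka.
set r := `|x - a'| in a'P; have ra : r <= `|x - a| by exact: a'P.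
have r0 : 0 < r.
  by rewrite normr_gt0 subr_eq0; apply/eqP => xa'; apply: nKx; rewrite xa'.
have rd : r < d by exact: le_lt_trans xad.
have r1 : r <= 1 by exact: le_trans (ltW rd) d1.
have [|m [m0m mr rm]] := @scale_exists m0 r r0.
  by rewrite mulrC -ltr_pdivlMr ?lam_gt0// (lt_le_trans rd).
have fx : far m.+2 x.
  move=> y Ky; apply: lt_le_trans (_ : 6 <= _); first by rewrite ltr_nat.
  rewrite lamS -mulrA (_ : 6 = 2 * 3 :> R); last by rewrite -natrM.
  rewrite ler_pM2l//; apply: le_trans rm _; rewrite ler_pM2l ?lam_gt0//; exact: a'P.
have rhor : rho m <= r.
  rewrite /rho invf_ple ?posrE ?lam_gt0// -(ler_pM2r r0) mulVf ?gt_eqF//.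
  by move: rm; rewrite lamS; lra.
have sq (C : R) : 0 <= C -> d <= e / 4 / (C + 1) -> C * r ^+ 2 <= e / 4 * `|x - a|.
  move=> C0 dC; rewrite expr2 mulrA; apply: ler_pM => //; [by rewrite mulr_ge0// ltW|exact: ltW|].
  move: dC; rewrite ler_pdivlMr ?ltr_wpDl// => dC; apply: le_trans dC.
  rewrite mulrDr mulr1 mulrC; apply: le_trans (_ : d * C <= _); last by rewrite lerDl ltW.
  by rewrite ler_wpM2r// ltW.
have t1 : q (ext s x - TJ k0 f a' (mnms s) x) <= e / 4 * `|x - a|.
  rewrite (ext_far _ fx); apply: le_trans (Hm0 m m0m a' x s Ka' mr (leqnn _)) _.
  apply: le_trans (sq C1 C10 dC1); rewrite ler_wpM2l//.
  apply: (@le_trans _ _ (r ^+ (k0 - size s))).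
    by rewrite lerXn2r ?nnegrE// ltW.
  have -> : (k0 - size s = 2 + p)%N by rewrite /k0 -[(size s).+2]addn2 -addnA addKn.
  by rewrite ler_wiXn2l ?(ltW r0)// leq_addr.
have t2 : q (TJ k0 f a' (mnms s) x - TJ k1 f a' (mnms s) x) <= e / 4 * `|x - a|.
  apply: le_trans (sq D D0 dD); rewrite mulrC mulrA.
  apply: (@taylor_order_diff k1 k0 q _ B r a' x (mnms s)) => //.
  - by rewrite exprn_ge0// ltW.
  - move=> i /andP[+ _]; rewrite mdeg_mnms subSnn => i1.
    by rewrite ler_wiXn2l// ltW.
  - by move=> c ck; exact: HB.
have t3 : q (TJ k1 f a' (mnms s) x - TJ k1 f a (mnms s) x) <= e / 4 * `|x - a|.
  apply: le_trans (H3 a' a x (mnms s) `|x - a| Ka' Ka _ ra (lexx _) sk1) _.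
    exact: lt_le_trans xad dd3.
  by rewrite mdeg_mnms subSnn expr1.
apply: le_trans (csemi_tri _ (TJ k0 f a' (mnms s) x) _ qs) _.
have := csemi_tri (TJ k0 f a' (mnms s) x) (TJ k1 f a' (mnms s) x) (TJ k1 f a (mnms s) x) qs.
have : 0 <= e / 4 * `|x - a| by rewrite mulr_ge0// ltW.
rewrite -/k1; lra.
Unshelve. all: by end_near. Qed.

(** At points of K, continuity and differentiability follow from those of the Taylor
polynomial, of which the extension is a first-order perturbation. *)
Lemma LJ_ext : LJ setT ext.
Proof.
apply: LJ_mk => [s|s i x _].
  apply/cont_inP => x q e _ qs e0.
  have [Kx|/far_near[m fm]] := pselect (K x); last first.
    have := cont_in_near (LJ_cont s (@LJ_glue m)) qs (I : setT x) e0.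
    have fx := nbhs_singleton fm; apply: filterS2 fm => y fy H _.
    by rewrite (ext_far _ fx) (ext_far _ fy); exact: H.
  have e2 : 0 < e / 2 by exact: divr_gt0.
  have [d d0 hd] := ext_taylor s Kx qs e2.
  have := cont_in_near (LJ_cont s (@MJ_taylor _ _ _ setT (size s).+1 f x)) qs (I : setT x) e2.
  have dn : 0 < Num.min d 1 by rewrite lt_min d0 ltr01.
  have : \forall y \near x, `|y - x| < Num.min d 1.
    by apply/nbhs_ballP; exists (Num.min d 1) => //= y; rewrite -ball_normE/= distrC.
  apply: filterS2 => y; rewrite lt_min => /andP[yd y1] H _.
  have := hd y yd; have := H I; rewrite (ext_in s Kx) /= TJ_center ?mdeg_mnms// => h1 h2.
  have h3 : e / 2 * `|y - x| <= e / 2 by rewrite ler_piMr// ltW.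
  have := csemi_tri (ext s y) (TJ (size s).+1 f x (mnms s) y) (f (mnms s) x) qs; lra.
have xT : (setT : set 'rV[R]_n)° x by rewrite interiorT.
have [Kx|/far_near[m fm]] := pselect (K x); last first.
  rewrite (ext_far _ (nbhs_singleton fm)).
  apply: (@dder_near _ _ _ (glue m s)); last by exact: (LJ_dder s i (@LJ_glue m) xT).
  by apply: filterS fm => y fy; rewrite (ext_far _ fy).
move=> q qs e e0; have e2 : 0 < e / 2 by exact: divr_gt0.
have [d d0 hd] := ext_taylor s Kx qs e2.
have Tx : dder (TJ (size s).+1 f x (mnms s)) x (ei R i) (TJ (size s).+1 f x (mnms (rcons s i)) x).
  exact: (LJ_dder s i (@MJ_taylor _ _ _ setT (size s).+1 f x) xT).
have [d' d'0 hd'] := Tx q qs _ e2.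
exists (Num.min d d'); first by rewrite lt_min d0.
move=> h; rewrite lt_min => /andP[hd0 hd1].
have hx : `|h *: ei R i + x - x| <= `|h|.
  by rewrite addrK normrZ ler_piMr// norm_ei_le.
have := hd' h hd1; rewrite !TJ_center ?mdeg_mnms ?size_rcons// => A1.
have A2 := hd (h *: ei R i + x) (le_lt_trans hx hd0).
have A3 : e / 2 * `|h *: ei R i + x - x| <= e / 2 * `|h| by rewrite ler_wpM2l// ltW.
rewrite [ext s x]ext_in// [ext (rcons s i) x]ext_in//.
have := csemi_tri (ext s (h *: ei R i + x)) (TJ (size s).+1 f x (mnms s) (h *: ei R i + x))
  (f (mnms s) x + h *: f (mnms (rcons s i)) x) qs.
rewrite !opprD !addrA; lra.
Qed.

End WhitneyExtension.

(** Whitney's extension theorem for compact sets and functions with values in a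
metrizable space, for jets of infinite order. *)
Theorem whitney_extension (R : realType) (n : nat) (E : tvsType R) (K : set 'rV[R]_n)
    (f : jet R n E) : metrizable R E -> compact K ->
  (forall l b q e, (mdeg b <= l)%N -> continuous_seminorm q -> 0 < e ->
     exists2 d : R, 0 < d & forall x y, K x -> K y -> 0 < `|x - y| < d ->
       q (remainder f l b y x) <= e * `|x - y| ^+ (l - mdeg b)) ->
  exists L : seq 'I_n -> 'rV[R]_n -> E,
    LJ setT L /\ forall s a, K a -> L s a = f (mnms s) a.
Proof.
move=> /metrizable_csemi[Q [Qs Qle Qdom]] Kc W.
have [w [wd wo wb ws]] := bump_exists R.
have [kk Hkk] := order_exists Qs Kc W.
have [Mb Mb0 HMb] : exists2 M : R, 0 <= M & forall z, K z -> `|z| <= M.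
  have idc : @cont_in R 'rV[R]_n n setT id by move=> x _; exact: cvg_within.
  exact: (cont_in_bound idc Kc (@subsetT _ _) (csemi_norm _)).
have HLb a : K a -> `|a| + 3 <= (Num.bound (Mb + 3))%:R.
  move=> Ka; apply: ltW; apply: le_lt_trans (archi_boundP _); last exact: addr_ge0.
  by rewrite lerD2r HMb.
exists (ext w K f kk (Num.bound (Mb + 3))); split; last by move=> s a; exact: ext_in.
exact: (LJ_ext Qle Qdom wd wo wb ws Kc W Hkk HLb).
Qed.

(** * Topologies generated by seminorms *)

Section SeminormTopology.
Variables (R : realType) (W : lmodType R) (X : set W) (P : set (W -> R)).
Notation T := (seminorm_topology X P).

Lemma seminorm_ball_nbhs (x : W) (p : W -> R) (e : R) : X x -> P p -> p 0 = 0 -> 0 < e ->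
  nbhs (x : T) ([set y | p (y - x) < e] : set T).
Proof.
move=> Xx Pp p0 e0; rewrite nbhsE; exists [set y | p (y - x) < e]; last by [].
split; last by rewrite /= subrr p0.
exists [set [set y | p (y - x) < e]]; last first.
  by rewrite predeqE => ?; split=> [[_ ->]|] //; exists [set y | p (y - x) < e].
move=> _ ->; exists [fset [set y | p (y - x) < e]%classic]%fset.
  by move=> B; rewrite inE inE => /eqP->; exists x, p, e.
rewrite predeqE => y; split=> [h|h B]; last by rewrite /= inE => /eqP->.
by apply: (h [set y | p (y - x) < e]); rewrite /= inE.
Qed.

Lemma seminorm_cvg (F : set_system W) (t : W) : Filter F ->
  (forall x p e, X x -> P p -> 0 < e -> p (t - x) < e -> F [set y | p (y - x) < e]) ->
  F --> (t : T).
Proof.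
move=> FF H A /=; rewrite (@nbhsE T) => -[_ [[B sB <-] [C BC Ct] sUBA]].
rewrite nbhs_filterE; apply: filterS sUBA _; apply: (@filterS _ _ _ C).
  by move=> ? ?; exists C.
have /sB [D sD IDeC] := BC; rewrite -IDeC; apply: filter_bigI => S DS.
have /sD := DS; rewrite inE => -[x [p [e [Xx Pp e0 SE]]]].
have St : S t by move: Ct; rewrite -IDeC => /(_ _ DS).
by move: St; rewrite SE/= => St; exact: H.
Qed.

End SeminormTopology.

Lemma prod_topology_cvg (I : Type) (T : I -> topologicalType) (S : Type) (F : set_system S)
    (g : S -> prod_topology T) (t : prod_topology T) : Filter F ->
  (forall i, (fun s => g s i) @ F --> t i) -> g @ F --> t.
Proof.
move=> FF H; apply/cvg_sup => i U [B [[C oC <-] Ct]] BU.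
apply: filterS BU _; apply: (H i); exact: open_nbhs_nbhs.
Qed.

(** * Charts and changes of charts *)

Lemma dense_interior_openI (R : realType) (n : nat) (V W : set 'rV[R]_n) :
  dense_interior V -> open W -> dense_interior (V `&` W).
Proof.
move=> Vd oW x [Vx Wx] B xB.
have xBW : nbhs x (B `&` W) by apply: filterI => //; exact: open_nbhs_nbhs.
have [y [Viy [By Wy]]] := Vd x Vx _ xBW; exists y; split => //.
by rewrite interiorI; split => //; exact: open_nbhs_nbhs.
Qed.

Section Charts.
Variables (R : realType) (n : nat) (M : topologicalType).
Implicit Types (phi psi : chart R n M) (x y : M) (v : 'rV[R]_n).

Lemma in_chartE (F : zmodType) phi (f : M -> F) x :
  is_chart phi -> chart_dom phi x -> in_chart phi f (phi x) = f x.
Proof.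
move=> [_ _ [inj _] _ _] dx; rewrite /in_chart.
have ex : exists z, [set f y | y in [set y | chart_dom phi y /\ phi y = phi x]] z.
  by exists (f x), x.
have [y [dy yx] <-] := xgetPex 0 ex.
by congr f; apply: inj => //; exact: mem_set.
Qed.

Lemma chart_open phi (O : set M) : is_chart phi -> open O ->
  exists2 W : set 'rV[R]_n, open W & phi @` (O `&` chart_dom phi) = chart_cod phi `&` W.
Proof.
move=> [od _ _ H _] oO; apply: H; last by move=> x [].
exact: openI.
Qed.

Lemma chart_nbhs phi (N : set M) x : is_chart phi -> chart_dom phi x -> nbhs x N ->
  \forall v \near phi x, chart_cod phi v -> exists2 y, N y & chart_dom phi y /\ phi y = v.
Proof.
move=> cphi dx; rewrite nbhsE => -[O [oO Ox] ON].
have [W oW OW] := chart_open cphi oO.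
have Wx : (chart_cod phi `&` W) (phi x) by rewrite -OW; exists x.
apply: filterS (open_nbhs_nbhs (conj oW Wx.2)) => v Wv Vv.
have : (chart_cod phi `&` W) v by [].
by rewrite -OW => -[y [Oy dy] <-]; exists y => //; exact: ON.
Qed.

Lemma chart_continuous phi x : is_chart phi -> chart_dom phi x -> phi @ x --> phi x.
Proof.
move=> [od _ [_ /subspace_continuousP cphi] _ _] dx.
have := cphi x dx; rewrite /from_subspace => + A xA => /(_ A xA); rewrite !nbhs_simpl /within/=.
by move=> H; near=> y; apply: (near H y) => //; near: y; exact: open_nbhs_nbhs.
Unshelve. all: by end_near. Qed.

(** A chart is a homeomorphism onto its codomain, so preimages of compact subsets of the
codomain are compact. *)
Lemma chart_compact phi (L : set 'rV[R]_n) : is_chart phi -> compact L ->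
  L `<=` chart_cod phi -> compact (chart_dom phi `&` phi @^-1` L).
Proof.
move=> cphi Lc LV F FF FK; have [_ _ [inj _] _ _] := cphi.
have FL : (phi @ F) L by apply: (@filterS _ F _ _ _ _ FK) => x [].
have [v [Lv Fv]] := Lc (phi @ F) _ FL.
have [x dx xv] := LV v Lv; exists x; split; first by split => //=; rewrite xv.
move=> A B FA xB.
have := chart_nbhs cphi dx xB; rewrite xv => vN.
have FA' : (phi @ F) [set phi y | y in A `&` (chart_dom phi `&` phi @^-1` L)].
  by apply: (@filterS _ F _ _ _ _ (filterI FA FK)) => y Ay; exists y.
have [_ [[y [Ay [dy Ly]] <-] H]] := Fv _ _ FA' vN.
have [z Bz [dz zy]] := H (LV _ Ly).
exists y; split => //; rewrite (_ : y = z)//; symmetry.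
by apply: inj => //; exact: mem_set.
Qed.

Definition overlap phi psi := phi @` (chart_dom phi `&` chart_dom psi).

Variable Atl : set (chart R n M).
Hypothesis Atl_smooth : smooth_atlas Atl.

Let isc phi : Atl phi -> is_chart phi. Proof. by case: Atl_smooth => + _ _; apply. Qed.

Lemma overlap_open phi psi : Atl phi -> Atl psi ->
  exists2 W, open W & overlap phi psi = chart_cod phi `&` W.
Proof.
move=> Ap Aq; have [oq _ _ _ _] := isc Aq.
by have [W oW e] := chart_open (isc Ap) oq; exists W => //; rewrite /overlap setIC.
Qed.

Lemma overlap_dense phi psi : Atl phi -> Atl psi -> dense_interior (overlap phi psi).
Proof.
move=> Ap Aq; have [W oW ->] := overlap_open Ap Aq.
by have [_ [_ dV] _ _ _] := isc Ap; exact: dense_interior_openI.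
Qed.

Lemma overlap_sub phi psi : overlap phi psi `<=` chart_cod phi.
Proof. by move=> _ [x [dx _] <-]; exists x. Qed.

Lemma transition_in phi psi v : Atl phi -> Atl psi -> overlap phi psi v ->
  chart_cod psi (in_chart phi psi v).
Proof. by move=> Ap Aq [x [dx dx'] <-]; rewrite in_chartE//; [exists x|exact: isc]. Qed.

(** Interior points stay interior under a change of charts: this is the
compatibility of the atlas with the boundaries of the codomains. *)
Lemma transition_interior phi psi v : Atl phi -> Atl psi ->
  (overlap phi psi)° v -> (chart_cod psi)° (in_chart phi psi v).
Proof.
move=> Ap Aq iv; have [x [dx dx'] xv] := interior_subset iv.
have [_ _ /(_ _ _ Ap Aq)[_ /(_ x dx dx') bd]] := Atl_smooth.
have iV : (chart_cod phi)° (phi x).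
  by rewrite xv; apply: (interiorS (@overlap_sub phi psi)).
rewrite -xv in_chartE//; last exact: isc.
apply: contrapT => nV; have [_] := bd.2 (conj (subset_closure (ex_intro2 _ _ x dx' erefl)) nV).
exact.
Qed.

Section PullbackOfJets.
Variable E : tvsType R.
Hypothesis Eh : hausdorff_space E.

(** The derivatives of f in the chart phi are those in the chart psi, pulled back by the
change of charts. *)
Lemma pullback_jet phi psi (J : jet R n E) (f : M -> E) : Atl phi -> Atl psi ->
  MJ (chart_cod psi) J -> (forall x, chart_dom psi x -> J mnm0 (psi x) = f x) ->
  is_jet_of (overlap phi psi) (in_chart phi f)
    (fun s => pullback (overlap phi psi) (in_chart phi psi) J (mnms s)).
Proof.
move=> Ap Aq hJ fJ; have dO := overlap_dense Ap Aq.
have [_ _ /(_ _ _ Ap Aq)[sm _]] := Atl_smooth.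
have [L Lj] := smooth_on_jet (@norm_hausdorff _ _) sm.
have := @compL_jet _ _ _ E _ (chart_cod psi) _ _ J (in_chart phi f) Lj hJ.
case=> [v Ov|v Ov|v [x [dx dx'] <-]|hL h0].
- exact: transition_in.
- exact: transition_interior.
- by rewrite !in_chartE ?fJ//; exact: isc.
have eqL s v : overlap phi psi v -> compL J (in_chart phi psi) L s v =
    pullback (overlap phi psi) (in_chart phi psi) J (mnms s) v.
  move=> Ov; rewrite (pullback_compL _ _ dO Lj Ov).
  by apply: (LJ_perm Eh dO hL Ov); rewrite perm_sym; exact: mnm_seqK.
split; first exact: LJ_eq eqL hL.
by move=> v Ov; rewrite -(eqL [::])//; exact: h0.
Qed.

Lemma smooth_jets phi (f : M -> E) : Atl phi -> smooth_functions Atl E f ->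
  MJ (chart_cod phi) (partial (chart_cod phi) (in_chart phi f)) /\
  forall x, chart_dom phi x -> partial (chart_cod phi) (in_chart phi f) mnm0 (phi x) = f x.
Proof.
move=> Ap [_ /(_ _ Ap) sm]; have [_ [_ dV] _ _ _] := isc Ap.
have [hM h0] := MJ_partial Eh dV sm; split => // x dx.
by rewrite h0 ?in_chartE//; [exact: isc|exists x].
Qed.

End PullbackOfJets.
End Charts.

(** * Bounds for Whitney jets *)

Section Suprema.
Variables (R : realType) (T : Type) (D : set T) (F : T -> R).

Lemma sup_image_le (B : R) : 0 <= B -> (forall x, D x -> F x <= B) ->
  sup [set F x | x in D] <= B.
Proof.
move=> B0 FB; have [->|/set0P[x Dx]] := eqVneq D set0; first by rewrite image_set0 sup0.
by apply: ge_sup; [exists (F x), x|move=> _ [y Dy <-]; exact: FB].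
Qed.

Lemma le_sup_image (B : R) x : (forall y, D y -> F y <= B) -> D x ->
  F x <= sup [set F x | x in D].
Proof.
move=> FB Dx; apply: ub_le_sup; last by exists x.
by exists B => _ [y Dy <-]; exact: FB.
Qed.

End Suprema.

Section WhitneyJets.
Variables (R : realType) (n : nat) (E : tvsType R).
Implicit Types (B K : set 'rV[R]_n) (f g : jet R n E) (q : E -> R).

Let c : R := n.+1%:R.

(** The Whitney condition does not depend on the choice of the norm of R^n; the maximum
norm is the convenient one for lattices of cubes. *)
Lemma whitney_jets_norm B K f : whitney_jets E B f -> compact K -> K `<=` B ->
  forall l b q e, (mdeg b <= l)%N -> continuous_seminorm q -> 0 < e ->
  exists2 d : R, 0 < d & forall x y, K x -> K y -> 0 < `|x - y| < d ->
    q (remainder f l b y x) <= e * `|x - y| ^+ (l - mdeg b).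
Proof.
move=> [_ W] Kc KB l b q e bl qs e0; pose k := (l - mdeg b)%N.
have c0 : 0 < c by [].
have [d d0 hd] := W l b q K (e / c ^+ k) bl qs Kc KB (divr_gt0 e0 (exprn_gt0 _ c0)).
exists (d / c); first exact: divr_gt0.
move=> x y Kx Ky /andP[xy0]; rewrite ltr_pdivlMr// mulrC => xyd.
apply: le_trans (hd x y Kx Ky _) _.
  rewrite euclidean_gt0 -normr_gt0 xy0/=; apply: le_lt_trans xyd.
  exact: euclidean_le_norm.
rewrite -mulrA ler_wpM2l ?(ltW e0)// ler_pdivrMl ?exprn_gt0// -exprMn.
have en0 : 0 <= euclidean_norm (x - y) by exact: sqrtr_ge0.
rewrite lerXn2r ?nnegrE ?mulr_ge0//; exact: euclidean_le_norm.
Qed.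

Lemma whitney_jets_mk B f : (forall a x, ~ B x -> f a x = 0) ->
  (forall K l b q e, compact K -> K `<=` B -> (mdeg b <= l)%N -> continuous_seminorm q -> 0 < e ->
   exists2 d : R, 0 < d & forall x y, K x -> K y -> 0 < `|x - y| < d ->
    q (remainder f l b y x) <= e * `|x - y| ^+ (l - mdeg b)) ->
  whitney_jets E B f.
Proof.
move=> f0 W; split => // l a q K e al qs Kc KB e0.
have [d d0 hd] := W K l a q e Kc KB al qs e0; exists d => // x y Kx Ky /andP[xy0 xyd].
have xy : `|x - y| <= euclidean_norm (x - y) by exact: norm_le_euclidean.
apply: le_trans (hd x y Kx Ky _) _.
  by rewrite normr_gt0 -euclidean_gt0 xy0 (le_lt_trans xy).
by rewrite ler_wpM2l ?(ltW e0)// lerXn2r ?nnegrE// (le_trans _ xy).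
Qed.

(** The suprema in the seminorms are finite: near the diagonal by the Whitney condition,
away from it because the jet is bounded on K and the distances are bounded below. *)
Lemma whitney_bounded B K f l q : whitney_jets E B f -> compact K -> K `<=` B ->
  continuous_seminorm q -> exists2 C : R, 0 <= C & forall a, (mdeg a <= l)%N ->
    (forall x, K x -> q (f a x) <= C) /\
    forall x y, K x -> K y -> x <> y ->
      q (remainder f l a y x) / euclidean_norm (x - y) ^+ (l - mdeg a) <= C.
Proof.
move=> Wf Kc KB qs; have W := whitney_jets_norm Wf Kc KB.
have [C1 C10 HC1] := jet_bound Kc W l qs.
have [Mb Mb0 HMb] : exists2 D : R, 0 <= D & forall z, K z -> `|z| <= D.
  have idc : @cont_in R 'rV[R]_n n setT id by move=> x _; exact: cvg_within.
  exact: (cont_in_bound idc Kc (@subsetT _ _) (csemi_norm _)).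
pose D := Mb + Mb + 1; have D1 : 1 <= D by rewrite lerDr addr_ge0.
have D0 : 0 <= D by exact: le_trans D1.
pose C2 (a : multinom n) := C1 + \sum_(b : bmultinom n (l - mdeg a).+1) D ^+ l * C1.
have HC2 a x y : (mdeg a <= l)%N -> K x -> K y -> q (remainder f l a y x) <= C2 a.
  move=> al Kx Ky; rewrite /remainder; apply: le_trans (csemiB _ _ qs) _.
  apply: lerD; first exact: HC1.
  apply: le_trans (csemi_sum _ _ _ qs) _; apply: ler_sum => b _.
  have bl : (mdeg b <= l - mdeg a)%N by rewrite -ltnS; exact: bmdeg.
  rewrite csemiZ//; apply: ler_pM => //; first exact: csemi_ge0.
    apply: le_trans (mono_norm _ _) _; apply: (@le_trans _ _ (D ^+ mdeg b)).
      rewrite lerXn2r ?nnegrE//; apply: le_trans (ler_normB _ _) _.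
      apply: le_trans (_ : Mb + Mb <= D); last by rewrite lerDl.
      by apply: lerD; exact: HMb.
    by rewrite ler_weXn2l// (leq_trans bl)// leq_subr.
  by apply: HC1 => //; rewrite mdegD -leq_subRL.
have [d d0 hd] : exists2 d : R, 0 < d & forall a : bmultinom n l.+1,
    forall x y, K x -> K y -> 0 < `|x - y| < d ->
    q (remainder f l a y x) <= 1 * `|x - y| ^+ (l - mdeg a).
  have : \forall d \near (0 : R)^'+, forall a : bmultinom n l.+1,
      forall x y, K x -> K y -> 0 < `|x - y| < d ->
      q (remainder f l a y x) <= 1 * `|x - y| ^+ (l - mdeg a).
    apply: near_fin => a; have al : (mdeg a <= l)%N by rewrite -ltnS; exact: bmdeg.
    have [d d0 hd] := W l a q 1 al qs ltr01; near=> d' => x y Kx Ky /andP[xy0 xyd].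
    apply: hd => //; rewrite xy0/=; apply: lt_le_trans xyd _.
    by near: d'; exact: nbhs_right_le.
  by move=> H; near (0 : R)^'+ => d; exists d => //; near: d.
pose C3 (a : bmultinom n l.+1) := C2 a / d ^+ (l - mdeg a).
have C20 a : 0 <= C2 a.
  by rewrite addr_ge0// sumr_ge0// => b _; rewrite mulr_ge0// exprn_ge0// (le_trans _ D1).
have C30 a : 0 <= C3 a by rewrite divr_ge0// exprn_ge0// ltW.
exists (C1 + 1 + \sum_a C3 a); first by rewrite !addr_ge0// sumr_ge0.
have S0 : 0 <= \sum_a C3 a by exact: sumr_ge0.
move=> a al; split=> [x Kx|x y Kx Ky xy].
  by apply: le_trans (HC1 a x al Kx) _; lra.
have al' : (mdeg a < l.+1)%N by [].
have nxy : 0 < `|x - y| by rewrite normr_gt0 subr_eq0; exact/eqP.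
have exy : 0 < euclidean_norm (x - y) by rewrite euclidean_gt0 -normr_gt0.
have nle : `|x - y| <= euclidean_norm (x - y) by exact: norm_le_euclidean.
have [xyd|xyd] := ltP `|x - y| d.
  apply: (@le_trans _ _ 1); last lra.
  rewrite ler_pdivrMr ?exprn_gt0//; have := hd (BMultinom al') x y Kx Ky.
  rewrite nxy xyd => /(_ isT)/le_trans; apply.
  by rewrite !mul1r lerXn2r ?nnegrE// ltW.
apply: (@le_trans _ _ (C3 (BMultinom al'))); last first.
  rewrite (bigD1 (BMultinom al'))//= addrCA lerDl.
  by rewrite !addr_ge0// sumr_ge0.
rewrite /C3/=; apply: ler_pM; rewrite ?invr_ge0 ?exprn_ge0 ?(ltW exy) ?HC2//.
  exact: csemi_ge0.
rewrite lef_pV2 ?posrE ?exprn_gt0// lerXn2r ?nnegrE ?(ltW d0) ?(ltW exy)//.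
exact: le_trans nle.
Unshelve. all: by end_near. Qed.

(** A perturbation of the values and of the quotients by at most eta changes each of the
two maxima by at most eta. Finiteness of the suprema for u is needed, because the supremum
of an unbounded set is 0 by convention. *)
Lemma whitney_seminorm_le l q K (u v : jet R n E) (C eta : R) : 0 <= eta ->
  (forall a, (mdeg a <= l)%N ->
    (forall x, K x -> q (u a x) <= C) /\
    forall x y, K x -> K y -> x <> y ->
      q (remainder u l a y x) / euclidean_norm (x - y) ^+ (l - mdeg a) <= C) ->
  (forall a, (mdeg a <= l)%N ->
    (forall x, K x -> q (v a x) <= q (u a x) + eta) /\
    forall x y, K x -> K y -> x <> y ->
      q (remainder v l a y x) / euclidean_norm (x - y) ^+ (l - mdeg a) <=
      q (remainder u l a y x) / euclidean_norm (x - y) ^+ (l - mdeg a) + eta) ->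
  whitney_seminorm l q K v <= whitney_seminorm l q K u + 2 * eta.
Proof.
move=> eta0 uC uv; rewrite /whitney_seminorm.
set m1 := (X in _ <= X + _ + _); set m2 := (X in _ <= _ + X + _).
have -> : m1 + m2 + 2 * eta = (m1 + eta) + (m2 + eta) by ring.
have m10 : 0 <= m1 by exact: bigmax_ge_id.
have m20 : 0 <= m2 by exact: bigmax_ge_id.
have adeg (a : bmultinom n l.+1) : (mdeg a <= l)%N by rewrite -ltnS; exact: bmdeg.
apply: lerD; apply: bigmax_le; rewrite ?addr_ge0// => a _; apply: sup_image_le; rewrite ?addr_ge0//.
  move=> x Kx; apply: le_trans ((uv a (adeg a)).1 x Kx) _; rewrite lerD2r.
  apply: le_trans (@le_bigmax _ _ _ 0 _ a).
  exact: (le_sup_image (uC a (adeg a)).1).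
move=> [x y] /= [Kx Ky xy]; apply: le_trans ((uv a (adeg a)).2 x y Kx Ky xy) _; rewrite lerD2r.
apply: le_trans (@le_bigmax _ _ _ 0 _ a).
apply: (@le_sup_image _ _ _ (fun xy => q (remainder u l a xy.2 xy.1) /
  euclidean_norm (xy.1 - xy.2) ^+ (l - mdeg a)) C (x, y)) => // -[x' y'] /= [Kx' Ky' xy'].
exact: (uC a (adeg a)).2.
Qed.

Lemma remainderB (u v : jet R n E) l a y x :
  remainder (u - v) l a y x = remainder u l a y x - remainder v l a y x.
Proof.
rewrite /remainder subrBB; congr (_ - _).
by rewrite -sumrB; apply: eq_bigr => b _; rewrite -scalerBr.
Qed.

End WhitneyJets.

(** * The restriction map *)

Section RestrictionMap.
Variables (R : realType) (E : tvsType R) (n : nat) (M : topologicalType).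
Variables (Atl : set (chart R n M)) (A : set M).
Hypothesis Eh : hausdorff_space E.
Hypothesis Atl_smooth : smooth_atlas Atl.
Let X := smooth_functions Atl E.
Let rho := restriction_map Atl E A.

Let isc phi : Atl phi -> is_chart phi. Proof. by case: Atl_smooth => + _ _; apply. Qed.
Let inAtl (phi : Atl) : Atl (\val phi). Proof. exact: set_mem (valP phi). Qed.

Lemma restriction_mapE (f : M -> E) (phi : Atl) a v : jet_dom A (\val phi) v ->
  rho f phi a v = partial (chart_cod (\val phi)) (in_chart (\val phi) f) a v.
Proof. by move=> Av; rewrite /rho /restriction_map patchT// mem_set. Qed.

Lemma restriction_map_out (f : M -> E) (phi : Atl) a v : ~ jet_dom A (\val phi) v ->
  rho f phi a v = 0.
Proof. by move=> Av; rewrite /rho /restriction_map /patch memNset. Qed.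

Lemma jet_dom_sub (phi : chart R n M) : jet_dom A phi `<=` chart_cod phi.
Proof. by move=> _ [x [_ dx] <-]; exists x. Qed.

Lemma restriction_remainder (f : M -> E) (phi : Atl) l a x y :
  jet_dom A (\val phi) x -> jet_dom A (\val phi) y ->
  remainder (rho f phi) l a y x =
  remainder (partial (chart_cod (\val phi)) (in_chart (\val phi) f)) l a y x.
Proof.
move=> Ax Ay; rewrite /remainder restriction_mapE//; congr (_ - _).
by apply: eq_bigr => b _; rewrite restriction_mapE.
Qed.

Lemma restriction_whitney f (phi : Atl) : X f ->
  whitney_jets E (jet_dom A (\val phi)) (rho f phi).
Proof.
move=> Xf; have [hJ _] := smooth_jets Atl_smooth Eh (inAtl phi) Xf.
have [_ [lV dV] _ _ _] := isc (inAtl phi).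
apply: whitney_jets_mk => [a x|K l b q e Kc KB bl qs e0]; first exact: restriction_map_out.
have KV := subset_trans KB (@jet_dom_sub (\val phi)).
have [d d0 hd] := smooth_whitney lV dV hJ Kc KV bl qs e0.
exists d => // x y Kx Ky; rewrite restriction_remainder; [exact: hd|exact: KB..].
Qed.

(** Both sides are jets on the overlap of the same function, expressed in the first
chart. *)
Lemma restriction_correspond f (phi psi : Atl) : X f ->
  jets_correspond A (\val phi) (\val psi) (rho f phi) (rho f psi).
Proof.
move=> Xf a _ [x [[Ax dx] dx'] <-].
have Ap := inAtl phi; have Aq := inAtl psi.
have [hJ h0] := smooth_jets Atl_smooth Eh Ap Xf.
have [hJ' h0'] := smooth_jets Atl_smooth Eh Aq Xf.
have Ov : overlap (\val phi) (\val psi) ((\val phi) x) by exists x.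
rewrite restriction_mapE; last by exists x.
transitivity (pullback (overlap (\val phi) (\val psi)) (in_chart (\val phi) (\val psi))
   (partial (chart_cod (\val psi)) (in_chart (\val psi) f)) a (\val phi x)).
  rewrite /pullback; apply: eq_bigr => b _; rewrite restriction_mapE//.
  by rewrite in_chartE//; [exists x|exact: isc].
have [hL hL0] := pullback_jet Atl_smooth Eh Ap Aq hJ' h0'.
rewrite -(mnms_seq a).
apply: (LJ_unique Eh (overlap_dense Atl_smooth Ap Aq) hL (LJ_sub (@overlap_sub _ _ _ _ _) hJ)) => //.
move=> _ [y [dy dy'] <-]; rewrite mnms_nil h0//.
by have := hL0 _ (ex_intro2 _ _ y (conj dy dy') erefl); rewrite mnms_nil => ->; rewrite in_chartE//; exact: isc.
Qed.

Lemma in_chart_linear (phi : chart R n M) (a : R) (f g : M -> E) v : Atl phi ->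
  chart_cod phi v -> in_chart phi (a *: f + g) v = a *: in_chart phi f v + in_chart phi g v.
Proof. by move=> Ap [x dx <-]; rewrite !in_chartE//; exact: isc. Qed.

Lemma smooth_jets_linear (phi : chart R n M) (a : R) (f g : M -> E) : Atl phi -> X f -> X g ->
  let J h := partial (chart_cod phi) (in_chart phi h) in
  let J' := fun b x => a *: J f b x + J g b x in
  MJ (chart_cod phi) J' /\
  forall b v, chart_cod phi v -> J (a *: f + g) b v = J' b v.
Proof.
move=> Ap Xf Xg J J'; have [hf f0] := smooth_jets Atl_smooth Eh Ap Xf.
have [hg g0] := smooth_jets Atl_smooth Eh Ap Xg.
have [_ [_ dV] _ _ _] := isc Ap.
have hJ' : MJ (chart_cod phi) J' by move=> k; apply: LJk_add => //; exact: LJk_scale.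
split => // b v Vv; apply: (partial_MJ Eh) => // w Vw.
rewrite in_chart_linear//; case: Vw => x dx <-.
by rewrite /J' /J f0 // g0// !in_chartE//; exact: isc.
Qed.

Lemma restriction_linear (a : R) f g : X f -> X g -> rho (a *: f + g) = a *: rho f + rho g.
Proof.
move=> Xf Xg; apply/funext => phi; apply/funext => b; apply/funext => v.
rewrite -[RHS]/(a *: rho f phi b v + rho g phi b v).
have [Av|Av] := pselect (jet_dom A (\val phi) v); last first.
  by rewrite !restriction_map_out// scaler0 addr0.
rewrite !restriction_mapE//.
by apply: (smooth_jets_linear a (inAtl phi) Xf Xg).2; exact: jet_dom_sub.
Qed.

Lemma smooth_seminorm_bound (V : set 'rV[R]_n) (F : 'rV[R]_n -> E) l q (L : set 'rV[R]_n) a v :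
  MJ V (partial V F) -> compact L -> L `<=` V -> continuous_seminorm q ->
  (mdeg a <= l)%N -> L v -> q (partial V F a v) <= smooth_seminorm V l q L F.
Proof.
move=> hJ Lc LV qs al Lv; have al' : (mdeg a < l.+1)%N by [].
apply: le_trans (@le_bigmax _ _ _ 0 _ (BMultinom al')).
have hc : cont_in V (partial V F a) by have := LJ_cont (mnm_seq a) hJ; rewrite mnms_seq.
have [B B0 HB] := cont_in_bound hc Lc LV qs.
exact: le_sup_image HB Lv.
Qed.

Lemma smooth_functionsB f g : X f -> X g -> X (g - f).
Proof.
move=> Xf Xg; split.
  by move=> x; apply: tvs_cvgB; [exact: Xg.1|exact: Xf.1].
move=> phi Ap; have [hJ h0] := smooth_jets_linear (-1) Ap Xf Xg.
have [_ [_ dV] _ _ _] := isc Ap.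
apply: (@jet_smooth_on _ _ _ Eh _ _ (fun s => (fun b x =>
  -1 *: partial (chart_cod phi) (in_chart phi f) b x + partial (chart_cod phi) (in_chart phi g) b x) (mnms s))) => //.
split => // v Vv; rewrite mnms_nil; case: Vv => x dx <-.
rewrite (smooth_jets Atl_smooth Eh Ap Xf).2// (smooth_jets Atl_smooth Eh Ap Xg).2//.
by rewrite in_chartE//; [rewrite scaleN1r addrC|exact: isc].
Qed.

Lemma restrictionB f g : X f -> X g -> rho (g - f) = rho g - rho f.
Proof.
move=> Xf Xg; have := restriction_linear (-1) Xf Xg.
by rewrite !scaleN1r addrC [RHS]addrC.
Qed.

(** By linearity only the difference g - f matters; each Whitney seminorm of its
restriction to K is at most a multiple of its C^l-seminorm on a larger compact set L. *)
Lemma restriction_continuous :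
  {within (X : set (smooth_space Atl E)),
    continuous (rho : smooth_space Atl E -> jet_product_space Atl E A)}.
Proof.
apply/subspace_continuousP => f Xf; apply: prod_topology_cvg => phi.
apply: seminorm_cvg => x _ e Wx [l [q [K [qs Kc KB ->]]]] e0 pe.
have Ap := inAtl phi; have [_ [lV dV] _ _ _] := isc Ap.
have KV := subset_trans KB (@jet_dom_sub (\val phi)).
have [L [Lc LV KL HL]] := whitney_bound E lV dV Kc KV.
have [C C0 HC] := HL l q qs.
have cK := chart_compact (isc Ap) Lc LV.
set K' := chart_dom (\val phi) `&` (\val phi) @^-1` L in cK.
have K'L : (\val phi) @` K' = L.
  apply/seteqP; split => [_ [y [dy Ly] <-]//|v Lv].
  by have [y dy yv] := LV v Lv; exists y => //; split => //=; rewrite yv.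
pose p := smooth_seminorm (chart_cod (\val phi)) l q L.
pose P h := p (in_chart (\val phi) h).
have Pp : smooth_seminorms Atl E P.
  exists l, q, (\val phi), K'; split => //; first by move=> y [].
  by rewrite K'L.
(* the two maxima of the Whitney seminorm change by at most (1 + C) D each *)
have [D D0 HD] : exists2 D : R, 0 < D & 2 * ((1 + C) * D) <=
    e - whitney_seminorm l q K (rho f phi - x).
  pose r := e - whitney_seminorm l q K (rho f phi - x).
  have r0 : 0 < r by rewrite subr_gt0.
  have C1 : 0 < 1 + C by rewrite ltr_pwDl.
  exists (r / (2 * (1 + C))); first by rewrite divr_gt0// mulr_gt0.
  by rewrite le_eqVlt; apply/orP; left; apply/eqP; rewrite -/r; field; rewrite gt_eqF.
have P0 : P 0 = 0.
  apply/eqP; rewrite eq_le; apply/andP; split; last exact: bigmax_ge_id.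
  have Xff := smooth_functionsB Xf Xf; rewrite subrr in Xff.
  apply: bigmax_le => // a _; apply: sup_image_le => // v Lv.
  have := (smooth_jets_linear (-1) Ap Xf Xf).2 a v (LV v Lv).
  by rewrite scaleN1r addNr => ->; rewrite scaleN1r addNr csemi0.
have := seminorm_ball_nbhs Xf Pp P0 D0; rewrite /within/=.
apply: filterS => g /= Pg Xg; rewrite /smooth_space.
have Xgf := smooth_functionsB Xf Xg.
have [hJ _] := smooth_jets Atl_smooth Eh Ap Xgf.
set J := partial _ _ in hJ.
have PJ0 : 0 <= P (g - f) by exact: bigmax_ge_id.
have PJ b z : (mdeg b <= l)%N -> L z -> q (J b z) <= P (g - f).
  by move=> bl Lz; exact: smooth_seminorm_bound.
have rgf : rho g phi - x = (rho f phi - x) + rho (g - f) phi.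
  by rewrite restrictionB// -[(rho g - rho f) phi]/(rho g phi - rho f phi) [RHS]addrC addrA subrK.
have W' a : (mdeg a <= l)%N ->
    (forall v, K v -> q ((rho g phi - x) a v) <= q ((rho f phi - x) a v) + (1 + C) * P (g - f)) /\
    forall v w, K v -> K w -> v <> w ->
      q (remainder (rho g phi - x) l a w v) / euclidean_norm (v - w) ^+ (l - mdeg a) <=
      q (remainder (rho f phi - x) l a w v) / euclidean_norm (v - w) ^+ (l - mdeg a) +
        (1 + C) * P (g - f).
  move=> al; split=> [v Kv|v w Kv Kw vw].
    rewrite rgf -[(_ + rho _ _) a v]/((rho f phi - x) a v + rho (g - f) phi a v).
    apply: le_trans (csemiD _ _ qs) _; rewrite lerD2l restriction_mapE; last exact: KB.
    apply: le_trans (PJ a v al (KL _ Kv)) _.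
    by rewrite mulrDl mul1r lerDl mulr_ge0.
  have e1 : remainder (rho g phi - x) l a w v =
      remainder (rho f phi - x) l a w v + remainder (rho (g - f) phi) l a w v.
    have -> : rho (g - f) phi = (rho g phi - x) - (rho f phi - x) by rewrite rgf addrAC subrr add0r.
    by rewrite [in RHS]remainderB [RHS]addrC subrK.
  have vw' : v != w by exact/eqP.
  have evw : 0 < euclidean_norm (v - w) by rewrite euclidean_gt0 subr_eq0.
  rewrite e1; apply: le_trans (ler_wpM2r _ (csemiD _ _ qs)) _.
    by rewrite invr_ge0 exprn_ge0// ltW.
  rewrite mulrDl lerD2l ler_pdivrMr ?exprn_gt0// restriction_remainder; [|exact: KB..].
  apply: le_trans (HC J _ hJ PJ0 PJ a v w al Kv Kw vw') _.
  apply: ler_pM; rewrite ?mulr_ge0 ?exprn_ge0//.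
    by rewrite ler_wpM2r// lerDr.
  by rewrite lerXn2r ?nnegrE// ?(ltW evw)// norm_le_euclidean.
have Wfx : whitney_jets E (jet_dom A (\val phi)) (rho f phi - x).
  have Wf := restriction_whitney phi Xf; split=> [a v nv|l' a q' K0 e' al qs' Kc0 KB0 e'0].
    by rewrite -[(_ - x) a v]/(rho f phi a v - x a v) Wf.1// Wx.1// subrr.
  have e2 : 0 < e' / 2 by exact: divr_gt0.
  have [d1 d10 h1] := Wf.2 l' a q' K0 _ al qs' Kc0 KB0 e2.
  have [d2 d20 h2] := Wx.2 l' a q' K0 _ al qs' Kc0 KB0 e2.
  exists (Num.min d1 d2); first by rewrite lt_min d10.
  move=> v w Kv Kw; rewrite lt_min => /and3P[vw0 vd1 vd2].
  rewrite remainderB; apply: le_trans (csemiB _ _ qs') _.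
  have := h1 v w Kv Kw; rewrite vw0 vd1 => /(_ isT) H1.
  have := h2 v w Kv Kw; rewrite vw0 vd2 => /(_ isT) H2.
  by rewrite [e']splitr mulrDl lerD.
have [B B0 HB] := whitney_bounded l Wfx Kc KB qs.
have eta0 : 0 <= (1 + C) * P (g - f) by rewrite mulr_ge0// addr_ge0.
apply: le_lt_trans (whitney_seminorm_le eta0 HB W') _.
rewrite -ltrBrDl; apply: lt_le_trans HD.
by rewrite ltr_pM2l// ltr_pM2l// ltr_pwDl.
Qed.

End RestrictionMap.

(** * Local computation of derivatives in charts *)

Section LocalJets.
Variables (R : realType) (n : nat) (M : topologicalType) (Atl : set (chart R n M)).
Hypothesis Atl_smooth : smooth_atlas Atl.
Implicit Types (phi psi : chart R n M) (x y : M) (s : seq 'I_n).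

Let isc phi : Atl phi -> is_chart phi. Proof. by case: Atl_smooth => + _ _; apply. Qed.

Lemma chart_dense phi (W : set 'rV[R]_n) : Atl phi -> open W ->
  dense_interior (chart_cod phi `&` W).
Proof. by move=> /isc[_ [_ dV] _ _ _]; exact: dense_interior_openI. Qed.

Section OneSpace.
Variable E : tvsType R.
Implicit Types (f g : M -> E) (L : seq 'I_n -> 'rV[R]_n -> E).

(** L is a jet, near phi x, of f expressed in the chart phi. *)
Definition local_jet phi x f L := exists2 W : set 'rV[R]_n, open W /\ W (phi x) &
  LJ (chart_cod phi `&` W) L /\
  forall y, chart_dom phi y -> W (phi y) -> L [::] (phi y) = f y.

Lemma local_jet_near phi x f g L : Atl phi -> chart_dom phi x ->
  (\forall y \near x, f y = g y) -> local_jet phi x f L -> local_jet phi x g L.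
Proof.
move=> Ap dx fg [W [oW Wx] [hL L0]].
have [O [oO Ox] Ofg] : exists2 O, open_nbhs x O & O `<=` [set y | f y = g y].
  by have := fg; rewrite /prop_near1/= nbhsE.
have [W' oW' OW'] := chart_open (isc Ap) oO.
have W'x : (chart_cod phi `&` W') (phi x) by rewrite -OW'; exists x.
exists (W `&` W'); first by split; [exact: openI|split => //; exact: W'x.2].
split; first by apply: LJ_sub hL => v [Vv []].
move=> y dy [Wy W'y]; rewrite L0//.
have : (chart_cod phi `&` W') (phi y) by split => //; exists y.
rewrite -OW' => -[z [Oz dz] zy]; have [_ _ [inj _] _ _] := isc Ap.
by rewrite -(inj z y (mem_set dz) (mem_set dy) zy); exact: Ofg.
Qed.

Lemma local_jet_zero phi x : local_jet phi x (fun=> 0 : E) (fun _ _ => 0).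
Proof.
exists setT; first by split => //; exact: openT.
split => //; apply: LJ_mk => [s|s i y _]; first exact: cont_in_cst.
exact: dder_cst.
Qed.

Lemma local_jet_add phi x f g L L' : local_jet phi x f L -> local_jet phi x g L' ->
  local_jet phi x (fun y => f y + g y) (fun s v => L s v + L' s v).
Proof.
move=> [W [oW Wx] [hL L0]] [W' [oW' Wx'] [hL' L0']].
exists (W `&` W'); first by split => //; exact: openI.
split; last by move=> y dy [Wy Wy']; rewrite L0// L0'.
by move=> k; apply: LJk_add; [apply: (LJ_sub _ hL)|apply: (LJ_sub _ hL')] => v [Vv []].
Qed.

Lemma local_jet_sum (I : Type) (r : seq I) phi x (f : I -> M -> E)
    (L : I -> seq 'I_n -> 'rV[R]_n -> E) :
  (forall i, local_jet phi x (f i) (L i)) ->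
  local_jet phi x (fun y => \sum_(i <- r) f i y) (fun s v => \sum_(i <- r) L i s v).
Proof.
move=> fL; elim: r => [|i r IH].
  have [W Wx [hL L0]] := local_jet_zero phi x; exists W => //; split.
    by apply: LJ_eq hL => s y _; rewrite big_nil.
  by move=> y _ _; rewrite !big_nil.
have [W Wx [hL L0]] := local_jet_add (fL i) IH; exists W => //; split.
  by apply: LJ_eq hL => s y _; rewrite big_cons.
by move=> y dy Wy; rewrite !big_cons L0.
Qed.

Hypothesis Eh : hausdorff_space E.

Lemma local_jet_unique phi x f L L' s : Atl phi -> chart_dom phi x ->
  local_jet phi x f L -> local_jet phi x f L' -> L s (phi x) = L' s (phi x).
Proof.
move=> Ap dx [W [oW Wx] [hL L0]] [W' [oW' Wx'] [hL' L0']].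
have oWW : open (W `&` W') by exact: openI.
apply: (LJ_unique Eh (chart_dense Ap oWW)).
- by apply: (LJ_sub _ hL) => v [Vv []].
- by apply: (LJ_sub _ hL') => v [Vv []].
- by move=> _ [[y dy <-] [Wy Wy']]; rewrite L0// L0'.
- by split => //; exists x.
Qed.

Lemma local_jet_smooth phi x f : Atl phi -> smooth_functions Atl E f ->
  local_jet phi x f (fun s => partial (chart_cod phi) (in_chart phi f) (mnms s)).
Proof.
move=> Ap Xf; have [hJ h0] := smooth_jets Atl_smooth Eh Ap Xf.
exists setT; first by split => //; exact: openT.
split; first by apply: (LJ_sub _ hJ) => v [].
by move=> y dy _; rewrite mnms_nil h0.
Qed.

(** Since jets of a given function agree on the dense interior, locally chosen
jets fit together. *)
Lemma smooth_of_local f : (forall phi x, Atl phi -> chart_dom phi x ->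
    exists L, local_jet phi x f L) -> smooth_functions Atl E f.
Proof.
move=> H.
have sm phi : Atl phi -> exists L, is_jet_of (chart_cod phi) (in_chart phi f) L.
  move=> Ap.
  have /choice[L HL] (v : 'rV[R]_n) : exists L, forall x, chart_dom phi x -> phi x = v ->
      local_jet phi x f L.
    have [[x dx xv]|nV] := pselect (chart_cod phi v); last first.
      by exists (fun _ _ => 0) => x dx xv; exfalso; apply: nV; exists x.
    have [L HL] := H phi x Ap dx; exists L => y dy yv.
    have [_ _ [inj _] _ _] := isc Ap.
    by rewrite (inj y x (mem_set dy) (mem_set dx))// yv xv.
  pose T s v := L v s v.
  have T0 x : chart_dom phi x -> T [::] (phi x) = f x.
    by move=> dx; have [W [oW Wx] [_ L0]] := HL _ x dx erefl; exact: L0.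
  have Tloc x : chart_dom phi x -> exists2 W : set 'rV[R]_n, open W /\ W (phi x) &
      LJ (chart_cod phi `&` W) (L (phi x)) /\
      forall s v, chart_cod phi v -> W v -> T s v = L (phi x) s v.
    move=> dx; have [W [oW Wx] [hL L0]] := HL _ x dx erefl.
    exists W => //; split => // s _ [y dy <-] Wy.
    apply: (@local_jet_unique phi y f (L (phi y)) (L (phi x)) s Ap dy); first exact: HL.
    by exists W.
  exists T; split; last by move=> _ [x dx <-]; rewrite T0// in_chartE//; exact: isc.
  apply: LJ_mk => [s|s i v iv].
    apply/cont_inP => _ q e [x dx <-] qs e0.
    have [W [oW Wx] [hL TL]] := Tloc x dx.
    have VWx : (chart_cod phi `&` W) (phi x) by split => //; exists x.
    have := cont_in_near (LJ_cont s hL) qs VWx e0.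
    apply: filterS2 (open_nbhs_nbhs (conj oW Wx)) => v Wv Hv Vv.
    by rewrite (TL s v Vv Wv) (TL s _ VWx.1 Wx); apply: Hv.
  have [x dx xv] := interior_subset iv; rewrite -xv in iv *.
  have [W [oW Wx] [hL TL]] := Tloc x dx.
  have iVW : (chart_cod phi `&` W)° (phi x).
    by rewrite interiorI; split => //; exact: open_nbhs_nbhs.
  have VWx := interior_subset iVW.
  rewrite (TL (rcons s i) _ VWx.1 Wx).
  apply: (dder_near _ (LJ_dder s i hL iVW)).
  by apply: filterS iVW => w [Vw Ww]; rewrite TL.
split; last by move=> phi Ap; have [L hL] := sm phi Ap; exact: jet_smooth_on hL.
move=> x; have [_ /(_ x)[phi Ap dx] _] := Atl_smooth.
have [L [hL L0]] := sm phi Ap; have [od _ _ _ _] := isc Ap.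
have c0 := LJ_cont [::] hL; apply/csemi_cvgP => q qs e e0.
have Vx : chart_cod phi (phi x) by exists x.
have := chart_continuous (isc Ap) dx (cont_in_near c0 qs Vx e0).
rewrite !nbhs_simpl/= => H1.
apply: filterS2 H1 (open_nbhs_nbhs (conj od dx)) => y /= Hy dy.
have Vy : chart_cod phi (phi y) by exists y.
by have := Hy Vy; rewrite !L0// !in_chartE//; exact: isc.
Qed.

Lemma smooth_local_partial phi x f L s : Atl phi -> chart_dom phi x ->
  smooth_functions Atl E f -> local_jet phi x f L ->
  partial (chart_cod phi) (in_chart phi f) (mnms s) (phi x) = L s (phi x).
Proof.
move=> Ap dx Xf; have := local_jet_smooth x Ap Xf.
exact: local_jet_unique.
Qed.

Lemma local_jet_pullback phi psi x J f : Atl phi -> Atl psi ->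
  chart_dom phi x -> chart_dom psi x -> MJ (chart_cod psi) J ->
  (forall y, chart_dom psi y -> f y = J mnm0 (psi y)) ->
  local_jet phi x f (fun s => pullback (overlap phi psi) (in_chart phi psi) J (mnms s)).
Proof.
move=> Ap Aq dx dx' hJ fJ; have [W oW eW] := overlap_open Atl_smooth Ap Aq.
have [hL L0] := pullback_jet Atl_smooth Eh Ap Aq hJ (fun x dx => esym (fJ x dx)).
have Ox : overlap phi psi (phi x) by exists x.
exists W; first by split => //; rewrite eW in Ox; exact: Ox.2.
split; first by rewrite -eW.
move=> y dy Wy; have Oy : overlap phi psi (phi y) by rewrite eW; split => //; exists y.
by rewrite L0// in_chartE//; exact: isc.
Qed.

(** Off the closed set S, the zero jet is a local jet of f. *)
Lemma smooth_of_support f (S : set M) : closed S -> (forall x, ~ S x -> f x = 0) ->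
  (forall phi x, Atl phi -> chart_dom phi x -> S x -> exists L, local_jet phi x f L) ->
  smooth_functions Atl E f.
Proof.
move=> cS f0 H; apply: smooth_of_local => phi x Ap dx.
have [Sx|nSx] := pselect (S x); first exact: H.
exists (fun _ _ => 0); apply: local_jet_near (local_jet_zero phi x) => //.
have : \forall y \near x, (~` S) y by apply: open_nbhs_nbhs; split => //; exact: closed_openC.
by apply: filterS => y /f0.
Qed.

Lemma smooth_cst (c : E) : smooth_functions Atl E (fun=> c).
Proof.
apply: smooth_of_local => phi x _ _; exists (fun s _ => if s is [::] then c else 0).
exists setT; first by split => //; exact: openT.
split => //; apply: LJ_mk => [s|s i y _]; first exact: cont_in_cst.
by case: s => [|j s]; exact: dder_cst.
Qed.

Lemma smooth_add f g : smooth_functions Atl E f -> smooth_functions Atl E g ->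
  smooth_functions Atl E (fun x => f x + g x).
Proof.
move=> Xf Xg; apply: smooth_of_local => phi x Ap dx; eexists.
by apply: local_jet_add; exact: local_jet_smooth.
Qed.

End OneSpace.

Lemma local_jet_prod (E : tvsType R) phi x (h : M -> R^o) (f : M -> E) H L :
  local_jet phi x h H -> local_jet phi x f L ->
  local_jet phi x (fun y => h y *: f y) (prodL H L).
Proof.
move=> [W [oW Wx] [hL L0]] [W' [oW' Wx'] [hL' L0']].
exists (W `&` W'); first by split => //; exact: openI.
split; last by move=> y dy [Wy Wy']; rewrite /prodL/= L0// L0'.
by apply: LJ_prod; [apply: (LJ_sub _ hL)|apply: (LJ_sub _ hL')] => v [Vv []].
Qed.

Lemma smooth_scale (E : tvsType R) (h : M -> R^o) (f : M -> E) : hausdorff_space E ->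
  smooth_functions Atl R^o h -> smooth_functions Atl E f ->
  smooth_functions Atl E (fun x => h x *: f x).
Proof.
move=> Eh Xh Xf; apply: (smooth_of_local Eh) => phi x Ap dx.
have hH := local_jet_smooth (@norm_hausdorff _ _) x Ap Xh.
by eexists; exact: local_jet_prod hH (local_jet_smooth Eh x Ap Xf).
Qed.

End LocalJets.

(** * Gluing the extensions obtained in charts *)

(** A locally finite family of smooth functions with sum 1 near A, each supported in one
chart domain and meeting A in a compact set, on which the extension theorem applies. Local
finiteness is expressed with sequences s over which the sums are taken. *)
Definition adapted_partition (R : realType) (n : nat) (M : topologicalType)
    (Atl : set (chart R n M)) (A : set M) (J : choiceType) (h : J -> M -> R)
    (phi : J -> chart R n M) (K : J -> set M) : Prop :=
  [/\ forall j, smooth_functions Atl R^o (h j),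
      forall j, Atl (phi j),
      forall j, compact (K j) /\ K j `<=` A `&` chart_dom (phi j),
      forall j, supp (h j) `<=` chart_dom (phi j) /\ supp (h j) `&` A `<=` K j &
      forall x, exists N s, [/\ nbhs x N, uniq s,
        forall j, supp (h j) `&` N !=set0 -> j \in s &
        A x -> forall y, N y -> \sum_(j <- s) h j y = 1]].

Section Surjectivity.
Variables (R : realType) (E : tvsType R) (n : nat) (M : topologicalType).
Variables (Atl : set (chart R n M)) (A : set M).
Hypothesis Eh : hausdorff_space E.
Hypothesis Em : metrizable R E.
Hypothesis Atl_smooth : smooth_atlas Atl.

Let isc phi : Atl phi -> is_chart phi. Proof. by case: Atl_smooth => + _ _; apply. Qed.
Let inAtl (phi : Atl) : Atl (\val phi). Proof. exact: set_mem (valP phi). Qed.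

(** The part K of A is seen in one chart, where Whitney's extension theorem applies. *)
Lemma chart_extension (phi : Atl) (f : jet R n E) (K : set M) :
  whitney_jets E (jet_dom A (\val phi)) f -> compact K -> K `<=` A `&` chart_dom (\val phi) ->
  exists J : jet R n E, MJ (chart_cod (\val phi)) J /\
    forall a x, K x -> J a (\val phi x) = f a (\val phi x).
Proof.
move=> Wf Kc KA; have Kc' : compact ((\val phi) @` K).
  apply: continuous_compact => //; apply/subspace_continuousP => x Kx.
  apply: cvg_within_filter; apply: chart_continuous; first exact: isc.
  exact: (KA _ Kx).2.
have KB : (\val phi) @` K `<=` jet_dom A (\val phi) by move=> _ [x Kx <-]; exists x => //; exact: KA.
have [L [hL HL]] := whitney_extension Em Kc' (whitney_jets_norm Wf Kc' KB).
have dT : dense_interior (setT : set 'rV[R]_n) by rewrite /dense_interior interiorT; exact: subset_closure.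
exists (fun a => L (mnm_seq a)); split; last first.
  by move=> a x Kx; rewrite HL ?mnms_seq//; exists x.
apply: (LJ_sub (@subsetT _ _)); apply: (LJ_eq _ hL) => s x _.
by apply: (LJ_perm Eh dT hL) => //; rewrite perm_sym; exact: mnm_seqK.
Qed.

Variables (J : choiceType) (h : J -> M -> R) (phi_ : J -> chart R n M) (K : J -> set M).
Hypothesis adapted : adapted_partition Atl A h phi_ K.

(** Near a point of A the glued function is a finite sum of products h_j g_j, where g_j
has the prescribed jet at the points of the support of h_j in A. By Leibniz' rule the jet of
the sum is the product of the jet of the sum of the h_j, which is that of 1, with the
prescribed jet. *)
Lemma restriction_surj : set_surj (smooth_functions Atl E) (manifold_jets Atl E A)
  (restriction_map Atl E A).
Proof.
have [hs Aphi KA sh lf] := adapted.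
move=> f [Wf cf]; pose ph j : Atl := exist _ (phi_ j) (mem_set (Aphi j)).
have /choice[G HG] j : exists G : jet R n E, MJ (chart_cod (phi_ j)) G /\
    forall a x, K j x -> G a (phi_ j x) = f (ph j) a (phi_ j x).
  exact: (@chart_extension (ph j) _ _ (Wf (ph j)) (KA j).1 (KA j).2).
pose g j := patch (fun=> 0) (chart_dom (phi_ j)) (fun x => G j mnm0 (phi_ j x)).
have gE j x : chart_dom (phi_ j) x -> g j x = G j mnm0 (phi_ j x).
  by move=> dx; rewrite /g patchT// mem_set.
pose u j x := h j x *: g j x.
pose P (phi : chart R n M) j s := pullback (overlap phi (phi_ j)) (in_chart phi (phi_ j)) (G j) (mnms s).
pose H (phi : chart R n M) j s := partial (chart_cod phi) (in_chart phi (h j : M -> R^o)) (mnms s).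
have R_h : hausdorff_space R^o by exact: norm_hausdorff.
have hout j x : ~ supp (h j) x -> h j x = 0.
  by move=> nx; apply: contrapT => /eqP hx; apply: nx; exact: subset_closure.
have lu phi j x : Atl phi -> chart_dom phi x -> chart_dom (phi_ j) x ->
    local_jet phi x (u j) (prodL (H phi j) (P phi j)).
  move=> Ap dx dx'; apply: local_jet_prod; first exact: (local_jet_smooth Atl_smooth R_h x Ap (hs j)).
  exact: (local_jet_pullback Atl_smooth Eh Ap (Aphi j) dx dx' (HG j).1 (gE j)).
have Xu j : smooth_functions Atl E (u j).
  apply: (smooth_of_support Atl_smooth Eh (@closed_closure _ _) (S := supp (h j))).
    by move=> x /hout; rewrite /u => ->; rewrite scale0r.
  by move=> phi x Ap dx Sx; eexists; apply: lu => //; exact: (sh j).1.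
pose F x : E := \sum_(j \in setT) u j x.
have FE x : exists N s, [/\ nbhs x N, uniq s, (forall j, supp (h j) `&` N !=set0 -> j \in s),
    (A x -> forall y, N y -> \sum_(j <- s) h j y = 1) &
    forall y, N y -> F y = \sum_(j <- s) u j y].
  have [N [s [xN us Ns s1]]] := lf x; exists N, s; split => // y Ny.
  rewrite /F (@fsbigE _ _ _ _ setT s)//.
    by apply: eq_bigl => j; rewrite in_setT.
  move=> j _ /negP js; rewrite /u hout ?scale0r// => Sj.
  by apply: js; apply: Ns; exists y.
have lF phi x : Atl phi -> chart_dom phi x -> forall N s, nbhs x N ->
    (forall y, N y -> F y = \sum_(j <- s) u j y) ->
    local_jet phi x F (fun t v => \sum_(j <- s)
      partial (chart_cod phi) (in_chart phi (u j)) (mnms t) v).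
  move=> Ap dx N s xN Fs; apply: (local_jet_near Atl_smooth Ap dx) (local_jet_sum _ _).
    by apply: filterS xN => y /Fs ->.
  by move=> j; exact: (local_jet_smooth Atl_smooth Eh x Ap (Xu j)).
have XF : smooth_functions Atl E F.
  apply: (smooth_of_local Atl_smooth Eh) => phi x Ap dx.
  have [N [s [xN _ _ _ Fs]]] := FE x; eexists; exact: lF Fs.
exists F => //; apply/funext => phi; apply/funext => a; apply/funext => v.
have [[x [Ax dx] <-]|nv] := pselect (jet_dom A (\val phi) v); last first.
  by rewrite restriction_map_out// (Wf phi).1.
have Ap := inAtl phi.
rewrite restriction_mapE; last by exists x.
have [N [s [xN us Ns /(_ Ax) s1 Fs]]] := FE x.
have H0 j t : ~ supp (h j) x -> H (\val phi) j t (\val phi x) = 0.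
  move=> nx; rewrite /H (smooth_local_partial Atl_smooth R_h t Ap dx (hs j) (L := fun _ _ => 0))//.
  apply: (local_jet_near Atl_smooth Ap dx _ (local_jet_zero _ _ _)).
  have : \forall y \near x, (~` supp (h j)) y.
    by apply: open_nbhs_nbhs; split => //; apply: closed_openC; exact: closed_closure.
  by apply: filterS => y /hout.
have term j : partial (chart_cod (\val phi)) (in_chart (\val phi) (u j)) a (\val phi x) =
    prodv (H (\val phi) j ^~ (\val phi x)) (fun t => f phi (mnms t) (\val phi x)) (mnm_seq a).
  rewrite -{1}(mnms_seq a); have [Sx|nSx] := pselect (supp (h j) x); last first.
    rewrite (smooth_local_partial Atl_smooth Eh _ Ap dx (Xu j) (L := fun _ _ => 0)).
      by rewrite prodv0l// => t; exact: H0.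
    apply: (local_jet_near Atl_smooth Ap dx _ (local_jet_zero _ _ _)).
    have : \forall y \near x, (~` supp (h j)) y.
      by apply: open_nbhs_nbhs; split => //; apply: closed_openC; exact: closed_closure.
    by apply: filterS => y /hout; rewrite /u => ->; rewrite scale0r.
  have dx' := (sh j).1 _ Sx.
  rewrite (smooth_local_partial Atl_smooth Eh _ Ap dx (Xu j) (lu _ j x Ap dx dx')).
  apply: prodv_ext => // t _; rewrite -(cf phi (ph j)); last by exists x.
  rewrite /P /pullback; apply: eq_bigr => b _; congr (_ *: _).
  rewrite in_chartE//; last exact: isc.
  by apply: (HG j).2; apply: (sh j).2.
rewrite -(mnms_seq a) (smooth_local_partial Atl_smooth Eh _ Ap dx XF (lF _ _ Ap dx N s xN Fs)).
rewrite mnms_seq (eq_bigr _ (fun j _ => term j)) -prodv_suml prodv1l ?mnms_seq// => t.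
have hl : local_jet (\val phi) x (fun y => \sum_(j <- s) h j y : R^o)
    (fun t v => \sum_(j <- s) H (\val phi) j t v).
  by apply: local_jet_sum => j; exact: (local_jet_smooth Atl_smooth R_h x Ap (hs j)).
have h1 : local_jet (\val phi) x (fun y => \sum_(j <- s) h j y : R^o) (fun t _ => one_jet R t).
  apply: (local_jet_near (f := fun=> 1 : R^o) Atl_smooth Ap dx).
    by apply: filterS xN => y /s1.
  exists setT; first by split => //; exact: openT.
  by split; [exact: LJ_one|].
exact: (local_jet_unique Atl_smooth R_h t Ap dx hl h1).
Qed.

End Surjectivity.

(** * Partitions of unity near a closed set *)

Section AdaptedPartitions.
Variables (R : realType) (n : nat) (M : topologicalType).
Variables (Atl : set (chart R n M)) (A : set M).
Hypothesis Atl_smooth : smooth_atlas Atl.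

Let isc phi : Atl phi -> is_chart phi. Proof. by case: Atl_smooth => + _ _; apply. Qed.

(** A compact neighbourhood in the subspace A, seen in M. *)
Lemma locally_compact_trace (x : A) : locally_compact [set: A] ->
  exists (O : set M) (C : set M), [/\ open O, O (\val x), compact C & O `&` A `<=` C] /\ C `<=` A.
Proof.
move=> lA; have [U xU [cU _]] := lA x I.
have : nbhs x U by move: xU; rewrite /within/=; apply: filterS => y; exact.
rewrite nbhsE => -[_ [[O oO <-] Ox] OU].
exists O, (set_val @` U); split; last by move=> _ [y _ <-]; exact: set_mem (valP y).
split => //; last first.
  by move=> y [Oy Ay]; exists (exist _ y (mem_set Ay)) => //; exact: OU.
apply: continuous_compact => //.
by apply: continuous_subspaceT; exact: initial_continuous.
Qed.

(** A partition of unity subordinate to small parts of chart domains whose traces on A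
are relatively compact, together with the complement of A. The member supported off A
vanishes near A and is dropped. *)
Lemma paracompact_partition : closed A -> smoothly_paracompact Atl ->
  locally_compact [set: A] ->
  exists (J : choiceType) (h : J -> M -> R) phi K, adapted_partition Atl A h phi K.
Proof.
move=> cA pM lA; have [_ cover _] := Atl_smooth.
have /choice[phi Hphi] (x : A) : exists phi, Atl phi /\ chart_dom phi (\val x).
  by have [phi Ap dx] := cover (\val x); exists phi.
have /choice[O HO] (x : A) : exists O : set M, exists C : set M,
    [/\ open O, O (\val x), compact C & O `&` A `<=` C] /\ C `<=` A.
  exact: locally_compact_trace.
have {HO}/choice[C HC] := HO.
pose U (j : option A) := if j is Some a then chart_dom (phi a) `&` O a else ~` A.
have oU j : open (U j).
  case: j => [a|]; last exact: closed_openC.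
  by apply: openI; [have [] := isc (Hphi a).1|have [[]] := HC a].
have cU : \bigcup_j U j = setT.
  apply/seteqP; split => // x _; have [Ax|nAx] := pselect (A x); last by exists None.
  exists (Some (exist _ x (mem_set Ax))) => //=; split; first exact: (Hphi _).2.
  by have [[]] := HC (exist _ x (mem_set Ax)).
have [h [hs _ lf h1 hU]] := pM _ U oU cU.
exists A, (fun a => h (Some a)), phi, (fun a => C a `&` supp (h (Some a))).
have sU a := hU (Some a); split => //.
- by move=> a; exact: (Hphi a).1.
- move=> a; have [[_ _ cC _] CA] := HC a; split.
    by apply: compact_closedI => //; exact: closed_closure.
  by move=> x [Cx /sU[dx _]]; split => //; exact: CA.
- move=> a; split; first by move=> x /sU[].
  move=> x [Sx Ax]; split => //; have [[_ _ _ OC] _] := HC a.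
  by apply: OC; split => //; exact: (sU a x Sx).2.
move=> x; have [N xN /finite_seqP[s0 Hs0]] := lf x.
pose s := undup (pmap id s0).
exists (N `&` [set y | A x -> ~ supp (h None) y]), s.
have memS a y : N y -> supp (h (Some a)) y -> a \in s.
  move=> Ny Sy; rewrite mem_undup mem_pmap map_id.
  by have : [set` s0] (Some a) by rewrite -Hs0; exists y.
split.
- apply: filterI => //; have [Ax|nAx] := pselect (A x); last by apply: nearW => y /nAx.
  have : nbhs x (~` supp (h None)).
    apply: open_nbhs_nbhs; split; first by apply: closed_openC; exact: closed_closure.
    by move=> /hU.
  by apply: filterS => y ny _.
- exact: undup_uniq.
- by move=> a [y [Sy [Ny _]]]; exact: memS Ny Sy.
- move=> Ax y [Ny /(_ Ax) Sy]; rewrite -(h1 y) (@fsbigE _ _ _ _ setT (map Some s))//.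
  + rewrite big_map; apply: eq_bigl => j; by rewrite in_setT.
  + by rewrite map_inj_uniq ?undup_uniq// => ? ? [].
  + have hout j : ~ supp (h j) y -> h j y = 0.
      by move=> ny; apply: contrapT => /eqP hy; apply: ny; exact: subset_closure.
    case=> [a|] _ /negP js; apply: hout => // Sa; apply: js.
    by rewrite mem_map ?(memS a y)// => ? ? [].
Qed.

(** Regularity provides a closed neighbourhood S of x inside the chart domain; a bump in
the chart whose support is contained in the image of S extends by 0. *)
Lemma chart_bump (x : M) : regular_space M -> exists phi (g : M -> R),
  [/\ Atl phi, smooth_functions Atl R^o g, supp g `<=` chart_dom phi &
      \forall y \near x, g y = 1].
Proof.
move=> rM; have [_ /(_ x)[phi Ap dx] _] := Atl_smooth.
have [od _ [inj _] _ _] := isc Ap.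
have [B xB BD] : filter_from (nbhs x) closure (chart_dom phi).
  by apply: rM; exact: open_nbhs_nbhs.
have [W oW eW] := chart_open (isc Ap) (@open_interior _ B).
have Wx : (chart_cod phi `&` W) (phi x) by rewrite -eW; exists x => //; split.
have /nbhs_ballP[r /= r0 rW] : nbhs (phi x) W by exact: open_nbhs_nbhs (conj oW Wx.2).
have [w [wd wo _ ws]] := bump_exists R.
(* the bump is 1 for lam |v - phi x| <= 1 and 0 for lam |v - phi x| >= 2 *)
pose lam := 4 / r; have lam0 : 0 < lam by exact: divr_gt0.
pose cn (z : {ffun 'I_n -> 'I_3}) i := @grid R n 1 z i + lam * phi x 0 i.
pose L (s : seq 'I_n) v : R^o := \sum_z cube_bump w lam (cn z) s v.
have hL : LJ setT L by move=> k; apply: LJk_sum => z _; exact: LJ_cube_bump.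
have L1 v : lam * `|v - phi x| <= 1 -> L [::] v = 1.
  move=> vx; rewrite -(cube_bump_sum ws (N := 1) (lam := lam) (x := v - phi x)) ?(ltW lam0)//.
  apply: eq_bigr => z _; rewrite !cube_bump0; apply: eq_bigr => i _.
  by congr (w 0%N _); rewrite !mxE /cn; ring.
have L0 v : r <= `|v - phi x| -> L [::] v = 0.
  move=> rv; apply: big1 => z _.
  have [i vi] : exists i, 2 <= `|lam * (v 0 i - phi x 0 i)|.
    apply: contrapT => /forallNP H; move: rv; rewrite leNgt => /negP; apply.
    apply: (@le_lt_trans _ _ (2 / lam)); last first.
      by rewrite ltr_pdivrMr// /lam mulrC divfK ?gt_eqF// ltr_nat.
    apply: rv_norm_le => [|i]; first by rewrite divr_ge0// ltW.
    have /negP := H i; rewrite -ltNge normrM gtr0_norm// !mxE => /ltW.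
    by rewrite ler_pdivlMr// mulrC.
  apply: (@cube_bump_out R n w wo lam (cn z) [::] v i).
  have g1 : `|@grid R n 1 z i| <= 1.
    rewrite /grid; case: (z i) => -[|[|[|//]]] ? /=; rewrite ?sub0r ?normrN ?subrr ?normr0 ?normr1//.
    by rewrite -natrB// normr1.
  rewrite /cn; set gz := grid R _ _ in g1 *.
  have -> : lam * v 0 i - (gz + lam * phi x 0 i) = lam * (v 0 i - phi x 0 i) - gz by ring.
  by have := lerB_dist (lam * (v 0 i - phi x 0 i)) gz; lra.
pose g := patch (fun=> 0) (chart_dom phi) (fun y => L [::] (phi y)) : M -> R^o.
have gE y : chart_dom phi y -> g y = L [::] (phi y) by move=> dy; rewrite /g patchT// mem_set.
have gS y : ~ closure B y -> g y = 0.
  move=> nBy; have [dy|ndy] := pselect (chart_dom phi y); last by rewrite /g /patch memNset.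
  rewrite gE//; apply: L0; rewrite leNgt; apply/negP => yr; apply: nBy.
  have : (chart_cod phi `&` W) (phi y).
    split; first by exists y.
    by apply: rW; rewrite -ball_normE/= distrC.
  rewrite -eW => -[z [Bz dz] zy].
  by rewrite -(inj z y (mem_set dz) (mem_set dy) zy); apply: subset_closure; exact: interior_subset.
have R_h : hausdorff_space R^o by exact: norm_hausdorff.
have dT : dense_interior (setT : set 'rV[R]_n) by rewrite /dense_interior interiorT; exact: subset_closure.
have hJ : MJ (chart_cod phi) (fun a => L (mnm_seq a)).
  apply: (LJ_sub (@subsetT _ _)); apply: (LJ_eq _ hL) => s v _.
  by apply: (LJ_perm R_h dT hL) => //; rewrite perm_sym; exact: mnm_seqK.
exists phi, g; split => //.
- apply: (smooth_of_support Atl_smooth R_h (@closed_closure _ B) gS) => psi y Aq dy Sy.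
  eexists; apply: (local_jet_pullback Atl_smooth R_h Aq Ap dy (BD _ Sy) hJ) => y' dy'.
  by rewrite gE// -[mnm0]mnms_nil; apply: (LJ_perm R_h dT hL); rewrite // perm_sym; exact: mnm_seqK.
- apply: subset_trans BD; rewrite /supp [X in _ `<=` X](iffLR (closure_id _) (@closed_closure _ B)).
  apply: closureS => y /eqP gy; apply: contrapT => /gS; exact: gy.
- have near1 : \forall v \near phi x, lam * `|v - phi x| <= 1.
    apply/nbhs_ballP; exists lam^-1 => /=; first by rewrite invr_gt0.
    by move=> v; rewrite -ball_normE/= distrC => /ltW; rewrite -(ler_pM2l lam0) mulfV ?gt_eqF.
  have := chart_continuous (isc Ap) dx near1; rewrite !nbhs_simpl/= => H1.
  by apply: filterS2 H1 (open_nbhs_nbhs (conj od dx)) => y /= Hy dy; rewrite gE// L1.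
Qed.

(** Finitely many bumps G_0, G_1, ... are equal to 1 on the members of an open cover of
A, and the functions G_i (1 - G_0) ... (1 - G_(i-1)) add up to 1 - (1 - G_0) (1 - G_1) ...,
which is 1 where one of the bumps is. *)
Lemma compact_partition : regular_space M -> compact A ->
  exists (J : choiceType) (h : J -> M -> R) phi K, adapted_partition Atl A h phi K.
Proof.
move=> rM Ac.
have /choice[phi /choice[g Hg]] (x : M) : exists phi, exists g : M -> R,
    [/\ Atl phi, smooth_functions Atl R^o g, supp g `<=` chart_dom phi &
        \forall y \near x, g y = 1] by exact: chart_bump.
pose O x := [set y | g x y = 1]°.
have xO x : O x x by have [] := Hg x.
have [r Ar] : exists r : seq M, forall y, A y -> exists2 z, z \in r & O z y.
  (* the filter of the sequences of points that contain any given one *)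
  pose F := filter_from setT (fun s : seq M => [set t : seq M | {subset s <= t}]).
  have FF : Filter F.
    apply: filter_from_filter; first by exists [::].
    move=> s t _ _; exists (s ++ t) => // u su; split=> z zs; apply: su; rewrite mem_cat zs//.
    exact: orbT.
  have [//|s _ Hs] := (compact_near_coveringP A).1 Ac _ F (fun (t : seq M) y => exists2 z, z \in t & O z y) FF.
    move=> x Ax; exists (O x, [set t : seq M | {subset [:: x] <= t}]).
      split; first exact: open_nbhs_nbhs (conj (@open_interior _ _) (xO x)).
      by exists [:: x].
    by move=> [y t] /= [Oy xt]; exists x => //; apply: xt; rewrite inE.
  by exists s => y; exact: (Hs s).
pose G k : M -> R^o := nth (fun=> 0) (map g r) k.
have R_h : hausdorff_space R^o by exact: norm_hausdorff.
have GE (i : 'I_(size r)) : G i = g (tnth (in_tuple r) i).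
  by have x0 := tnth (in_tuple r) i; rewrite /G (nth_map x0)// (tnth_nth x0).
have Gs k : smooth_functions Atl R^o (G k).
  have [kr|rk] := ltnP k (size r); first by rewrite (GE (Ordinal kr)); case: (Hg (tnth (in_tuple r) (Ordinal kr))).
  by rewrite /G nth_default ?size_map//; exact: smooth_cst.
pose P k (y : M) : R^o := \prod_(j < k) (1 - G j y).
have Ps k : smooth_functions Atl R^o (P k).
  elim: k => [|k IH].
    by rewrite (_ : P 0%N = fun=> 1); [exact: smooth_cst|apply/funext => y; rewrite /P big_ord0].
  rewrite (_ : P k.+1 = fun y => P k y *: (1 + -1 *: G k y : R^o)); last first.
    by apply/funext => y; rewrite /P big_ord_recr/= scaleN1r.
  apply: smooth_scale => //; apply: smooth_add => //; first exact: smooth_cst.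
  by apply: smooth_scale => //; exact: smooth_cst.
pose h (i : 'I_(size r)) y := G i y * P i y.
have hsum y m : \sum_(i < m) (G i y * P i y) = 1 - P m y.
  elim: m => [|m IH]; first by rewrite big_ord0 /P big_ord0 subrr.
  by rewrite big_ord_recr/= IH /P big_ord_recr/=; ring.
have sG i : supp (h i) `<=` supp (g (tnth (in_tuple r) i)).
  apply: closureS => y /= hy; apply: contraNneq hy => gy.
  by rewrite /h GE gy mul0r.
exists 'I_(size r), h, (fun i => phi (tnth (in_tuple r) i)), (fun i => A `&` supp (h i)).
split.
- by move=> i; apply: (@smooth_scale _ _ _ _ Atl_smooth R^o (G i) (P i)).
- by move=> i; case: (Hg (tnth (in_tuple r) i)).
- move=> i; split; first by apply: compact_closedI => //; exact: closed_closure.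
  by move=> y [Ay /sG]; case: (Hg (tnth (in_tuple r) i)) => _ _ H _ /H.
- move=> i; split; last by move=> y [].
  by move=> y /sG; case: (Hg (tnth (in_tuple r) i)) => _ _ H _ /H.
move=> x; exists [set y | A x -> \sum_(i < size r) h i y = 1], (enum 'I_(size r)).
split.
- have [Ax|nAx] := pselect (A x); last by apply: nearW => y /nAx.
  have [z zr' Oz] := Ar x Ax.
  apply: filterS (open_nbhs_nbhs (conj (@open_interior _ _) Oz)) => y /interior_subset/= gy _.
  have zr : (index z r < size r)%N by rewrite index_mem.
  rewrite hsum /P (bigD1 (Ordinal zr))//= /G (nth_map z)// nth_index// gy.
  by rewrite subrr mul0r subr0.
- exact: enum_uniq.
- by move=> j _; rewrite mem_enum.
- by move=> Ax y /(_ Ax) /= <-; rewrite big_enum.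
Qed.

End AdaptedPartitions.

Theorem mainTheorem6 (R : realType) (E : tvsType R) (n : nat)
    (M : topologicalType) (Atl : set (chart R n M)) (A : set M)
    (E_hausdorff : hausdorff_space E) (E_metrizable : metrizable R E)
    (M_manifold : rough_manifold Atl) (A_closed : closed A)
    (hyp : (smoothly_paracompact Atl /\ locally_compact [set: A]) \/
           (regular_space M /\ compact A)) :
  let X := smooth_functions Atl E in
  let Y := manifold_jets Atl E A in
  let rho := restriction_map Atl E A in
  [/\ set_fun X Y rho,
      forall (a : R) f g, X f -> X g -> rho (a *: f + g) = a *: rho f + rho g,
      {within (X : set (smooth_space Atl E)),
        continuous (rho : smooth_space Atl E -> jet_product_space Atl E A)} &
      set_surj X Y rho].
Proof.
case: M_manifold => _ Atl_smooth _ X Y rho.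
have [J [h [phi [K adapted]]]] : exists (J : choiceType) (h : J -> M -> R) phi K,
    adapted_partition Atl A h phi K.
  case: hyp => [[pM lA]|[rM Ac]]; last exact: compact_partition.
  exact: paracompact_partition.
split.
- move=> f Xf; split=> [psi|psi psi']; first exact: restriction_whitney.
  exact: restriction_correspond.
- by move=> a f g Xf Xg; exact: restriction_linear.
- exact: restriction_continuous.
- exact: restriction_surj adapted.
Qed.
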